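(* Let $\Bbbk$ be a perfect field, let $A$ be a finite-dimensional $\Bbbk$-algebra, let $n\geqslant1$ be an integer and let $X_1,\ldots,X_{n+1}\in\mathrm{ind}\,A$. The following conditions are equivalent: (a) there exist irreducible morphisms $X_1\xrightarrow{h_1}X_2\to\cdots\to X_n\xrightarrow{h_n}X_{n+1}$ such that $h_1\cdots h_n\in\mathrm{rad}^{n+1}\setminus\{0\}$; (b) there exist irreducible morphisms $f_i\colon X_i\to X_{i+1}$ and morphisms $\varepsilon_i\colon X_i\to X_{i+1}$, for every $i\in\{1,\ldots,n\}$, such that $f_1\cdots f_n=0$, such that $\varepsilon_1\cdots\varepsilon_n\neq0$ and such that, for every $i$, either $\varepsilon_i\in\mathrm{rad}^2$ or else $\varepsilon_i=f_i$.
   Context: Composition convention: for $f\colon X\to Y$ and $g\colon Y\to Z$ the composite is written $fg\colon X\to Z$. $\mathrm{mod}\,A$ is the category of finitely generated right $A$-modules and $\mathrm{ind}\,A$ is a full subcategory containing one representative of each isomorphism class of indecomposable $A$-modules. $\mathrm{rad}$ is the ideal of $\mathrm{mod}\,A$ generated by the non-invertible morphisms between indecomposable modules; its powers are $\mathrm{rad}^0=\mathrm{mod}\,A$ and $\mathrm{rad}^{m+1}=\mathrm{rad}\cdot\mathrm{rad}^m=\mathrm{rad}^m\cdot\mathrm{rad}$. A morphism $X\to Y$ between indecomposable modules is irreducible if and only if it lies in $\mathrm{rad}$ and not in $\mathrm{rad}^2$. *)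

(* Defs.v *)
From HB Require Import structures.
From mathcomp Require Import all_boot all_order all_algebra all_field.

Set Implicit Arguments.
Unset Strict Implicit.
Unset Printing Implicit Defensive.

Import GRing.Theory.

Local Open Scope ring_scope.

Definition perfect_field (k : fieldType) : Prop :=
  forall p : {poly k}, irreducible_poly p -> separable_poly p.

Definition finitely_generated (R : nzRingType) (M : lmodType R) : Prop :=
  exists (n : nat) (s : 'I_n -> M),
    forall x : M, exists c : 'I_n -> R, x = \sum_(i < n) c i *: s i.

(* A right A-module is a left module over the converse algebra A^c:
   for x in M and a, b in A, the right action x.a is a *: x, and
   (x.a).b = b *: (a *: x) = ((b : A^c) * a) *: x = (a * b : A) *: x = x.(ab). *)
Record modA (k : fieldType) (A : falgType k) := ModA {
  mod_car :> lmodType A^c;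
  mod_fg : finitely_generated mod_car
}.

Notation mhom X Y := {linear mod_car X -> mod_car Y}.

Section Modules.
Variables (k : fieldType) (A : falgType k).
Local Notation modA := (modA A).

(* Composites are written in diagrammatic order: mcomp f g is "f, then g".
   Morphisms are compared pointwise (=1) throughout. *)
Definition mcomp (X Y Z : modA) (f : mhom X Y) (g : mhom Y Z) : mhom X Z :=
  g \o f.

Definition mzero (X Y : modA) : mhom X Y := \0.

Definition madd (X Y : modA) (f g : mhom X Y) : mhom X Y := f \+ g.

Definition is_section (X Y : modA) (f : mhom X Y) : Prop :=
  exists g : mhom Y X, mcomp f g =1 id.

Definition is_retraction (X Y : modA) (f : mhom X Y) : Prop :=
  exists g : mhom Y X, mcomp g f =1 id.

Definition is_iso (X Y : modA) (f : mhom X Y) : Prop :=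
  exists g : mhom Y X, mcomp f g =1 id /\ mcomp g f =1 id.

Definition isomorphic (X Y : modA) : Prop := exists f : mhom X Y, is_iso f.

Definition is_zero_mod (X : modA) : Prop := forall x : X, x = 0.

Definition indecomposable (X : modA) : Prop :=
  ~ is_zero_mod X /\
  forall (Y Z : modA) (phi : {linear X -> (Y * Z)%type}),
    bijective phi -> is_zero_mod Y \/ is_zero_mod Z.

(* The objects of ind A: I contains exactly one representative of each
   isomorphism class of indecomposable modules. *)
Definition is_ind (I : modA -> Prop) : Prop :=
  [/\ forall X, I X -> indecomposable X,
      forall X, indecomposable X -> exists2 Y, I Y & isomorphic X Y
    & forall X Y, I X -> I Y -> isomorphic X Y -> X = Y].

Definition morph_class := forall X Y : modA, mhom X Y -> Prop.

(* The two-sided ideal of mod A generated by S. Closure under the scalars of k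
   is a case of closure under composition, since multiplication by a scalar is
   an endomorphism of every module. *)
Inductive ideal_gen (S : morph_class) : forall X Y : modA, mhom X Y -> Prop :=
| ideal_gen_in X Y (f : mhom X Y) : S X Y f -> ideal_gen S f
| ideal_gen_eq X Y (f g : mhom X Y) : ideal_gen S f -> f =1 g -> ideal_gen S g
| ideal_gen_zero X Y : ideal_gen S (mzero X Y)
| ideal_gen_add X Y (f g : mhom X Y) :
    ideal_gen S f -> ideal_gen S g -> ideal_gen S (madd f g)
| ideal_gen_compl W X Y (u : mhom W X) (f : mhom X Y) :
    ideal_gen S f -> ideal_gen S (mcomp u f)
| ideal_gen_compr X Y Z (f : mhom X Y) (v : mhom Y Z) :
    ideal_gen S f -> ideal_gen S (mcomp f v).

Definition ideal_mul (I J : morph_class) : morph_class :=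
  ideal_gen (fun X Y f => exists (Z : modA) (g : mhom X Z) (h : mhom Z Y),
    [/\ I X Z g, J Z Y h & f =1 mcomp g h]).

Definition rad : morph_class :=
  ideal_gen (fun X Y f =>
    [/\ indecomposable X, indecomposable Y & ~ is_iso f]).

Fixpoint rad_pow (m : nat) : morph_class :=
  if m is m'.+1 then ideal_mul rad (rad_pow m') else fun X Y f => True.

Definition irreducible_hom (X Y : modA) (f : mhom X Y) : Prop :=
  [/\ ~ is_section f,
      ~ is_retraction f
    & forall (Z : modA) (g : mhom X Z) (h : mhom Z Y),
        f =1 mcomp g h -> is_section g \/ is_retraction h].

(* The composite f_0 f_1 ... f_(n-1), from X_0 to X_n. *)
Fixpoint comp_seq (X : nat -> modA) (f : forall i, mhom (X i) (X i.+1)) (n : nat)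
    : mhom (X 0%N) (X n) :=
  if n is m.+1 then mcomp (comp_seq f m) (f m) else idfun.

End Modules.

(* Main.v *)
(* The radical of mod A has a complement K stable under composition, because k
   is perfect (Wedderburn's principal theorem). For Y in ind A, let e : E -> Y be
   a minimal right almost split map and s its kernel. Averaging with a Casimir
   element of the division algebra K(Y, Y) yields eps congruent to e modulo rad^2
   which exactly intertwines the actions of K(Y, Y) and K(E, E), and the kernel
   of eps can be prescribed among the maps s' congruent to s that are
   K-combinations of a previously chosen family of such maps. This gives families
   eps_0, eps_1, ... such that the kernels of the members of eps_(n+1) lie in the
   K-bimodule generated by eps_n. By induction on n, the composites of n maps
   taken from the bimodules of eps_0, ..., eps_(n-1) meet rad^(n+1) only in 0.
   Therefore, if h_1...h_n is in rad^(n+1), then the representatives f_i of h_i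
   modulo rad^2 in these bimodules satisfy f_1...f_n = 0.

   This gives (a) => (b) by expanding the nonzero product of the sums
   h_i = f_i + (h_i - f_i), and (b) => (a) by expanding the nonzero product of
   the sums eps_i = (f_i + eps_i) + (- f_i), for the i with eps_i in rad^2. *)

Require Import Defs.
From HB Require Import structures.
From mathcomp Require Import all_boot all_order all_algebra all_field.
From mathcomp Require Import ring zify.
From Stdlib Require Import ClassicalEpsilon.

Set Implicit Arguments.
Unset Strict Implicit.
Unset Printing Implicit Defensive.

Import GRing.Theory.
Local Open Scope ring_scope.

(** * Strictification of composites modulo powers of the radical *)

(** The obstacle is that a composite of chosen representatives can fall into a deeper power of the
    radical without being zero. Such a fall comes from a factorisation through the kernel [s] of an
    almost split map, and for arbitrary representatives this kernel is a combination of
    representatives only up to deeper terms, which survive in the composite. Asking one family of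
    almost split maps to have its kernels in its own bimodule is circular, since correcting the maps
    moves their kernels. Levels break the circle: the arrow in position i is represented at level i,
    and a kernel of level i+1 has to be a combination at level i only, where nothing changes any
    more. The ground field being perfect enters through the separability of the division algebras
    End(Y)/rad, which yields both the multiplicative complement [K] and the Casimir elements used
    for averaging. This section is linear algebra over abstract classes [R] and [K] of matrices; the
    later ones construct these classes for mod A. *)

Section Levels.

(** Matrices act on row vectors, so [f *m g] is f followed by g. [R n] stands for the n-th power of
    the radical, [K] for its complement in [R 0], and [I] for the objects of ind A. *)
Variables (k : fieldType) (O : Type) (d : O -> nat) (I : O -> Prop).
Variables (R : nat -> forall M N : O, 'M[k]_(d M, d N) -> Prop).
Variables (K : forall M N : O, 'M[k]_(d M, d N) -> Prop).
Arguments R _ {_ _}.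
Arguments K {_ _}.

Hypothesis R_0 : forall n M N, R n (0 : 'M_(d M, d N)).
Hypothesis R_D : forall n M N (f g : 'M_(d M, d N)), R n f -> R n g -> R n (f + g).
Hypothesis R_Z : forall n M N a (f : 'M_(d M, d N)), R n f -> R n (a *: f).
Hypothesis R_S : forall n M N (f : 'M_(d M, d N)), R n.+1 f -> R n f.
Hypothesis R_M : forall a b M N P (f : 'M_(d M, d N)) (g : 'M_(d N, d P)),
  R a f -> R b g -> R (a + b) (f *m g).
Hypothesis R_1 : forall M, R 0 (1%:M : 'M_(d M)).
Hypothesis R_inv : forall M (f : 'M_(d M)), R 0 f -> f \in unitmx -> R 0 (invmx f).
Hypothesis R_unit : forall M (f : 'M_(d M)), R 1 f -> 1%:M + f \in unitmx.

Hypothesis K_0 : forall M N, K (0 : 'M_(d M, d N)).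
Hypothesis K_D : forall M N (f g : 'M_(d M, d N)), K f -> K g -> K (f + g).
Hypothesis K_Z : forall M N a (f : 'M_(d M, d N)), K f -> K (a *: f).
Hypothesis K_M : forall M N P (f : 'M_(d M, d N)) (g : 'M_(d N, d P)),
  K f -> K g -> K (f *m g).
Hypothesis K_1 : forall M, K (1%:M : 'M_(d M)).
Hypothesis K_R : forall M N (f : 'M_(d M, d N)), K f -> R 0 f.
Hypothesis K_R1 : forall M N (f : 'M_(d M, d N)), K f -> R 1 f -> f = 0.
Hypothesis K_split : forall M N (f : 'M_(d M, d N)), R 0 f -> exists2 g, K g & R 1 (f - g).
Hypothesis K_ne : forall M N (f : 'M_(d M, d N)), I M -> I N -> K f -> f = 0 \/ M = N.
Hypothesis K_dec : forall N, exists (T : finType) (P : T -> O)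
  (p : forall i, 'M_(d N, d (P i))) (q : forall i, 'M_(d (P i), d N)),
  [/\ forall i, I (P i), forall i, K (p i), forall i, K (q i)
    & \sum_i p i *m q i = 1%:M].
Hypothesis K_casimir : forall M, I M -> exists m (x y : 'I_m -> 'M_(d M)),
  [/\ forall j, K (x j), forall j, K (y j), \sum_j x j *m y j = 1%:M
    & forall a : 'M_(d M), K a -> exists al : 'I_m -> 'I_m -> k,
       (forall j, a *m x j = \sum_l al j l *: x l) /\
       (forall l, y l *m a = \sum_j al j l *: y j)].

(** [e Y] stands for a minimal right almost split map ending at Y and [s Y] for its kernel.
    [s_cover] is the dual property of the kernel: radical maps out of [Z Y] extend along [s Y], with
    the expected loss of one degree. *)
Variables (E Z : O -> O) (e : forall Y, 'M[k]_(d (E Y), d Y))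
  (s : forall Y, 'M[k]_(d (Z Y), d (E Y))).
Hypothesis e_R : forall Y, I Y -> R 1 (e Y).
Hypothesis e_cover : forall Y, I Y -> forall n M (g : 'M_(d M, d Y)),
  R n.+1 g -> exists2 h, R n h & g = h *m e Y.
Hypothesis e_min : forall Y, I Y -> forall M (g : 'M_(d M, d (E Y))),
  R 0 g -> R 2 (g *m e Y) -> R 1 g.
Hypothesis s_R : forall Y, I Y -> R 1 (s Y).
Hypothesis s_free : forall Y, I Y -> row_free (s Y).
Hypothesis s_ker : forall Y, I Y -> forall M (g : 'M_(d M, d (E Y))),
  R 0 g -> g *m e Y = 0 -> exists2 c, R 0 c & g = c *m s Y.
Hypothesis s_e : forall Y, I Y -> s Y *m e Y = 0.
Hypothesis s_cover : forall Y, I Y -> forall n M (f : 'M_(d (Z Y), d M)),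
  R n.+1 f -> exists2 h, R n h & f = s Y *m h.

Lemma R_N n M N (f : 'M_(d M, d N)) : R n f -> R n (- f).
Proof. by move=> h; rewrite -scaleN1r; apply: R_Z. Qed.

Lemma R_B n M N (f g : 'M_(d M, d N)) : R n f -> R n g -> R n (f - g).
Proof. by move=> hf hg; apply: R_D => //; apply: R_N. Qed.

Lemma R_sub n M N (f g : 'M_(d M, d N)) : R n (f - g) -> R n g -> R n f.
Proof. by move=> h1 h2; rewrite -(subrK g f); apply: R_D. Qed.

Lemma R_subC n M N (f g : 'M_(d M, d N)) : R n (f - g) -> R n (g - f).
Proof. by move=> h; rewrite -opprB; apply: R_N. Qed.

Lemma R_le m n M N (f : 'M_(d M, d N)) : (m <= n)%N -> R n f -> R m f.
Proof.
move=> /subnK <-; elim: (n - m)%N => [|p IH] //=.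
by rewrite addSn => /R_S /IH.
Qed.

Lemma R_sum n M N (J : finType) (f : J -> 'M_(d M, d N)) :
  (forall i, R n (f i)) -> R n (\sum_i f i).
Proof. by move=> h; apply: (big_ind (R n (M := M) (N := N))) => // x y; apply: R_D. Qed.

Lemma R_Ml n a M N P (f : 'M_(d M, d N)) (g : 'M_(d N, d P)) :
  R a f -> R n g -> R n (f *m g).
Proof. by move=> ? ?; apply: (@R_le _ (a + n)); [exact: leq_addl|exact: R_M]. Qed.

Lemma R_Mr n b M N P (f : 'M_(d M, d N)) (g : 'M_(d N, d P)) :
  R n f -> R b g -> R n (f *m g).
Proof. by move=> ? ?; apply: (@R_le _ (n + b)); [exact: leq_addr|exact: R_M]. Qed.

Lemma R_M1 n M N P (f : 'M_(d M, d N)) (g : 'M_(d N, d P)) :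
  R n f -> R 1 g -> R n.+1 (f *m g).
Proof. by move=> Rf Rg; rewrite -(addn1 n); apply: R_M. Qed.

Lemma R_any n M N (f : 'M_(d M, d N)) : R n f -> R 0 f.
Proof. exact: R_le. Qed.

Lemma K_N M N (f : 'M_(d M, d N)) : K f -> K (- f).
Proof. by move=> h; rewrite -scaleN1r; apply: K_Z. Qed.

Lemma K_B M N (f g : 'M_(d M, d N)) : K f -> K g -> K (f - g).
Proof. by move=> hf hg; apply: K_D => //; apply: K_N. Qed.

Lemma K_sum M N (J : finType) (f : J -> 'M_(d M, d N)) :
  (forall i, K (f i)) -> K (\sum_i f i).
Proof. by move=> h; apply: (big_ind (@K M N)) => // x y; apply: K_D. Qed.

(** For [e] itself the second clause holds only modulo [R 2]. The exact equality is what lets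
    coefficients from [K] be moved across f. *)
Definition good_at Y (f : 'M[k]_(d (E Y), d Y)) :=
  R 2 (f - e Y) /\ forall a : 'M_(d Y), K a -> exists2 b, K b & f *m a = b *m f.

Definition good (eps : forall Y, 'M[k]_(d (E Y), d Y)) :=
  forall Y, I Y -> good_at (eps Y).

(** The class S of left coefficients is a parameter: S = [K] gives the degree one maps [J], and S =
    homogeneous composites of degree n gives those of degree n+1. *)
Inductive span (eps : forall Y, 'M[k]_(d (E Y), d Y)) M
    (S : forall N, 'M[k]_(d M, d N) -> Prop) N : 'M[k]_(d M, d N) -> Prop :=
| span_0 : span eps S 0
| span_gen Y g c f : I Y -> S (E Y) g -> K (c : 'M_(d Y, d N)) ->
    span eps S f -> span eps S (g *m eps Y *m c + f).

(* The degree one maps of level [eps]: a complement of [R 2] in [R 1] which is a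
   bimodule over [K]. *)
Definition J (eps : forall Y, 'M[k]_(d (E Y), d Y)) M N (f : 'M[k]_(d M, d N)) :=
  span eps (@K M) f.

Lemma span_D eps M S N (f g : 'M_(d M, d N)) :
  span eps S f -> span eps S g -> span eps S (f + g).
Proof.
move=> hf hg; elim: hf => [|Y a c f' IY Sa Kc _ IH]; first by rewrite add0r.
by rewrite -addrA; apply: span_gen.
Qed.

Lemma span_Mr eps M S N P (f : 'M_(d M, d N)) (a : 'M_(d N, d P)) :
  span eps S f -> K a -> span eps S (f *m a).
Proof.
move=> hf Ka; elim: hf => [|Y g c f' IY Sg Kc _ IH].
  by rewrite mul0mx; apply: span_0.
by rewrite mulmxDl -(mulmxA _ c); apply: span_gen => //; apply: K_M.
Qed.

Lemma span_one eps M S Y (g : 'M_(d M, d (E Y))) :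
  I Y -> S (E Y) g -> span eps S (g *m eps Y).
Proof.
move=> IY Sg; rewrite -[_ *m eps _]addr0 -[_ *m eps _]mulmx1.
by apply: span_gen => //; apply: span_0.
Qed.

(** * The degree one maps of a single level *)

Section Good.
Variables (eps : forall Y, 'M[k]_(d (E Y), d Y)) (eps_good : good eps).

Lemma eps_R Y : I Y -> R 1 (eps Y).
Proof.
move=> IY; have [h _] := eps_good IY.
by apply: (R_sub (R_S h)); apply: e_R.
Qed.

(* [eps] and [e] differ by an automorphism congruent to 1. *)
Lemma eps_factor Y : I Y ->
  exists v : 'M_(d (E Y)), [/\ R 1 (v - 1%:M), v \in unitmx & eps Y = v *m e Y].
Proof.
move=> IY; have [h _] := eps_good IY.
have [r rR E1] := e_cover IY h.
exists (1%:M + r); split; first by rewrite addrC addrA addNr add0r.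
  exact: R_unit.
by rewrite mulmxDl mul1mx -E1 addrC subrK.
Qed.

Lemma J_D M N (f g : 'M_(d M, d N)) : J eps f -> J eps g -> J eps (f + g).
Proof. exact: span_D. Qed.

Lemma J_Ml M N P (a : 'M_(d M, d N)) (f : 'M_(d N, d P)) :
  K a -> J eps f -> J eps (a *m f).
Proof.
move=> Ka; elim=> [|Y g c f' IY Kg Kc _ IH]; first by rewrite mulmx0; apply: span_0.
by rewrite mulmxDr !mulmxA; apply: span_gen => //; apply: K_M.
Qed.

Lemma J_Mr M N P (f : 'M_(d M, d N)) (a : 'M_(d N, d P)) :
  J eps f -> K a -> J eps (f *m a).
Proof. exact: span_Mr. Qed.

Lemma J_N M N (f : 'M_(d M, d N)) : J eps f -> J eps (- f).
Proof.
by move=> h; rewrite -[f]mul1mx -mulNmx; apply: J_Ml => //; apply: K_N; apply: K_1.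
Qed.

Lemma J_R M N (f : 'M_(d M, d N)) : J eps f -> R 1 f.
Proof.
elim=> [|Y g c f' IY Kg Kc _ IH]; first exact: R_0.
apply: R_D => //; apply: (R_Mr (b := 0)); last exact: K_R.
by apply: (R_Ml (a := 0)); [exact: K_R|exact: eps_R].
Qed.

Lemma eps_K M Y (c : 'M_(d M, d Y)) : I M -> I Y -> K c ->
  exists2 b, K b & eps M *m c = b *m eps Y.
Proof.
move=> IM IY Kc; have [c0|eMY] := K_ne IM IY Kc.
  by exists 0; [exact: K_0|rewrite c0 mulmx0 mul0mx].
by subst Y; have [_] := eps_good IM; apply.
Qed.

(** When the target is in [I], a right coefficient either vanishes or is an endomorphism of Y, and
    in the second case goodness turns it into a left coefficient. All terms then share the factor
    [eps Y] and add up. *)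
Lemma span_normal M (S : forall N, 'M_(d M, d N) -> Prop) Y (f : 'M_(d M, d Y)) :
  S (E Y) 0 -> (forall g h, S (E Y) g -> S (E Y) h -> S (E Y) (g + h)) ->
  (forall N g (c : 'M_(d N, d (E Y))), S N g -> K c -> S (E Y) (g *m c)) ->
  I Y -> span eps S f -> exists2 g, S (E Y) g & f = g *m eps Y.
Proof.
move=> S0 SD SM IY; elim=> [|Y' g c f' IY' Sg Kc _ [g' Sg' ->]].
  by exists 0; rewrite ?mul0mx.
have [b Kb E1] := eps_K IY' IY Kc.
exists (g *m b + g'); first by apply: SD => //; apply: SM Kb.
by rewrite -mulmxA E1 mulmxDl mulmxA.
Qed.

(** After reduction to a target in [I], the normal form is [g *m eps] with g in [K]; minimality of
    [e] puts g in [R 1], where [K] is zero. *)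
Lemma J_R2 M N (f : 'M_(d M, d N)) : J eps f -> R 2 f -> f = 0.
Proof.
move=> Jf Rf; have [T [P [p [q [IP Kp Kq E1]]]]] := K_dec N.
rewrite -[f]mulmx1 -E1 mulmx_sumr big1 // => i _.
have Jfi := J_Mr Jf (Kp i).
have Rfi : R 2 (f *m p i) by apply: (R_Mr (b := 0)) => //; apply: K_R.
have [g Kg E2] : exists2 g, K g & f *m p i = g *m eps (P i).
  apply: (@span_normal M (@K M) (P i)) (IP i) Jfi.
  - exact: K_0.
  - exact: K_D.
  - by move=> *; apply: K_M.
suff g0 : g = 0 by rewrite mulmxA E2 g0 !mul0mx.
apply: K_R1 => //; apply: (e_min (IP i)); first exact: K_R.
have [h _] := eps_good (IP i).
apply: (R_sub (g := g *m eps (P i))); last by rewrite -E2.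
by rewrite -mulmxBr; apply: (R_Ml (a := 0)); [exact: K_R|exact: R_subC].
Qed.

Lemma J_split M N (f : 'M_(d M, d N)) : R 1 f -> exists2 g, J eps g & R 2 (f - g).
Proof.
move=> Rf; have [T [P [p [q [IP Kp Kq E1]]]]] := K_dec N.
suff H i : exists2 g, J eps g & R 2 (f *m p i - g).
  have {H} H : forall i, {g | J eps g /\ R 2 (f *m p i - g)}.
    by move=> i; apply: constructive_indefinite_description; have [g] := H i; exists g.
  exists (\sum_i sval (H i) *m q i).
    apply: (big_ind (@J eps M N)); [exact: span_0|exact: J_D|move=> i _].
    by apply: J_Mr => //; case: (svalP (H i)).
  rewrite -[f in f - _]mulmx1 -E1 mulmx_sumr -sumrB; apply: R_sum => i.
  rewrite mulmxA -mulmxBl; apply: (R_Mr (b := 0)); last exact: K_R.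
  by case: (svalP (H i)).
have Rfi : R 1 (f *m p i) by apply: (R_Mr (b := 0)) => //; apply: K_R.
have [h Rh E2] := e_cover (IP i) Rfi.
have [g Kg Rg] := K_split Rh.
exists (g *m eps (P i)).
  exact: span_one.
rewrite E2 -(subrK (g *m e (P i)) (h *m _)) -mulmxBl -addrA -mulmxBr.
apply: R_D; first by apply: (@R_M 1 1) => //; apply: e_R.
apply: (R_Ml (a := 0)); first exact: K_R.
by have [h' _] := eps_good (IP i); apply: R_subC.
Qed.

End Good.

(* Any choice of right almost split maps congruent to [e] can be averaged with
   a Casimir element into a good one; every relation [u *m e0 Y = 0] that is
   stable under the degree zero endomorphisms survives. *)
Lemma average Y (e0 : 'M[k]_(d (E Y), d Y)) : I Y -> R 2 (e0 - e Y) ->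
  exists eps : 'M[k]_(d (E Y), d Y), good_at eps /\ (forall P (u : 'M_(d P, d (E Y))), u *m e0 = 0 ->
      (forall (a : 'M_(d Y)) (b : 'M_(d (E Y))), K a -> K b ->
        R 2 (e0 *m a - b *m e0) -> exists c : 'M_(d P), u *m b = c *m u) ->
      u *m eps = 0).
Proof.
move=> IY Re0.
have e0R : R 1 (e0) by apply: (R_sub (R_S Re0)); apply: e_R.
have lift (a : 'M_(d Y)) : K a ->
    exists b : 'M_(d (E Y)), K b /\ R 2 (e0 *m a - b *m e0).
  move=> Ka; have : R 1 (e0 *m a) by apply: (R_Mr (b := 0)) => //; apply: K_R.
  case/(e_cover IY) => h Rh E1; have [b Kb Rb] := K_split Rh.
  exists b; split => //.
  rewrite E1 -(subrK (b *m e Y) (h *m _)) -mulmxBl -addrA -mulmxBr.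
  apply: R_D; first by apply: (@R_M 1 1) => //; apply: e_R.
  by apply: (R_Ml (a := 0)); [exact: K_R|exact: R_subC].
(* Uniqueness makes the assignment of b to a compatible with products, although it is defined only
   by a congruence; see [bphi]. *)
have lift_uniq (b b' : 'M_(d (E Y))) : K b -> K b' -> R 2 (b *m e0 - b' *m e0) -> b = b'.
  move=> Kb Kb' Rb; apply/subr0_eq/K_R1; first exact: K_B.
  apply: (e_min IY); first by apply/K_R/K_B.
  rewrite -(subrK (e0) (e Y)) mulmxDr mulmxBl (mulmxBl b b'); apply: R_D => //.
  by apply: R_B; apply: (R_Ml (a := 0)); try exact: K_R; exact: R_subC.
have [m [x [y [Kx Ky E1 cas]]]] := K_casimir IY.
have H j : {b : 'M_(d (E Y)) | K b /\ R 2 (e0 *m x j - b *m e0)}.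
  by apply: constructive_indefinite_description; apply: lift.
pose phi j := sval (H j).
have Kphi j : K (phi j) by case: (svalP (H j)).
have Rphi j : R 2 (e0 *m x j - phi j *m e0) by case: (svalP (H j)).
(* The Casimir average: x j acts on E through [phi j], y j acts on Y. It is congruent to [e0]
   because the products x j *m y j sum to 1. *)
exists (\sum_j phi j *m e0 *m y j); split; first split.
- apply: (R_sub (g := e0 - e Y)) => //.
  rewrite opprB addrA subrK -[X in _ - X]mulmx1 -E1 mulmx_sumr -sumrB.
  apply: R_sum => j; rewrite mulmxA -mulmxBl.
  apply: (R_Mr (b := 0)); last exact: K_R.
  exact: R_subC.
- move=> a Ka; have [al [ax ya]] := cas _ Ka; have [b [Kb Rb]] := lift _ Ka.
  exists b => //.
  have bphi j : b *m phi j = \sum_l al j l *: phi l.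
    apply: lift_uniq; [exact: K_M|by apply: K_sum => l; apply: K_Z|].
    apply: (R_sub (g := e0 *m (a *m x j) - (\sum_l al j l *: phi l) *m e0)).
      rewrite opprB addrA subrK.
      rewrite -(subrK (b *m e0 *m x j) (b *m phi j *m _)) -!mulmxA -mulmxBr -addrA.
      apply: R_D; first by apply: (R_Ml (a := 0)); [exact: K_R|exact: R_subC].
      rewrite !mulmxA -mulmxBl; apply: (R_Mr (b := 0)); last exact: K_R.
      exact: R_subC.
    rewrite ax mulmx_sumr mulmx_suml -sumrB; apply: R_sum => l.
    by rewrite -scalemxAr -scalemxAl -scalerBr; apply: R_Z.
  rewrite mulmx_suml mulmx_sumr.
  under eq_bigr => j _ do rewrite -mulmxA ya mulmx_sumr.
  rewrite exchange_big; apply: eq_bigr => j _ /=.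
  rewrite !mulmxA bphi !mulmx_suml; apply: eq_bigr => l _.
  by rewrite -!scalemxAl -scalemxAr.
- move=> P u ue0 ub; rewrite mulmx_sumr big1 // => j _.
  have [c E2] := ub _ _ (Kx j) (Kphi j) (Rphi j).
  by rewrite !mulmxA E2 -(mulmxA c) ue0 mulmx0 mul0mx.
Qed.

(** The matrix [s'] is a kernel of f made of degree one maps of the level [eps]; its congruence with
    [s Y] allows depth estimates to be carried from one kernel to another. *)
Definition linked_at (eps : forall Y, 'M[k]_(d (E Y), d Y)) Y
    (f : 'M[k]_(d (E Y), d Y)) :=
  exists s' : 'M[k]_(d (Z Y), d (E Y)),
    [/\ J eps s', R 2 (s' - s Y), row_free s', s' *m f = 0
      & forall M (g : 'M_(d M, d (E Y))), R 0 g -> g *m f = 0 ->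
          exists2 c, R 0 c & g = c *m s'].

Definition linked (eps eps' : forall Y, 'M[k]_(d (E Y), d Y)) :=
  forall Y, I Y -> linked_at eps (eps' Y).

Lemma choose_family (P : forall Y, 'M[k]_(d (E Y), d Y) -> Prop) :
  (forall Y, I Y -> exists f, P Y f) -> exists f, forall Y, I Y -> P Y (f Y).
Proof.
move=> H; have H' Y : {f | I Y -> P Y f}.
  apply: constructive_indefinite_description.
  have [IY|nIY] := classic (I Y); last by exists 0.
  by have [f Pf] := H Y IY; exists f.
by exists (fun Y => sval (H' Y)) => Y; case: (H' Y).
Qed.

Lemma good_exists : exists eps, good eps.
Proof.
apply: (@choose_family good_at) => Y IY.
have RY : R 2 (e Y - e Y) by rewrite subrr; apply: R_0.
have [eps [G _]] := average IY RY.
by exists eps.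
Qed.

(* The kernel [s] is congruent to some [s'] in [J eps], and [s' = s *m w] for an
   automorphism [w] congruent to 1; hence [s'] is the kernel of [invmx w *m e].
   It remains a kernel after averaging, because its commutation defects lie both
   in [J eps] and in [R 2]. *)
Lemma good_next eps : good eps -> exists2 eps', good eps' & linked eps eps'.
Proof.
move=> G.
have step Y : I Y -> exists f, good_at f /\ linked_at eps (f : 'M_(d (E Y), d Y)); last first.
  have [eps' H] := @choose_family (fun Y f => good_at f /\ linked_at eps f) step.
  by exists eps' => Y IY; case: (H Y IY).
move=> IY.
have [s' Js' Rs'] := J_split G (s_R IY); have {}Rs' := R_subC Rs'.
have [r Rr E1] := s_cover IY Rs'.
pose w := 1%:M + r; have Uw : w \in unitmx by apply: R_unit.
have Rw : R 0 w by apply: R_D; [exact: R_1|exact: R_any Rr].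
have Rw' : R 0 (invmx w) by apply: R_inv.
have E2 : s' = s Y *m w by rewrite mulmxDr mulmx1 -E1 addrC subrK.
have fs' : row_free s'.
  by rewrite -row_leq_rank E2 mxrankMfree ?row_free_unit // row_leq_rank s_free.
have ker0 M (g : 'M_(d M, d (E Y))) : R 0 g -> g *m (invmx w *m e Y) = 0 ->
    exists2 c, R 0 c & g = c *m s'.
  move=> Rg; rewrite mulmxA => /(s_ker IY) [|c Rc E3]; first exact: (R_M Rg Rw').
  by exists c => //; rewrite E2 mulmxA -E3 mulmxKV.
have Re0 : R 2 (invmx w *m e Y - e Y).
  rewrite -[X in _ - X]mul1mx -mulmxBl; apply: (@R_M 1 1); last exact: e_R.
  rewrite -(mulmxV Uw) (_ : invmx w - _ = - (r *m invmx w)).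
    by apply: R_N; apply: (R_Mr (b := 0)).
  by rewrite mulmxDl mul1mx opprD addrA subrr sub0r.
have s'e0 : s' *m (invmx w *m e Y) = 0 by rewrite E2 mulmxA mulmxK ?s_e.
have s'R : R 1 s' by apply: (R_sub (R_S Rs')); apply: s_R.
have [eps' [[h1 h2] h3]] := average IY Re0.
have s'eps' : s' *m eps' = 0.
  apply: h3 => // a b Ka Kb Rab.
  have Rs'ab : R 2 (s' *m (invmx w *m e Y *m a - b *m (invmx w *m e Y))).
    exact: (R_Ml (a := 1)).
  have : R 1 (invmx w *m e Y *m a).
    apply: (R_Mr (b := 0)); last exact: K_R.
    by apply: (R_Ml (a := 0)) => //; apply: e_R.
  case/(e_cover IY) => h0 Rh0 E3.
  pose h := h0 *m w.
  have Rh : R 0 h by apply: (@R_M 0 0).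
  have E4 : invmx w *m e Y *m a = h *m (invmx w *m e Y).
    by rewrite E3 /h !mulmxA mulmxK.
  have Rhb : R 1 (h - b).
    have: R 2 ((h *m invmx w - b *m invmx w) *m e Y).
      by move: Rab; rewrite E4 -mulmxBl -mulmxBl mulmxA.
    rewrite -mulmxBl => /(e_min IY) H1.
    have {}H1 : R 1 ((h - b) *m invmx w).
      by apply: H1; apply: (@R_M 0 0) => //; apply: R_B => //; apply: K_R.
    by rewrite -[h - b](mulmxK Uw) -mulmxA (_ : w *m _ = invmx w *m w) 1?mulmxA;
      [apply: (R_Mr (b := 0))|rewrite mulmxV // mulVmx].
  (* h is the exact endomorphism of E induced by a, and c its restriction to the kernel. The
     [K]-part [c0] of c commutes with [s'] modulo [R 2], hence exactly by [J_R2]. *)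
  have [c Rc E5] : exists2 c, R 0 c & s' *m h = c *m s'.
    apply: ker0; first exact: (@R_M 0 0 _ _ _ _ _ (R_any s'R)).
    by rewrite -mulmxA -E4 mulmxA s'e0 mul0mx.
  have [c0 Kc0 Rc0] := K_split Rc.
  exists c0; apply/subr0_eq/(J_R2 G).
    by apply: J_D; [exact: J_Mr|apply: J_N; exact: J_Ml].
  apply: (R_sub (g := s' *m b - s' *m h)).
    rewrite opprB addrC addrA subrK E5 -mulmxBl.
    by apply: (@R_M 1 1).
  by rewrite -mulmxBr; apply: (@R_M 1 1) => //; apply: R_subC.
exists eps'; split => //; exists s'; split => // M g Rg geps'.
(* The averaged map differs from [invmx w *m e Y] by an automorphism v; v restricts to an
   automorphism c' of the kernel, so [s'] is still a kernel. *)
have [r' Rr' E3] : exists2 r', R 1 r' & eps' = (1%:M + r') *m (invmx w *m e Y).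
  have : R 2 (eps' - invmx w *m e Y) by apply: (R_sub (g := e Y - invmx w *m e Y));
    [rewrite opprB addrA subrK|exact: R_subC].
  case/(e_cover IY) => r' Rr' E3.
  exists (r' *m w); first by apply: (R_Mr (b := 0)).
  by rewrite mulmxDl mul1mx mulmxA mulmxK // -E3 addrC subrK.
pose v := 1%:M + r'; have Uv : v \in unitmx by apply: R_unit.
have Rv : R 0 v by apply: R_D; [exact: R_1|exact: R_any Rr'].
have [c Rc E4] : exists2 c, R 0 c & g *m v = c *m s'.
  by apply: ker0; [exact: (@R_M 0 0)|rewrite -mulmxA -E3].
have [c' Rc' E5] : exists2 c', R 0 c' & s' *m v = c' *m s'.
  apply: ker0; first exact: (@R_M 0 0 _ _ _ _ _ (R_any s'R)).
  by rewrite -mulmxA -E3.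
have Uc' : c' \in unitmx.
  rewrite -row_free_unit -row_leq_rank -(mxrankMfree _ fs') -E5.
  by rewrite mxrankMfree ?row_free_unit // row_leq_rank.
exists (c *m invmx c'); first by apply: (@R_M 0 0) => //; apply: R_inv.
have : c *m invmx c' *m s' *m v = c *m s' by rewrite -mulmxA E5 mulmxA mulmxKV.
by rewrite -E4 => /(can_inj (mulmxK Uv)).
Qed.

Lemma levels_exist : exists eps : nat -> forall Y, 'M[k]_(d (E Y), d Y),
  (forall n, good (eps n)) /\ (forall n, linked (eps n) (eps n.+1)).
Proof.
have [eps0 G0] := good_exists.
have next (u : {eps | good eps}) : {v : {eps | good eps} | linked (sval u) (sval v)}.
  apply: constructive_indefinite_description.
  by have [v Gv Lv] := good_next (svalP u); exists (exist _ v Gv).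
pose u := fix F n := if n is m.+1 then sval (next (F m)) else exist _ eps0 G0.
exists (fun n => sval (u n)); split=> n; first exact: svalP (u n).
exact: svalP (next (u n)).
Qed.

(** * Homogeneous composites and the power of the radical in which they lie *)

Section Homogeneous.
Variables (eps : nat -> forall Y, 'M[k]_(d (E Y), d Y)).
Hypotheses (eps_good : forall n, good (eps n))
  (eps_linked : forall n, linked (eps n) (eps n.+1)).
Variable X : O.

(** The level equals the position of the factor: the kernel of a map in position m+1 is then a
    combination of maps allowed in position m. *)
Fixpoint H n : forall N, 'M[k]_(d X, d N) -> Prop :=
  if n is m.+1 then fun N f => span (eps m) (@H m) f else @K X.
Arguments H _ {_}.

Lemma H_0 n N : H n (0 : 'M_(d X, d N)).
Proof. by case: n => [|n]; [apply: K_0|apply: span_0]. Qed.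

Lemma H_D n N (f g : 'M_(d X, d N)) : H n f -> H n g -> H n (f + g).
Proof. by case: n => [|n]; [apply: K_D|apply: span_D]. Qed.

Lemma H_Mr n M N (f : 'M_(d X, d M)) (a : 'M_(d M, d N)) : H n f -> K a -> H n (f *m a).
Proof. by case: n => [|n]; [apply: K_M|apply: span_Mr]. Qed.

Lemma H_N n N (f : 'M_(d X, d N)) : H n f -> H n (- f).
Proof.
by move=> h; rewrite -[f]mulmx1 -mulmxN; apply: H_Mr => //; apply: K_N; apply: K_1.
Qed.

Lemma H_J n M N (f : 'M_(d X, d M)) (g : 'M_(d M, d N)) :
  H n f -> J (eps n) g -> H n.+1 (f *m g).
Proof.
move=> Hf; elim=> [|Y a c g' IY Ka Kc _ IH]; first by rewrite mulmx0; apply: H_0.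
by rewrite mulmxDr !mulmxA; apply: span_gen => //; apply: H_Mr.
Qed.

Lemma H_R n N (f : 'M_(d X, d N)) : H n f -> R n f.
Proof.
elim: n N f => [|n IH] N f; first exact: K_R.
elim=> [|Y g c f' IY Hg Kc _ IH']; first exact: R_0.
apply: R_D => //; apply: (R_Mr (b := 0)); last exact: K_R.
by apply: R_M1; [exact: IH|exact: (eps_R (eps_good n))].
Qed.

Lemma H_normal n Y (f : 'M_(d X, d Y)) : I Y -> H n.+1 f ->
  exists2 g, H n g & f = g *m eps n Y.
Proof.
move=> IY; apply: (@span_normal _ (eps_good n) X (@H n)) => //.
- exact: H_0.
- by move=> *; apply: H_D.
- by move=> *; apply: H_Mr.
Qed.

Lemma R_cover_eps n m Y M (g : 'M_(d M, d Y)) : I Y -> R m.+1 g ->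
  exists2 h, R m h & g = h *m eps n Y.
Proof.
move=> IY /(e_cover IY) [h Rh ->].
have [v [Rv Uv ->]] := eps_factor (eps_good n) IY.
exists (h *m invmx v); last by rewrite mulmxA mulmxKV.
apply: (R_Mr (b := 0)) => //; apply: R_inv => //.
by rewrite -(subrK 1%:M v); apply: R_D; [exact: R_any Rv|exact: R_1].
Qed.

Lemma H_split n N (f : 'M_(d X, d N)) : R n f -> exists2 g, H n g & R n.+1 (f - g).
Proof.
elim: n N f => [|n IH] N f Rf; first exact: K_split.
have [T [P [p [q [IP Kp Kq E1]]]]] := K_dec N.
have step i : exists g, H n.+1 g /\ R n.+2 (f *m p i - g).
  have Rfi : R n.+1 (f *m p i) by apply: (R_Mr (b := 0)) => //; apply: K_R.
  have [h Rh E2] := R_cover_eps n (IP i) Rfi.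
  have [g Hg Rg] := IH _ _ Rh.
  exists (g *m eps n (P i)); split; first exact: span_one.
  rewrite E2 -mulmxBl; apply: R_M1 => //.
  exact: (eps_R (eps_good n)).
have {}step i := constructive_indefinite_description _ (step i).
exists (\sum_i sval (step i) *m q i).
  apply: (big_ind (@H n.+1 N)); [exact: H_0|by move=> *; apply: H_D|move=> i _].
  by apply: H_Mr => //; case: (svalP (step i)).
rewrite -[f in f - _]mulmx1 -E1 mulmx_sumr -sumrB; apply: R_sum => i.
rewrite mulmxA -mulmxBl; apply: (R_Mr (b := 0)); last exact: K_R.
by case: (svalP (step i)).
Qed.

(* If a mesh [s'] of level [n] carries [chi] into depth [n.+1], then [chi] has
   depth [n]: its leading part would be killed by a monomorphism. *)
Lemma mesh_depth n : (forall m, (m <= n)%N -> forall N (f : 'M_(d X, d N)),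
    H m f -> R m.+1 f -> f = 0) ->
  forall Y (s' : 'M_(d (Z Y), d (E Y))) (chi : 'M_(d X, d (Z Y))), I Y ->
  R 0 chi -> R 2 (s' - s Y) -> R n.+1 (chi *m s') -> R n chi.
Proof.
move=> IHn Y s' chi IY Rchi Rs' Rchis'.
suff : forall m, (m <= n)%N -> R m chi by apply.
elim=> [|m IH] // ltmn; have Rm := IH (ltnW ltmn).
have [eta Heta Reta] := H_split Rm.
have [sm [Jsm Rsm fsm _ _]] := eps_linked m IY.
suff eta0 : eta = 0 by rewrite -[chi]subr0 -eta0.
apply: (row_free_inj fsm); rewrite mul0mx.
apply: (IHn m.+1) => //; first exact: H_J.
apply: (R_sub (g := eta *m s')).
  rewrite -mulmxBr -(addn2 m); apply: R_M; first exact: H_R.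
  rewrite -(subrK (s Y) sm) -addrA; apply: R_D => //; exact: R_subC.
apply: (R_sub (g := chi *m s')); last by apply: (R_le _ Rchis').
rewrite -mulmxBl; apply: R_M1; first exact: R_subC.
by apply: (R_sub (R_S Rs')); apply: s_R.
Qed.

(** Write the map as psi followed by [eps], with psi homogeneous, and also as psi' followed by
    [eps], with psi' one degree deeper. Then psi - psi' factors as chi followed by the kernel [s'],
    which belongs to the preceding level. If eta is the leading part of chi, then psi and
    [eta *m s'] are homogeneous and agree modulo the next power, so they are equal by induction, and
    [s'] kills [eps]. *)
Lemma homogeneous n N (f : 'M_(d X, d N)) : H n f -> R n.+1 f -> f = 0.
Proof.
elim/ltn_ind: n N f => [[|n] IH] N f; first exact: K_R1.
suff main Y (g : 'M_(d X, d Y)) : I Y -> H n.+1 g -> R n.+2 g -> g = 0.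
  move=> Hf Rf; have [T [P [p [q [IP Kp Kq E1]]]]] := K_dec N.
  rewrite -[f]mulmx1 -E1 mulmx_sumr big1 // => i _.
  rewrite mulmxA (main _ (f *m p i)) ?mul0mx //; first exact: H_Mr.
  by apply: (R_Mr (b := 0)) => //; apply: K_R.
move=> IY Hg; have [psi Hpsi ->] := H_normal IY Hg => {g Hg}.
move=> /(R_cover_eps n IY) [psi' Rpsi' E1].
have Rd : R n (psi - psi') by apply: R_B; [exact: H_R|exact: R_S].
have E0 : (psi - psi') *m eps n Y = 0 by rewrite mulmxBl E1 subrr.
(* In degree one there is no preceding level, but [s] is radical, and this already forces psi into
   both [K] and [R 1]. *)
case: n IH Hpsi Rpsi' E1 Rd E0 => [|n] IH Hpsi Rpsi' E1 Rd E0.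
  suff -> : psi = 0 by rewrite mul0mx.
  apply: K_R1 => //.
  have [v [Rv Uv Ev]] := eps_factor (eps_good 0) IY.
  have R0v : R 0 v by rewrite -(subrK 1%:M v); apply: R_D; [exact: R_any Rv|exact: R_1].
  have [chi Rchi E2] : exists2 chi, R 0 chi & (psi - psi') *m v = chi *m s Y.
    by apply: (s_ker IY); [exact: (@R_M 0 0)|rewrite -mulmxA -Ev].
  apply: (R_sub (g := psi')) => //; rewrite -(mulmxK Uv (psi - psi')) E2.
  apply: (R_Mr (b := 0)); last exact: R_inv.
  by apply: (R_Ml (a := 0)) => //; apply: s_R.
have [s' [Js' Rs' _ s'e kers']] := eps_linked n IY.
have [chi Rchi E2] := kers' _ _ (R_any Rd) E0.
have {}Rchi : R n chi.
  apply: (mesh_depth _ IY Rchi Rs'); last by rewrite -E2.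
  by move=> m lemn N' f'; apply: IH; rewrite ltnS ltnW.
have [eta Heta Reta] := H_split Rchi.
have R1s' : R 1 s' by apply: J_R Js'; apply: eps_good.
have : psi - eta *m s' = 0.
  apply: (IH n.+1) => //; first by apply: H_D => //; apply: H_N; apply: H_J.
  rewrite -(subrK psi' psi) E2 addrAC -mulmxBl; apply: R_D => //.
  exact: R_M1.
by move/subr0_eq => ->; rewrite -mulmxA s'e mulmx0.
Qed.

End Homogeneous.

Fixpoint path_mx (P : nat -> O) (f : forall i, 'M[k]_(d (P i), d (P i.+1))) n :
    'M[k]_(d (P 0%N), d (P n)) :=
  if n is m.+1 then path_mx f m *m f m else 1%:M.

Lemma strictify (P : nat -> O) (h : forall i, 'M[k]_(d (P i), d (P i.+1))) n :
  (forall i, (i < n)%N -> R 1 (h i)) -> R n.+1 (path_mx h n) ->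
  exists f : forall i, 'M[k]_(d (P i), d (P i.+1)),
    [/\ forall i, R 0 (f i), forall i, (i < n)%N -> R 2 (h i - f i) & path_mx f n = 0].
Proof.
move=> Rh Rp; have [eps [G L]] := levels_exist.
have lvl i : exists f, R 0 f /\ ((i < n)%N -> J (eps i) f /\ R 2 (h i - f)).
  (* Beyond the end of the path the value is arbitrary. *)
  have [lt|_] := boolP (i < n)%N; last by exists 0; split=> //; apply: R_0.
  have [f Jf Rf] := J_split (G i) (Rh i lt); exists f; split=> //.
    by apply: R_S; apply: (J_R (G i)).
have {}lvl i := constructive_indefinite_description _ (lvl i).
pose f i := sval (lvl i); exists f.
have Jf i : (i < n)%N -> J (eps i) (f i) by move=> lt; case: (svalP (lvl i)) => _ /(_ lt) [].
have Rf i : (i < n)%N -> R 2 (h i - f i) by move=> lt; case: (svalP (lvl i)) => _ /(_ lt) [].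
split=> // [i|]; first by case: (svalP (lvl i)).
(* Replacing one factor changes the composite by a term with one radical factor more. *)
have main m : (m <= n)%N ->
    @H eps (P 0%N) m _ (path_mx f m) /\ R m.+1 (path_mx h m - path_mx f m).
  elim: m => [|m IH] /= ltmn.
    by split; [apply: K_1|rewrite subrr; apply: R_0].
  have [Hm Rm] := IH (ltnW ltmn).
  split; first by apply: H_J => //; apply: Jf.
  rewrite -(subrK (path_mx f m *m h m) (path_mx h m *m _)) -mulmxBl -addrA -mulmxBr.
  apply: R_D; first by apply: R_M1 => //; apply: Rh.
  by rewrite -(addn2 m); apply: R_M; [apply: H_R Hm|apply: Rf].
have [Hn Rn] := main n (leqnn n).
apply: (homogeneous G L Hn); exact: (R_sub (R_subC Rn)).
Qed.

End Levels.

(** * Casimir elements of division algebras over a perfect field *)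

Definition alg_eval (k : fieldType) (Q : algType k) (a : Q) (f : {poly k}) : Q :=
  \sum_(n < size f) f`_n *: a ^+ n.

Lemma alg_evalE (k : fieldType) (Q : algType k) (a : Q) (f : {poly k}) :
  alg_eval a f = horner_alg a f.
Proof.
rewrite /alg_eval /horner_alg /horner_morph /= (horner_coef_wide (n := size f)) ?size_poly //.
by apply: eq_bigr => i _; rewrite coef_map mulr_algl.
Qed.

Lemma alg_eval_wide n (k : fieldType) (Q : algType k) (a : Q) (f : {poly k}) :
  (size f <= n)%N -> alg_eval a f = \sum_(i < n) f`_i *: a ^+ i.
Proof.
move=> le; rewrite /alg_eval (big_ord_widen n (fun i => f`_i *: a ^+ i)) // big_mkcond.
apply: eq_bigr => i _; case: ltnP => // h.
by rewrite nth_default ?scale0r.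
Qed.

Section Average.
Variables (k : fieldType) (Q : algType k).
Implicit Types (a T : Q) (f : {poly k}).

(* The sandwich of [T] by the noncommutative difference quotient of [f]. *)
Definition avg f a T : Q :=
  \sum_(n < size f) f`_n *: \sum_(i < n) a ^+ (n.-1 - i) * T * a ^+ i.

(** For f = X^n the commutator telescopes to a^n T - T a^n; by linearity it is f(a) T - T f(a) in
    general. *)
Lemma avg_comm f a T : alg_eval a f = 0 -> a * avg f a T = avg f a T * a.
Proof.
move=> fa0; apply/subr0_eq.
have E1 : a * avg f a T - avg f a T * a = alg_eval a f * T - T * alg_eval a f.
  rewrite /avg /alg_eval !mulr_sumr !mulr_suml -!sumrB.
  apply: eq_bigr => -[n /= _] _.
  rewrite -!scalerAr -!scalerAl -!scalerBr; congr (_ *: _).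
  rewrite mulr_sumr mulr_suml -sumrB.
  pose u i := a ^+ (n - i) * T * a ^+ i.
  rewrite (_ : _ - _ = - (u n - u 0%N)); last first.
    by rewrite /u opprB subnn subn0 expr0 mul1r mulr1.
  rewrite -telescope_sumr // -sumrN big_mkord; apply: eq_bigr => -[i /= lt] _.
  rewrite opprB /u !mulrA -exprS -(mulrA _ (a ^+ i) a) -exprSr.
  rewrite (_ : (n.-1 - i).+1 = (n - i)%N); last by rewrite -subSn ?prednK; lia.
  by rewrite (_ : n.-1 - i = n - i.+1)%N; last lia.
by rewrite E1 fa0 mul0r mulr0 subrr.
Qed.

(** The n terms coming from X^n all have the same image, which produces the derivative. This serves
    for phi the identity, when a and T commute, and for phi a trace. *)
Lemma avg_map (V : lmodType k) (phi : {linear Q -> V}) f a T :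
  (forall i j, phi (a ^+ i * T * a ^+ j) = phi (a ^+ (i + j) * T)) ->
  phi (avg f a T) = phi (alg_eval a f^`() * T).
Proof.
move=> com.
rewrite (@alg_eval_wide (size f).-1); last by rewrite /deriv size_poly.
rewrite /avg linear_sum; case: (size f) => [|n]; first by rewrite !big_ord0 mul0r linear0.
rewrite big_ord_recl big_ord0 scaler0 linear0 add0r mulr_suml linear_sum.
apply: eq_bigr => i _.
rewrite coef_deriv linearZ linear_sum /= (eq_bigr (fun=> phi (a ^+ i * T))); last first.
  move=> j _; rewrite com; have := ltn_ord j; rewrite [X in (_ < X)%N -> _]lift0 ltnS.
  by move/subnK => ->.
by rewrite sumr_const card_ord -scalerMnr -scalerAl linearZ /= scalerMnl.
Qed.

Lemma avg_id f a T : a * T = T * a -> avg f a T = alg_eval a f^`() * T.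
Proof.
move=> com; apply: (@avg_map Q idfun) => i j /=.
by rewrite -mulrA (commrX j (esym com : GRing.comm T a)) mulrA -exprD.
Qed.

Lemma avg_commr f a T b : b * a = a * b -> b * T = T * b ->
  b * avg f a T = avg f a T * b.
Proof.
move=> ba bT; rewrite mulr_sumr mulr_suml; apply: eq_bigr => n _.
rewrite -scalerAr -scalerAl; congr (_ *: _).
rewrite mulr_sumr mulr_suml; apply: eq_bigr => i _.
have ca j : b * a ^+ j = a ^+ j * b by apply: commrX.
by rewrite !mulrA ca -(mulrA _ b) bT -!mulrA ca.
Qed.

End Average.

Section Division.
Variables (k : fieldType) (perf : perfect_field k) (D : falgType k).
Hypothesis D_unit : forall x : D, x != 0 -> x \is a GRing.unit.

Lemma D_mulf (x y : D) : x * y = 0 -> x = 0 \/ y = 0.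
Proof.
move=> xy; have [->|/D_unit ux] := eqVneq x 0; [by left|right].
by rewrite -[y](mulKr ux) xy mulr0.
Qed.

Lemma annihilator (a : D) : exists2 f : {poly k}, f != 0 & alg_eval a f = 0.
Proof.
pose n := \dim {:D}.
pose X := [tuple a ^+ i | i < n.+1].
have : ~~ free X.
  apply/negP => /eqP; rewrite size_tuple => E1.
  by have := dimvS (subvf <<X>>); rewrite E1 ltnn.
move/freeP => nf.
have [c /not_all_ex_not [c0 /not_all_ex_not [i ci]]] := not_all_ex_not _ _ nf.
exists (\poly_(j < n.+1) c (inord j)).
  apply/eqP => /(congr1 (fun p : {poly k} => p`_i)).
  by rewrite coef_poly ltn_ord coef0 inord_val => /ci.
rewrite (@alg_eval_wide n.+1) ?size_poly // -[RHS]c0.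
by apply: eq_bigr => j _; rewrite coef_poly ltn_ord inord_val -tnth_nth tnth_mktuple.
Qed.

(** Since D has no zero divisors, one factor of a reducible annihilator kills a; the degree
    decreases. *)
Lemma irreducible_annihilator (a : D) :
  exists2 f : {poly k}, irreducible_poly f & alg_eval a f = 0.
Proof.
have [f] := annihilator a; move: (size f) {-2}f (leqnn (size f)) => n.
elim: n => [|n IH] {}f; first by rewrite leqn0 size_poly_eq0 => ->.
move=> szf f0 fa; have [irr|nirr] := classic (irreducible_poly f); first by exists f.
have sz1 : (1 < size f)%N.
  rewrite ltnNge; apply/negP => /size1_polyC E1; move: fa f0; rewrite E1 alg_evalE.
  rewrite /= /horner_alg /horner_morph map_polyC hornerC /= polyC_eq0 => /eqP.
  by rewrite scaler_eq0 oner_eq0 orbF => ->.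
have [q Hq] : exists q : {poly k}, ~ (size q != 1%N -> q %| f -> q %= f)%R.
  by apply: not_all_ex_not => H; apply: nirr.
have [sq Hq'] := imply_to_and _ _ Hq.
have [qf0 /negP nq] := imply_to_and _ _ Hq'.
have [r E1] := dvdpP _ _ qf0.
have fn0 := f0; move: fn0; rewrite {1}E1 mulf_eq0 negb_or => /andP [r0 q0].
have := fa; rewrite E1 alg_evalE rmorphM /= -!alg_evalE => /D_mulf [].
  apply: IH => //; rewrite -ltnS; apply: leq_trans szf.
  rewrite E1 size_mul //; move: sq q0; rewrite -size_poly_gt0.
  by case: (size q) => [|[|m]] // _ _; rewrite !addnS /= ltnS leq_addr.
apply: IH => //; rewrite -ltnS; apply: leq_trans szf.
have qf : q %| f by rewrite E1 dvdp_mulIr.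
rewrite ltn_neqAle dvdp_leq // andbT; apply: contra nq => /eqP E2.
by rewrite -dvdp_size_eqp // E2.
Qed.

(** The place where the field is required to be perfect: a Bezout relation between f and its
    derivative shows that f'(a) is nonzero, hence invertible in D, so that averages can be
    normalised. *)
Lemma separable_annihilator (a : D) :
  exists2 f : {poly k}, alg_eval a f = 0 & alg_eval a f^`() != 0.
Proof.
have [f irr fa] := irreducible_annihilator a; exists f => //.
have := perf irr; rewrite unlock => /Bezout_coprimepP [[u v] /= E1].
apply/eqP => f'a.
have : alg_eval a (u * f + v * f^`()) = 0.
  by rewrite alg_evalE rmorphD !rmorphM /= -!alg_evalE fa f'a !mulr0 addr0.
have /eqpP [[c1 c2] /= /andP [c10 c20] E2] := E1.
move/(congr1 (fun x => c1 *: x)); rewrite scaler0 alg_evalE -mulr_algl -(horner_algC a c1) -rmorphM mul_polyC E2.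
rewrite alg_polyC -[X in X = 0 -> _]/(horner_alg a c2%:P) horner_algC.
by move/eqP; rewrite scaler_eq0 oner_eq0 orbF (negPf c20).
Qed.

Import FalgLfun.
Notation LD := (@amull k D).
Notation RD := (@amulr k D).

Definition opr_tr (T : 'End(D)) : k :=
  \sum_i coord (vbasis {:D}) i (T (vbasis {:D})`_i).

Lemma opr_tr_is_linear : linear_for *%R opr_tr.
Proof.
move=> a S T; rewrite /opr_tr mulr_sumr -big_split /=; apply: eq_bigr => i _.
by rewrite add_lfunE scale_lfunE linearP.
Qed.

HB.instance Definition _ := GRing.isLinear.Build k 'End(D) k *%R opr_tr opr_tr_is_linear.

Lemma opr_trC (S T : 'End(D)) : opr_tr (S * T) = opr_tr (T * S).
Proof.
pose X := vbasis {:D}.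
have expand (A B : 'End(D)) :
    opr_tr (A * B) = \sum_(i < \dim {:D}) \sum_(j < \dim {:D}) coord X j (A X`_i) * coord X i (B X`_j).
  rewrite /opr_tr; apply: eq_bigr => i _.
  rewrite lfun_mulE {1}(coord_vbasis (memvf (A X`_i))) linear_sum linear_sum.
  by apply: eq_bigr => j _; rewrite linearZ linearZ.
rewrite !expand exchange_big; apply: eq_bigr => i _; apply: eq_bigr => j _.
exact: mulrC.
Qed.

(** The image of the enveloping algebra of D in its k-linear operators. A product in ['End(D)]
    applies its left factor first, so [LD] reverses products and [RD] preserves them. *)
Inductive sandwich : 'End(D) -> Prop :=
| sandwich_0 : sandwich 0
| sandwich_gen u v T : sandwich T -> sandwich (LD u * RD v + T).

Lemma sandwich_D S T : sandwich S -> sandwich T -> sandwich (S + T).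
Proof.
move=> hS hT; elim: hS => [|u v S' _ IH]; first by rewrite add0r.
by rewrite -addrA; apply: sandwich_gen.
Qed.

Lemma amull_amulr (u v : D) : LD u * RD v = RD v * LD u.
Proof. by apply/lfunP => z; rewrite !lfun_mulE !lfunE /= mulrA. Qed.

Lemma sandwich_Ml u S : sandwich S -> sandwich (LD u * S).
Proof.
elim=> [|x v S' _ IH]; first by rewrite mulr0; apply: sandwich_0.
by rewrite mulrDr mulrA -amullM; apply: sandwich_gen.
Qed.

Lemma sandwich_Mr S v : sandwich S -> sandwich (S * RD v).
Proof.
elim=> [|x y S' _ IH]; first by rewrite mul0r; apply: sandwich_0.
by rewrite mulrDl -mulrA -rmorphM; apply: sandwich_gen.
Qed.

Lemma sandwich_MrL S u : sandwich S -> sandwich (S * LD u).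
Proof.
elim=> [|x y S' _ IH]; first by rewrite mul0r; apply: sandwich_0.
by rewrite mulrDl -mulrA -amull_amulr mulrA -amullM; apply: sandwich_gen.
Qed.

Lemma sandwich_Z c S : sandwich S -> sandwich (c *: S).
Proof.
move=> hS; rewrite (_ : c *: S = LD c%:A * S); first exact: sandwich_Ml.
by apply/lfunP => z; rewrite lfun_mulE scale_lfunE !lfunE /= -scalerAl mul1r linearZ.
Qed.

Lemma sandwich_sum n (F : 'I_n -> 'End(D)) :
  (forall i, sandwich (F i)) -> sandwich (\sum_i F i).
Proof. by move=> h; apply: big_ind => //; [exact: sandwich_0|exact: sandwich_D]. Qed.

Lemma sandwich_avg f (a : D) S : sandwich S ->
  exists2 S', sandwich S' & forall z, S' z = avg f a (S z).
Proof.
move=> hS; exists (\sum_(n < size f) f`_n *: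
    \sum_(i < n) S * LD (a ^+ (n.-1 - i)) * RD (a ^+ i)).
  apply: sandwich_sum => n; apply: sandwich_Z; apply: sandwich_sum => i.
  by apply/sandwich_Mr/sandwich_MrL.
move=> z; rewrite sum_lfunE; apply: eq_bigr => n _.
rewrite scale_lfunE sum_lfunE; congr (_ *: _); apply: eq_bigr => i _.
by rewrite !lfun_mulE !lfunE.
Qed.

Definition commuting (s : seq D) := forall a b, a \in s -> b \in s -> a * b = b * a.

Definition centralizes (z : D) (s : seq D) := forall a, a \in s -> a * z = z * a.

(** Induction on s: averaging with an annihilator of the new element a forces commutation with a,
    preserves the earlier commutations because s is commutative, and multiplies the centralizer of a
    by f'(a), which is then divided out. *)
Lemma centralizing_operator (s : seq D) : commuting s ->
  exists P, [/\ sandwich P, forall z, centralizes (P z) s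
    & forall z, centralizes z s -> P z = z].
Proof.
elim: s => [|a s IH] com.
  exists 1; split=> //; last by move=> z _; rewrite id_lfunE.
  rewrite (_ : 1 = LD 1 * RD 1 + 0); first by apply/sandwich_gen/sandwich_0.
  by apply/lfunP => z; rewrite addr0 lfun_mulE !lfunE /= mul1r mulr1.
have [|P [SP cP idP]] := IH.
  by move=> x y xs ys; apply: com; rewrite inE ?xs ?ys orbT.
have [f fa f'a] := separable_annihilator a; set c := alg_eval a f^`() in f'a *.
have [P' SP' E1] := sandwich_avg f a SP.
have cb b : b * a = a * b -> b * c = c * b.
  move=> ba; rewrite /c mulr_sumr mulr_suml; apply: eq_bigr => i _.
  by rewrite -scalerAr -scalerAl; congr (_ *: _); apply: commrX.
have cVb b : b * a = a * b -> b * c^-1 = c^-1 * b by move=> /cb; apply: commrV.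
exists (P' * LD c^-1); split; first exact: sandwich_MrL.
- move=> z b; rewrite inE lfun_mulE lfunE /= E1 => /predU1P [->|bs].
    by rewrite mulrA cVb // -!mulrA; congr (_ * _); apply: avg_comm.
  have ba : b * a = a * b by apply: com; rewrite inE ?eqxx ?bs ?orbT.
  rewrite mulrA cVb // -!mulrA; congr (_ * _).
  by apply: avg_commr => //; apply: cP.
- move=> z cz; rewrite lfun_mulE lfunE /= E1 idP; last first.
    by move=> b bs; apply: cz; rewrite inE bs orbT.
  by rewrite avg_id ?mulKr ?D_unit //; apply: cz; rewrite inE eqxx.
Qed.

(** Linearity over one more element a comes from averaging inside ['End(D)] with the operator
    [LD a]. The trace is cyclic, so the average of S has the trace of f'([LD a]) S, and the factor
    [LD c^-1] in S keeps it equal to 1. *)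
Lemma trace_one_operator (s : seq D) : commuting s ->
  exists T : 'End(D), [/\ opr_tr T = 1, forall z, centralizes (T z) s
    & forall a z, a \in s -> T (a * z) = a * T z].
Proof.
move=> com.
suff : forall t : seq D, {subset t <= s} ->
    exists T : 'End(D), [/\ opr_tr T = 1, forall z, centralizes (T z) s
    & forall a z, a \in t -> T (a * z) = a * T z] by apply.
elim=> [|a t IH] ts.
  pose X := vbasis {:D}.
  have [i ci] : exists i, coord X i 1 != 0.
    apply: not_all_not_ex => H; have := oner_neq0 D.
    rewrite (coord_vbasis (memvf (1 : D))) big1 ?eqxx // => i _.
    by have /negP := H i; rewrite negbK => /eqP ->; rewrite scale0r.
  (* The starting operator has rank one and its image consists of scalars, which centralize
     everything; the normalisation of u gives trace 1. *)
  pose u : D := (coord X i 1)^-1%:A.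
  have lin : linear (fun z : D => coord X i z *: u).
    move=> a x y; have -> : coord X i (a *: x + y) = a * coord X i x + coord X i y.
      by rewrite linearD linearZ.
    by rewrite scalerDl -scalerA.
  pose T0 : {linear D -> D} := HB.pack (fun z : D => coord X i z *: u)
    (GRing.isLinear.Build k D D *:%R _ lin).
  exists (linfun T0); split=> // [|z a _]; last first.
    by rewrite lfunE /= -scalerAr -scalerAl -scalerAr -scalerAl mulr1 mul1r.
  rewrite /opr_tr (bigD1 i) // big1 => [|j ji].
    rewrite lfunE /= (coord_free _ _ (basis_free (vbasisP _))) eqxx scale1r addr0.
    by rewrite linearZ /= mulVf.
  by rewrite lfunE /= (coord_free _ _ (basis_free (vbasisP _))) (negPf ji) scale0r linear0.
have [|T [trT cT linT]] := IH; first by move=> x xt; apply: ts; rewrite inE xt orbT.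
have [f fa f'a] := separable_annihilator a; set c := alg_eval a f^`() in f'a *.
have as_ : a \in s by apply: ts; rewrite inE eqxx.
have evalL g : alg_eval (LD a) g = LD (alg_eval a g).
  rewrite /alg_eval linear_sum; apply: eq_bigr => i _; rewrite linearZ /=; congr (_ *: _).
  elim: (val i) => [|n IHn]; first by rewrite !expr0 amull1.
  by rewrite exprS IHn exprSr amullM.
pose A := LD a; pose S := LD c^-1 * T.
have S_c z b : b \in s -> b * S z = S z * b by move=> bs; rewrite lfun_mulE; apply: cT.
exists (avg f A S); split.
- rewrite (@avg_map k _ k^o opr_tr).
    by rewrite evalL -/c /S mulrA -amullM mulVr ?D_unit // amull1 mul1r.
  by move=> i j /=; rewrite opr_trC mulrA -exprD addnC.
- move=> z b bs; rewrite sum_lfunE mulr_sumr mulr_suml; apply: eq_bigr => n _.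
  rewrite scale_lfunE -scalerAr -scalerAl; congr (_ *: _).
  rewrite sum_lfunE mulr_sumr mulr_suml; apply: eq_bigr => i _.
  rewrite 2!lfun_mulE; set w := S _.
  have -> : (A ^+ i) w = a ^+ i * w.
    elim: (val i) w => [|j IHj] w; first by rewrite !expr0 id_lfunE mul1r.
    by rewrite exprSr lfun_mulE IHj lfunE /= exprS mulrA.
  have ba : b * a ^+ i = a ^+ i * b by apply: commrX; apply: com.
  by rewrite mulrA ba -!mulrA S_c.
- have lb b (U : 'End(D)) : (forall z, U (b * z) = b * U z) <-> LD b * U = U * LD b.
    split=> [h|/lfunP h z]; last by have := h z; rewrite !lfun_mulE !lfunE /=.
    by apply/lfunP => z; rewrite !lfun_mulE !lfunE /=.
  move=> b z; rewrite inE => /predU1P [->|bt].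
    by apply/(lb a): z; apply: avg_comm; rewrite evalL fa linear0.
  have bs : b \in s by apply: ts; rewrite inE bt orbT.
  have ba : b * a = a * b by apply: com.
  have bc : b * c^-1 = c^-1 * b.
    apply: commrV; rewrite /GRing.comm /c mulr_sumr mulr_suml; apply: eq_bigr => i _.
    by rewrite -scalerAr -scalerAl; congr (_ *: _); apply: commrX.
  apply/(lb b): z; apply: avg_commr; first by rewrite /A -!amullM ba.
  rewrite /S mulrA -amullM -bc amullM -!mulrA; congr (_ * _).
  by apply/(lb b) => z; apply: linT.
Qed.

(** The span of s is a maximal subfield, reached by adjoining centralizing elements as long as the
    dimension grows. *)
Lemma maximal_commuting : exists s : seq D, commuting s /\
  forall z, centralizes z s -> z \in <<s>>%VS.
Proof.
suff : forall m (s : seq D), commuting s -> (\dim {:D} - \dim <<s>> <= m)%N ->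
    exists s : seq D, commuting s /\ forall z, centralizes z s -> z \in <<s>>%VS.
  by move=> /(_ _ [::]); apply.
elim=> [|m IH] s com le.
  exists s; split=> // z _.
  have /eqP -> : <<s>>%VS == fullv by rewrite eqEdim subvf -subn_eq0 -leqn0.
  exact: memvf.
have [ok|] := classic (forall z, centralizes z s -> z \in <<s>>%VS); first by exists s.
move=> /not_all_ex_not [z nz]; have [cz /negP zs] := imply_to_and _ _ nz.
apply: (IH (z :: s)).
  move=> x y; rewrite !inE => /predU1P [->|xs] /predU1P [->|ys] //.
  - by rewrite cz.
  - by rewrite cz.
  - exact: com.
rewrite -ltnS; apply: leq_trans le; apply: ltn_sub2l.
  rewrite ltn_neqAle dimvS ?subvf // andbT; apply: contraNneq zs => E1.
  suff /eqP -> : <<s>>%VS == fullv by apply: memvf.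
  by rewrite eqEdim subvf E1 leqnn.
rewrite ltn_neqAle dimvS ?andbT; last by apply: sub_span => x xs; rewrite inE xs orbT.
apply: contraNneq zs => E1.
suff /eqP -> : <<s>>%VS == <<z :: s>>%VS by apply: memv_span; rewrite inE eqxx.
by rewrite eqEdim E1 leqnn andbT; apply: sub_span => x xs; rewrite inE xs orbT.
Qed.

(** P takes values in the span of s, on which T is right multiplication by T 1; hence [P * T] is a
    sandwich. Since P fixes the values of T, [T * P] is T. By cyclicity some sandwich has trace
    1. *)
Lemma trace_neq0 : exists u v, opr_tr (LD u * RD v) != 0.
Proof.
have [s [com cs]] := maximal_commuting.
have [P [SP cP idP]] := centralizing_operator com.
have [T [trT cT linT]] := trace_one_operator com.
apply: not_all_not_ex => H0.
have H u : forall v, opr_tr (LD u * RD v) = 0.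
  move=> v; apply/eqP; apply: contraT => ne.
  by have := H0 u => /not_ex_all_not /(_ v) /negP; rewrite ne.
have E1 : P * T = P * RD (T 1).
  apply/lfunP => z; rewrite !lfun_mulE [RHS]lfunE /=.
  have : P z \in <<s>>%VS by apply: cs.
  move: (P z) => w; rewrite -[s]/(tval (in_tuple s)) => /coord_span ->; rewrite linear_sum mulr_suml.
  apply: eq_bigr => i _; rewrite linearZ /= -scalerAl; congr (_ *: _).
  by rewrite -{1}[s`_i]mulr1 linT // mem_nth.
have E2 : T * P = T by apply/lfunP => z; rewrite lfun_mulE idP.
have : opr_tr (P * RD (T 1)) = 0.
  elim: (sandwich_Mr (T 1) SP) => [|u v U _ IH]; first exact: linear0.
  by rewrite linearD /= H IH addr0.
by rewrite -E1 opr_trC E2 trT => /eqP; rewrite oner_eq0.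
Qed.

(* [x ⊗ y] is a separability idempotent, its invariance under [a] being
   written in coordinates: [al] is the matrix of [a] on the [x j], and its
   transpose is the matrix of [a] on the [y j]. *)
Definition casimir (Q : algType k) (P : Q -> Prop) n (x y : 'I_n -> Q) :=
  \sum_j x j * y j = 1 /\ forall a, P a -> exists al : 'I_n -> 'I_n -> k,
    (forall j, a * x j = \sum_l al j l *: x l) /\
    (forall l, y l * a = \sum_j al j l *: y j).

(** The form (x, y) -> lam (x y) is symmetric, and nondegenerate because D is a division algebra and
    lam u is nonzero; X and y are dual bases. The element N, the sum of the y_j u X_j, is central,
    and lam (N v) is the nonzero trace of z -> u z v; so N is invertible and normalises the sum to
    1. *)
Lemma division_casimir : exists n (x y : 'I_n -> D), casimir (fun=> True) x y.
Proof.
have [u [v uv0]] := trace_neq0.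
pose lam x := opr_tr (LD x * RD v).
have lamD x y : lam (x + y) = lam x + lam y.
  by rewrite /lam !linearD /= mulrDl linearD.
have lamZ c x : lam (c *: x) = c * lam x.
  by rewrite /lam linearZ -scalerAl linearZ.
have lam0 : lam 0 = 0 by rewrite -(scale0r 0) lamZ mul0r.
have lam_sum n (F : 'I_n -> D) : lam (\sum_i F i) = \sum_i lam (F i).
  by apply: (big_morph lam lamD lam0).
have lamC x y : lam (x * y) = lam (y * x).
  by rewrite /lam !amullM -mulrA opr_trC -mulrA -amull_amulr mulrA.
have nondeg x : (forall y, lam (x * y) = 0) -> x = 0.
  move=> h; have [//|/D_unit ux] := eqVneq x 0.
  by have := h (x^-1 * u); rewrite mulVKr // => /eqP; rewrite (negPf uv0).
pose n := \dim {:D}; pose X := vbasis {:D}.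
have frX := basis_free (vbasisP {:D}).
have expX w : w = \sum_(i < n) coord X i w *: X`_i by apply: coord_vbasis; apply: memvf.
have nondegX x : (forall j : 'I_n, lam (x * X`_j) = 0) -> x = 0.
  move=> h; apply: nondeg => y; rewrite (expX y) mulr_sumr lam_sum big1 // => i _.
  by rewrite -scalerAr lamZ h mulr0.
pose G : 'M_n := \matrix_(i, j) lam (X`_i * X`_j).
have UG : G \in unitmx.
  rewrite -row_free_unit; apply/row_freeP.
  apply/row_freeP/inj_row_free => c cG.
  have c0 : \sum_(i < n) c 0 i *: X`_i = 0.
    apply: nondegX => j; rewrite mulr_suml lam_sum.
    have := congr1 (fun M : 'rV_n => M 0 j) cG; rewrite mxE [RHS]mxE => E1; rewrite -[RHS]E1.
    by apply: eq_bigr => i _; rewrite mxE -scalerAl lamZ.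
  by apply/rowP => i; rewrite mxE; move/freeP: frX => /(_ (fun i => c 0 i) c0 i).
pose y (j : 'I_n) := \sum_i invmx G j i *: X`_i.
have yX (j l : 'I_n) : lam (y j * X`_l) = (j == l)%:R.
  rewrite mulr_suml lam_sum.
  have := congr1 (fun M : 'M_n => M j l) (mulVmx UG); rewrite mxE [RHS]mxE => E1.
  by rewrite -[RHS]E1; apply: eq_bigr => i _; rewrite -scalerAl lamZ mxE.
have coordE w (j : 'I_n) : coord X j w = lam (y j * w).
  rewrite [in RHS](expX w) mulr_sumr lam_sum (bigD1 j) //= big1 => [|i ij].
    by rewrite -scalerAr lamZ yX eqxx mulr1 addr0.
  by rewrite -scalerAr lamZ yX eq_sym (negPf ij) mulr0.
have expY w : w = \sum_(i < n) lam (w * X`_i) *: y i.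
  apply/subr0_eq/nondegX => j; rewrite mulrBl lamD -scaleN1r lamZ mulN1r.
  rewrite mulr_suml lam_sum (bigD1 j) //= big1 => [|i ij].
    by rewrite -scalerAl lamZ yX eqxx mulr1 addr0 subrr.
  by rewrite -scalerAl lamZ yX (negPf ij) mulr0.
pose N := \sum_(j < n) y j * u * X`_j.
have N0 : N != 0.
  apply: contraNneq uv0 => N0; rewrite /opr_tr.
  have -> : \sum_i coord (vbasis fullv) i ((LD u * RD v) (vbasis fullv)`_i) = lam (N * v).
    rewrite mulr_suml lam_sum; apply: eq_bigr => i _.
    by rewrite coordE lfun_mulE !lfunE /= !mulrA.
  by rewrite N0 mul0r lam0.
have al_y d j : d * y j = \sum_(i < n) lam (d * y j * X`_i) *: y i by apply: expY.
have al_X d i : X`_i * d = \sum_(j < n) lam (d * y j * X`_i) *: X`_j.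
  by rewrite {1}(expX (X`_i * d)); apply: eq_bigr => j _; rewrite coordE mulrA lamC mulrA.
have Nc d : d * N = N * d.
  rewrite mulr_sumr mulr_suml.
  under eq_bigr => j _ do rewrite !mulrA al_y !mulr_suml.
  under [RHS]eq_bigr => j _ do rewrite -mulrA al_X mulr_sumr.
  rewrite exchange_big; apply: eq_bigr => i _; apply: eq_bigr => j _ /=.
  by rewrite -!scalerAl -scalerAr.
have NVc d : d * N^-1 = N^-1 * d by apply/commrV/Nc.
exists n, (fun j => N^-1 * y j * u), (fun j => X`_j); split.
  rewrite -(mulVr (D_unit N0)) mulr_sumr; apply: eq_bigr => j _.
  by rewrite !mulrA.
move=> d _; exists (fun j i => lam (d * y j * X`_i)); split=> // j.
rewrite !mulrA NVc -(mulrA _ d) [in LHS]al_y mulr_sumr mulr_suml.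
by apply: eq_bigr => i _; rewrite -scalerAr -scalerAl.
Qed.

End Division.

(** * Lifting along nilpotent ideals *)

(** Additive bookkeeping for [section_modulo], with the products there treated as atoms. *)
Lemma section_defect_identity (V : zmodType) (a b p q s u v : V) :
  a + (p + (q + s) - u) - (b + p + (q + v)) = a - b - u + s - v.
Proof.
rewrite !opprD !addrA [LHS](ACl (1*6*5*4*9*(2*7)*(3*8)))%AC /=.
by rewrite !subrr !addr0.
Qed.


Section Ideals.
Variables (k : fieldType) (R : falgType k) (J : {vspace R}).
Hypothesis J_l : forall r x, x \in J -> r * x \in J.
Hypothesis J_r : forall r x, x \in J -> x * r \in J.

Lemma expv_ideal_l n r x : x \in (J ^+ n.+1)%VS -> r * x \in (J ^+ n.+1)%VS.
Proof.
have JJ : (fullv * J <= J)%VS by apply/prodvP => a b _; apply: J_l.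
move=> hx; have : r * x \in (fullv * J ^+ n.+1)%VS by apply: memv_mul; rewrite ?memvf.
by apply/subvP; rewrite expvSl prodvA prodvSl.
Qed.

Lemma expv_ideal_r n r x : x \in (J ^+ n.+1)%VS -> x * r \in (J ^+ n.+1)%VS.
Proof.
have JJ : (J * fullv <= J)%VS by apply/prodvP => a b hb _; apply: J_r.
move=> hx; have : x * r \in (J ^+ n.+1 * fullv)%VS by apply: memv_mul; rewrite ?memvf.
by apply/subvP; rewrite expvSr -prodvA prodvSr.
Qed.

(** Of the 2n+2 factors only n+2 are kept, which is enough to improve a section by one power at each
    step. *)
Lemma expv_ideal_mul n x y : x \in (J ^+ n.+1)%VS -> y \in (J ^+ n.+1)%VS ->
  x * y \in (J ^+ n.+2)%VS.
Proof.
move=> hx hy; rewrite expvSl; apply: memv_mul => //.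
suff /subvP : (J ^+ n.+1 <= J)%VS by apply.
case: n {hx hy} => [|n]; first by rewrite expv1.
by rewrite expvSr; apply/prodvP => a b _; apply: J_l.
Qed.

Section Lift.
Variables (D : falgType k) (pi : 'Hom(R, D)).
Hypothesis pi_1 : pi 1 = 1.
Hypothesis pi_M : forall x y, pi (x * y) = pi x * pi y.
Hypothesis pi_surj : forall d, exists r, pi r = d.
Hypothesis pi_ker : lker pi = J.
Hypothesis D_casimir : exists n (x y : 'I_n -> D), casimir (fun=> True) x y.

(* Lifting a separable algebra along a nilpotent ideal: the Hochschild
   two-cocycle of a linear section is the coboundary of a sum over the
   Casimir element. *)
Lemma section_modulo n : exists sigma : 'Hom(D, R), [/\ forall d, pi (sigma d) = d,
  1 - sigma 1 \in (J ^+ n.+1)%VS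
  & forall a b, sigma (a * b) - sigma a * sigma b \in (J ^+ n.+1)%VS].
Proof.
elim: n => [|n [s [s_id s1 sM]]].
  have E1 d : pi ((pi^-1)%VF d) = d.
    by apply: limg_lfunVK; have [r <-] := pi_surj d; apply: memv_img; apply: memvf.
  exists (pi^-1)%VF; rewrite expv1 -pi_ker; split=> // [|a b].
    by rewrite memv_ker linearB /= E1 pi_1 subrr.
  by rewrite memv_ker linearB /= pi_M !E1 subrr.
have [m [x [y [xy1 cas]]]] := D_casimir.
pose g a b := s (a * b) - s a * s b.
pose t a := \sum_j g a (x j) * s (y j).
pose s' := (s + \sum_j (amulr (s (y j)) \o
   ((s \o amulr (x j)) - (amulr (s (x j)) \o s))))%VF.
have s'E a : s' a = s a + t a.
  rewrite add_lfunE sum_lfunE; congr (_ + _); apply: eq_bigr => j _.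
  by rewrite comp_lfunE lfunE /= add_lfunE opp_lfunE !comp_lfunE !lfunE.
have gI a b : g a b \in (J ^+ n.+1)%VS by apply: sM.
have tI a : t a \in (J ^+ n.+1)%VS by apply: rpred_sum => j _; apply: expv_ideal_r.
pose u := \sum_j s (x j) * s (y j).
have uE : 1 - u = (1 - s 1) + \sum_j g (x j) (y j).
  by rewrite /g sumrB -/u -linear_sum xy1 addrA subrK.
have uI : 1 - u \in (J ^+ n.+1)%VS by rewrite uE rpredD // rpred_sum.
have le2 : (J ^+ n.+2 <= J ^+ n.+1)%VS.
  by rewrite expvSl; apply/prodvP => a b _; apply: expv_ideal_l.
exists s'; split.
- move=> d; rewrite s'E linearD /= s_id.
  suff -> : pi (t d) = 0 by rewrite addr0.
  apply/eqP; rewrite -memv_ker pi_ker.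
  have /subvP : (J ^+ n.+1 <= J)%VS.
    case: (n) => [|p]; first by rewrite expv1.
    by rewrite expvSr; apply/prodvP => a b _; apply: J_l.
  by apply.
(* The defect at the unit improves along with the multiplicative one: both factors lie in
   [J ^+ n.+1]. *)
- have -> : 1 - s' 1 = (1 - s 1) * (1 - u).
    have t1 : t 1 = (1 - s 1) * u.
      rewrite /t /u mulr_sumr; apply: eq_bigr => j _.
      by rewrite /g [1 * x j]mul1r mulrA [(1 - _) * _]mulrBl mul1r.
    by rewrite mulrBr mulr1 -t1 s'E opprD addrA.
  exact: expv_ideal_mul.
- move=> a b.
  have cocycle c : g (a * b) c = s a * g b c + g a (b * c) - g a b * s c.
    rewrite /g mulrBr mulrBl !mulrA [_ + (_ - s a * _)]addrC addrA subrK.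
    by rewrite opprB addrA subrK.
  have [al [bx yb]] := cas b I.
  have E1 : \sum_j g a (b * x j) * s (y j) = t a * s b + \sum_j g a (x j) * g (y j) b.
    have gx c : s a * s c = s (a * c) - g a c by rewrite /g opprB addrC subrK.
    have gs (F : 'I_m -> k) : g a (\sum_l F l *: x l) = \sum_l F l *: g a (x l).
      rewrite /g mulr_sumr !linear_sum mulr_sumr -sumrB; apply: eq_bigr => l _.
      by rewrite -scalerAr !linearZ /= -scalerAr scalerBr.
    under eq_bigr => j _ do rewrite bx gs mulr_suml.
    rewrite exchange_big mulr_suml -big_split; apply: eq_bigr => l _ /=.
    rewrite -mulrA -mulrDr [s (y l) * s b + _]addrC subrK yb linear_sum mulr_sumr.
    by apply: eq_bigr => j _; rewrite linearZ /= -scalerAl -scalerAr.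
  have E2 : t (a * b) = s a * t b + (t a * s b + \sum_j g a (x j) * g (y j) b) - g a b * u.
    rewrite -E1 /t /u !mulr_sumr -big_split -sumrB; apply: eq_bigr => j _ /=.
    by rewrite cocycle mulrBl mulrDl !mulrA.
  (* What remains of the defect is a combination of products of two elements of [J ^+ n.+1]. *)
  have -> : s' (a * b) - s' a * s' b =
      g a b * (1 - u) + \sum_j g a (x j) * g (y j) b - t a * t b.
    rewrite !s'E E2 mulrBr mulr1 (mulrDl (s a) (t a)) !(mulrDr _ (s b)).
    exact: (section_defect_identity (s (a * b)) (s a * s b)).
  by rewrite rpredB ?rpredD ?rpred_sum // => *; apply: expv_ideal_mul.
Qed.

Lemma algebra_section N : (J ^+ N.+1 = 0)%VS -> exists sigma : 'Hom(D, R),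
  [/\ forall d, pi (sigma d) = d, sigma 1 = 1
    & forall a b, sigma (a * b) = sigma a * sigma b].
Proof.
move=> JN; have [s [s_id s1 sM]] := section_modulo N.
exists s; split=> //; first by move: s1; rewrite JN memv0 subr_eq0 => /eqP.
by move=> a b; have := sM a b; rewrite JN memv0 subr_eq0 => /eqP.
Qed.

End Lift.
End Ideals.

(** * The quotient of an algebra by a two-sided ideal, and Wedderburn's theorem for local
    algebras *)

Section Quotient.
Variables (k : fieldType) (R : falgType k) (J : {vspace R}).
Hypothesis J_l : forall r x, x \in J -> r * x \in J.
Hypothesis J_r : forall r x, x \in J -> x * r \in J.
Hypothesis J_1 : 1 \notin J.

Let C := (J^C)%VS.
Let p (x : R) : R := x - projv J x.

Let pD x y : p (x + y) = p x + p y.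
Proof. by rewrite /p linearD /= opprD addrACA. Qed.
Let pZ a x : p (a *: x) = a *: p x.
Proof. by rewrite /p linearZ /= scalerBr. Qed.
Let p_C x : p x \in C.
Proof. by rewrite /C -lker_proj memv_ker linearB /= projv_proj subrr. Qed.
Let p_id x : x \in C -> p x = x.
Proof. by rewrite /C -lker_proj memv_ker /p => /eqP ->; rewrite subr0. Qed.
Let p_J x : x - p x \in J.
Proof. by rewrite /p opprB addrC subrK memv_proj. Qed.
Let p0 x : x \in J -> p x = 0.
Proof. by move=> h; rewrite /p projv_id ?subrr. Qed.
Let p_eq x y : x - y \in J -> p x = p y.
Proof.
move=> h; apply/subr0_eq; rewrite -(p0 h) -[x in RHS](subrK y) addrK.
by rewrite -{1}[x](subrK y) pD addrK.
Qed.

(** The quotient is realised on a linear complement of J, whose vector space structure is at hand;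
    the product is the product of R projected back along J. *)
Definition ideal_quot := subvs_of C.
HB.instance Definition _ := Vector.on ideal_quot.

Let qproj (x : R) : ideal_quot := vsproj C (p x).
Let qprojK x : vsval (qproj x) = p x.
Proof. by rewrite vsprojK. Qed.
Let qmul (x y : ideal_quot) := qproj (vsval x * vsval y).

Let p_mul x y : p (p x * p y) = p (x * y).
Proof.
apply: p_eq; rewrite -opprB rpredN.
have -> : x * y - p x * p y = (x - p x) * y + p x * (y - p y).
  by move: (p x) (p y) => px py; rewrite mulrBl mulrBr addrA subrK.
by rewrite rpredD //; [apply: J_r|apply: J_l].
Qed.

Let qmulA : associative qmul.
Proof.
move=> x y z; apply: subvs_inj; rewrite !qprojK.
rewrite -[vsval x in LHS]p_id ?subvsP // -[vsval z in RHS]p_id ?subvsP //.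
by rewrite !p_mul mulrA.
Qed.
Let qmul1r : left_id (qproj 1) qmul.
Proof.
move=> x; apply: subvs_inj; rewrite !qprojK -{1}[vsval x]p_id ?subvsP //.
by rewrite p_mul mul1r p_id ?subvsP.
Qed.
Let qmulr1 : right_id (qproj 1) qmul.
Proof.
move=> x; apply: subvs_inj; rewrite !qprojK -{1}[vsval x]p_id ?subvsP //.
by rewrite p_mul mulr1 p_id ?subvsP.
Qed.
Let qmulDl : left_distributive qmul +%R.
Proof. by move=> x y z; apply: subvs_inj; rewrite linearD /= !qprojK linearD mulrDl pD. Qed.
Let qmulDr : right_distributive qmul +%R.
Proof. by move=> x y z; apply: subvs_inj; rewrite linearD /= !qprojK linearD mulrDr pD. Qed.
Let q1_neq0 : qproj 1 != 0.
Proof.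
apply: contraNneq J_1 => /(congr1 vsval); rewrite qprojK linear0 => p1.
by have := p_J 1; rewrite p1 subr0.
Qed.
HB.instance Definition _ :=
  GRing.Zmodule_isNzRing.Build ideal_quot qmulA qmul1r qmulr1 qmulDl qmulDr q1_neq0.
Let qscaleAl (a : k) (x y : ideal_quot) : a *: (x * y) = a *: x * y.
Proof. by apply: subvs_inj; rewrite linearZ /= !qprojK linearZ -scalerAl pZ. Qed.
HB.instance Definition _ := GRing.Lmodule_isLalgebra.Build k ideal_quot qscaleAl.
Let qscaleAr (a : k) (x y : ideal_quot) : a *: (x * y) = x * (a *: y).
Proof. by apply: subvs_inj; rewrite linearZ /= !qprojK linearZ -scalerAr pZ. Qed.
HB.instance Definition _ := GRing.Lalgebra_isAlgebra.Build k ideal_quot qscaleAr.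
HB.instance Definition _ := Algebra_isFalgebra.Build k ideal_quot.

Lemma ideal_quotient : exists (D : falgType k) (pi : 'Hom(R, D)),
  [/\ pi 1 = 1, forall x y, pi (x * y) = pi x * pi y,
      forall d, exists r, pi r = d & lker pi = J].
Proof.
have lin : linear qproj.
  move=> a x y; apply: subvs_inj.
  by rewrite linearD linearZ /= !qprojK pD pZ.
pose f : {linear R -> ideal_quot} := HB.pack (qproj : R -> ideal_quot)
  (GRing.isLinear.Build k R ideal_quot *:%R qproj lin).
exists ideal_quot, (linfun f); split.
- by rewrite lfunE.
- move=> x y; rewrite !lfunE; apply: subvs_inj.
  by rewrite [RHS]qprojK /= !qprojK p_mul.
- move=> d; exists (vsval d); rewrite lfunE; apply: subvs_inj.
  by rewrite qprojK p_id ?subvsP.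
- apply/vspaceP => x; rewrite memv_ker lfunE /=; apply/eqP/idP => [|xJ].
    by move/(congr1 vsval); rewrite qprojK linear0 => px; have := p_J x; rewrite px subr0.
  by apply: subvs_inj; rewrite qprojK p0 // linear0.
Qed.

End Quotient.

(** The powers of J stabilise at some U with U U = U. If U were nonzero, descend on subspaces L
    stable under U with U L nonzero: pick x in L with U x nonzero. Either x is not in U x, which is
    a smaller such subspace, or x = u x with u nilpotent, so x = 0. *)
Lemma nil_ideal_nilpotent (k : fieldType) (R : falgType k) (J : {vspace R}) :
  (forall r x, x \in J -> r * x \in J) ->
  (forall x, x \in J -> exists n, x ^+ n = 0) -> exists n, (J ^+ n.+1 = 0)%VS.
Proof.
move=> J_l nil.
have stab : forall m n, (\dim (J ^+ n.+1) <= m)%N ->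
    exists n, (J * J ^+ n.+1 = J ^+ n.+1)%VS.
  elim=> [|m IH] n le.
    by exists n; move: le; rewrite leqn0 dimv_eq0 => /eqP ->; rewrite prodv0.
  have [E1|ne] := eqVneq (J * J ^+ n.+1)%VS (J ^+ n.+1)%VS; first by exists n.
  apply: (IH n.+1); rewrite -ltnS; apply: leq_trans le.
  have leJ : (J * J ^+ n.+1 <= J ^+ n.+1)%VS.
    by apply/prodvP => a b _; apply: expv_ideal_l.
  rewrite expvSl ltnNge; apply: contra ne => leU.
  by rewrite eqEdim leJ leU.
have [n JU] := stab _ 0%N (leqnn _).
exists n; apply/eqP; apply: contraT => U0; exfalso; move: U0 JU.
set U := (J ^+ n.+1)%VS => U0 JU.
have UU : (U * U = U)%VS.
  have : forall m, (J ^+ m * U = U)%VS.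
    by elim=> [|m IH]; rewrite ?expv0 ?prod1v // expvSr -prodvA JU IH.
  by apply.
have UJ : (U <= J)%VS.
  rewrite /U; case: (n) => [|m]; first by rewrite expv1.
  by rewrite expvSr; apply/prodvP => a b _; apply: J_l.
suff : forall m (L : {vspace R}), (\dim L <= m)%N -> (U * L <= L)%VS -> (U * L)%VS != 0%VS -> False.
  apply; [exact: leqnn|exact: subvf|]; apply: contraNneq U0 => E1.
  by rewrite -subv0 -E1 -{1}(prodv1 U) prodvSr ?subvf.
elim=> [|m IH] L.
  by rewrite leqn0 dimv_eq0 => /eqP -> _; rewrite prodv0 eqxx.
move=> dL UL ne.
have [x xL Ux] : exists2 x, x \in L & (U * <[x]>)%VS != 0%VS.
  apply: NNPP => no; move/eqP: ne; apply; apply/eqP; rewrite -subv0; apply/prodvP => u x uU xL.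
  apply: contraT => ux; exfalso; apply: no; exists x => //.
  apply: contraNneq ux => <-; exact: memv_mul (memv_line x).
have L'L : (U * <[x]> <= L)%VS.
  by apply: subv_trans UL; apply: prodvSr; rewrite -memvE.
have [xL'|nxL'] := boolP (x \in (U * <[x]>)%VS).
  have /memv_cosetP [u uU E1] := xL'.
  have [N uN] := nil u (subvP UJ _ uU).
  have : x = u ^+ N * x.
    by elim: (N) => [|q IHq]; rewrite ?expr0 ?mul1r // exprSr -mulrA -E1.
  by rewrite uN mul0r => x0; move/eqP: Ux; apply; rewrite x0; apply/eqP;
    rewrite -subv0; apply/prodvP => a b _ /vlineP [c ->];
    rewrite scaler0 mulr0 mem0v.
apply: (IH (U * <[x]>)%VS).
- rewrite -ltnS; apply: leq_trans dL; rewrite ltnNge; apply: contra nxL' => dl.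
  have /eqP -> : (U * <[x]>)%VS == L by rewrite eqEdim L'L dl.
  exact: xL.
- by rewrite prodvA UU.
- by rewrite prodvA UU.
Qed.

(** R is local with radical J. The quotient is a division algebra, hence has a Casimir element,
    hence lifts to R; K is the image of a lifting, and the Casimir element is transported along
    it. *)
Lemma wedderburn (k : fieldType) (R : falgType k) (J : {vspace R}) :
  perfect_field k ->
  (forall r x, x \in J -> r * x \in J) -> (forall r x, x \in J -> x * r \in J) ->
  1 \notin J -> (forall x, x \in J -> exists n, x ^+ n = 0) ->
  (forall x, x \notin J -> x \is a GRing.unit) ->
  exists K : {vspace R}, [/\ 1 \in K, {in K &, forall x y, x * y \in K},
    forall r, exists2 x, x \in K & r - x \in J,
    forall x, x \in K -> x \in J -> x = 0
  & exists n (x y : 'I_n -> R), [/\ forall j, x j \in K, forall j, y j \in K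
     & casimir (fun a => a \in K) x y]].
Proof.
move=> perf J_l J_r J_1 nil units.
have [N JN] := nil_ideal_nilpotent J_l nil.
have [D [pi [pi1 piM pi_surj pi_ker]]] := ideal_quotient J_l J_r J_1.
have D_unit (d : D) : d != 0 -> d \is a GRing.unit.
  have [r <-] := pi_surj d => r0.
  have ur : r \is a GRing.unit by apply: units; rewrite -pi_ker memv_ker.
  by apply/unitrP; exists (pi r^-1); rewrite -!piM mulVr // mulrV // pi1.
have cas := division_casimir perf D_unit.
have [s [s_id s1 sM]] := algebra_section J_l J_r pi1 piM pi_surj pi_ker cas JN.
exists (limg s); split.
- by rewrite -s1 memv_img ?memvf.
- by move=> _ _ /memv_imgP [a _ ->] /memv_imgP [b _ ->]; rewrite -sM memv_img ?memvf.
- move=> r; exists (s (pi r)); first by rewrite memv_img ?memvf.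
  by rewrite -pi_ker memv_ker linearB /= s_id subrr.
- move=> _ /memv_imgP [a _ ->]; rewrite -pi_ker memv_ker s_id => /eqP ->.
  exact: linear0.
have [n [x [y [xy casim]]]] := cas.
exists n, (s \o x), (s \o y); split=> [j|j|]; try by rewrite memv_img ?memvf.
split; first by rewrite -s1 -xy linear_sum; apply: eq_bigr => j _ /=; rewrite sM.
move=> _ /memv_imgP [a _ ->]; have [al [E1 E2]] := casim a I.
exists al; split=> j /=; rewrite -sM ?E1 ?E2 linear_sum; apply: eq_bigr => l _;
  exact: linearZ.
Qed.

(** * Modules as matrix representations *)

Section Coordinates.
Variables (k : fieldType) (A : falgType k).
Local Notation modA := (modA A).
Implicit Types M N P : modA.

(** A module carries only its action of [A^c]; the k-structure is recovered through the scalars of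
    A. *)
Definition kscale (M : modA) (c : k) (x : M) : M := (c%:A : A^c) *: x.

Lemma kscaleA (M : modA) c d (x : M) : kscale c (kscale d x) = kscale (c * d) x.
Proof. by rewrite /kscale scalerA; congr (_ *: _); rewrite -[LHS]/(d%:A * c%:A) mulr_algl scalerA mulrC. Qed.

Lemma kscaleDl (M : modA) c d (x : M) : kscale (c + d) x = kscale c x + kscale d x.
Proof. by rewrite /kscale -scalerDl; congr (_ *: _); rewrite scalerDl. Qed.

Lemma kscale1 (M : modA) (x : M) : kscale 1 x = x.
Proof. by rewrite /kscale -[RHS]scale1r; congr (_ *: _); rewrite scale1r. Qed.

Lemma kscale0 (M : modA) (x : M) : kscale 0 x = 0.
Proof. by rewrite /kscale -[RHS](scale0r x); congr (_ *: _); rewrite scale0r. Qed.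

Lemma kscale_r0 (M : modA) c : kscale c (0 : M) = 0.
Proof. exact: scaler0. Qed.

Lemma kscale_sumr (M : modA) c n (F : 'I_n -> M) :
  kscale c (\sum_i F i) = \sum_i kscale c (F i).
Proof. exact: scaler_sumr. Qed.

Lemma kscaleC (M : modA) c (a : A) (x : M) :
  (a : A^c) *: kscale c x = kscale c ((a : A^c) *: x).
Proof.
rewrite /kscale !scalerA; congr (_ *: _).
by rewrite -[LHS]/(c%:A * a : A) -[RHS]/(a * c%:A : A) mulr_algl mulr_algr.
Qed.

Record coordinates (M : modA) := Coordinates {
  cdim : nat;
  cvec : M -> 'rV[k]_cdim;
  cmod : 'rV[k]_cdim -> M;
  cvecK : cancel cvec cmod;
  cmodK : cancel cmod cvec;
  cvecD : forall x y, cvec (x + y) = cvec x + cvec y;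
  cvecZ : forall c x, cvec (kscale c x) = c *: cvec x
}.

(** Either the spanning family is free, or a linear relation expresses one member through the others
    and it is dropped. *)
Lemma coordinates_of_span (M : modA) n (t : 'I_n -> M) :
  (forall x, exists c : 'I_n -> k, x = \sum_i kscale (c i) (t i)) ->
  inhabited (coordinates M).
Proof.
elim: n t => [|n IH] t sp.
  have M0 (x y : M) : x = y by have [c ->] := sp x; have [d ->] := sp y; rewrite !big_ord0.
  constructor; apply: (@Coordinates M 0 (fun=> 0) (fun=> 0)).
  - by move=> x; apply: M0.
  - by move=> v; rewrite [v]thinmx0.
  - by move=> x y; rewrite addr0.
  - by move=> c x; rewrite scaler0.
pose F (v : 'rV[k]_n.+1) : M := \sum_i kscale (v 0 i) (t i).
have FD u v : F (u + v) = F u + F v.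
  by rewrite -big_split; apply: eq_bigr => i _; rewrite mxE kscaleDl.
have FZ c v : F (c *: v) = kscale c (F v).
  by rewrite /F kscale_sumr; apply: eq_bigr => i _; rewrite mxE kscaleA.
have [ker0|] := classic (forall v, F v = 0 -> v = 0).
  have Finj u v : F u = F v -> u = v.
    move=> E1; apply/subr0_eq/ker0; rewrite -scaleN1r FD FZ E1.
    by rewrite -[X in X + _]kscale1 -kscaleDl subrr kscale0.
  have H x : {v : 'rV[k]_n.+1 | F v = x}.
    apply: constructive_indefinite_description; have [c ->] := sp x.
    by exists (\row_i c i); apply: eq_bigr => i _; rewrite mxE.
  have HK x : F (sval (H x)) = x by case: (H x).
  constructor; apply: (@Coordinates M n.+1 (fun x => sval (H x)) F HK).
  - by move=> v; apply: Finj.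
  - by move=> x y; apply: Finj; rewrite FD !HK.
  - by move=> c x; apply: Finj; rewrite FZ !HK.
move=> /not_all_ex_not [v nv]; have [Fv /eqP v0] := imply_to_and _ _ nv.
have [i vi] : exists i, v 0 i != 0 by apply/rV0Pn.
have ti : t i = \sum_(j < n) kscale (- (v 0 i)^-1 * v 0 (lift i j)) (t (lift i j)).
  have : kscale (- (v 0 i)^-1) (F v) = 0 by rewrite Fv kscale_r0.
  rewrite kscale_sumr (bigD1_ord i) //= kscaleA mulNr mulVf // => /eqP.
  rewrite addrC -[X in _ + X]opprK subr_eq0 => /eqP E1.
  transitivity (- kscale (-1) (t i)).
    by rewrite /kscale scaleN1r scaleNr opprK scale1r.
  by rewrite -E1; apply: eq_bigr => j _; rewrite kscaleA.
apply: (IH (t \o lift i)) => x; have [c ->] := sp x.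
exists (fun j => c i * (- (v 0 i)^-1 * v 0 (lift i j)) + c (lift i j)).
rewrite (bigD1_ord i) //= {1}ti kscale_sumr -big_split; apply: eq_bigr => j _ /=.
by rewrite kscaleDl kscaleA.
Qed.

(** Products of module generators with a basis of A span the module over k. *)
Lemma coordinates_exist (M : modA) : inhabited (coordinates M).
Proof.
have [n [s sp]] := mod_fg M.
pose d := \dim {:A}; pose e := vbasis {:A}.
pose T := ('I_n * 'I_d)%type.
pose t (z : 'I_#|{: T}|) : M := (e`_(enum_val z).2 : A^c) *: s (enum_val z).1.
apply: (@coordinates_of_span M _ t) => x; have [a ->] := sp x.
exists (fun z => coord e (enum_val z).2 (a (enum_val z).1 : A)).
pose G (y : T) : M := kscale (coord e y.2 (a y.1 : A)) ((e`_y.2 : A^c) *: s y.1).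
transitivity (\sum_(y in {: T}) G y); last exact: big_enum_val.
rewrite (eq_bigl predT) // -(pair_bigA _ (fun i j => G (i, j))) /G /=.
apply: eq_bigr => i _; rewrite {1}(coord_vbasis (memvf (a i : A))) scaler_suml.
apply: eq_bigr => j _; rewrite /kscale scalerA; congr (_ *: _).
by rewrite -[RHS]/(e`_j * (coord e j (a i : A))%:A : A) mulr_algr.
Qed.

Definition mcoord (M : modA) : coordinates M :=
  epsilon (coordinates_exist M) (fun=> True).
Definition dm M := cdim (mcoord M).
Definition vec M (x : mod_car M) : 'rV[k]_(dm M) := @cvec M (mcoord M) x.
Definition elt M (v : 'rV[k]_(dm M)) : M := @cmod M (mcoord M) v.

Lemma vecK M : cancel (@vec M) (@elt M). Proof. exact: cvecK. Qed.
Lemma eltK M : cancel (@elt M) (@vec M). Proof. exact: cmodK. Qed.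
Lemma vecD M (x y : M) : vec (x + y) = vec x + vec y. Proof. exact: cvecD. Qed.
Lemma vecZ M c (x : M) : vec (kscale c x) = c *: vec x. Proof. exact: cvecZ. Qed.
Lemma vec_inj M : injective (@vec M). Proof. exact: can_inj (@vecK M). Qed.
Lemma eltD M u v : elt (u + v) = elt u + elt v :> M.
Proof. by apply: vec_inj; rewrite vecD !eltK. Qed.
Lemma eltZ M c u : elt (c *: u) = kscale c (elt u) :> M.
Proof. by apply: vec_inj; rewrite vecZ !eltK. Qed.
Lemma vec0 M : vec (0 : M) = 0.
Proof. by rewrite -(kscale0 0) vecZ scale0r. Qed.

Definition fmat M N (f : mod_car M -> mod_car N) : 'M[k]_(dm M, dm N) :=
  \matrix_i vec (f (elt (delta_mx 0 i))).

Lemma fmatE M N (f : mod_car M -> mod_car N) (x : M) :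
  (forall x y, f (x + y) = f x + f y) ->
  (forall c x, f (kscale c x) = kscale c (f x)) -> vec (f x) = vec x *m fmat f.
Proof.
move=> fD fZ; rewrite -{1}(vecK x) {1}(row_sum_delta (vec x)).
have f0 : f 0 = 0 by rewrite -(kscale0 0) fZ kscale0.
pose g v := vec (f (elt v)).
have gD u v : g (u + v) = g u + g v by rewrite /g eltD fD vecD.
have g0 : g 0 = 0 by rewrite /g -(scale0r 0) eltZ fZ kscale0 vec0.
rewrite -/(g _) (big_morph g gD g0) mulmx_sum_row; apply: eq_bigr => i _.
by rewrite /g eltZ fZ vecZ rowK.
Qed.

Definition rho M (a : A) : 'M[k]_(dm M) := fmat (fun x : M => (a : A^c) *: x).

Lemma rhoE M (a : A) (x : M) : vec ((a : A^c) *: x) = vec x *m rho M a.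
Proof. by apply: fmatE => *; [exact: scalerDr|exact: kscaleC]. Qed.

Lemma eq_rowmx m n (F G : 'M[k]_(m, n)) : (forall v : 'rV_m, v *m F = v *m G) -> F = G.
Proof. by move=> h; apply/row_matrixP => i; rewrite !rowE. Qed.

Lemma eq_vecmx M n (F G : 'M[k]_(dm M, n)) :
  (forall x : M, vec x *m F = vec x *m G) -> F = G.
Proof. by move=> h; apply: eq_rowmx => v; rewrite -(eltK v). Qed.

Lemma rho1 M : rho M 1 = 1%:M.
Proof. by apply: eq_vecmx => x; rewrite -rhoE mulmx1 scale1r. Qed.

(** Acting on row vectors from the right undoes the reversal of products in [A^c]. *)
Lemma rhoM M a b : rho M (a * b) = rho M a *m rho M b.
Proof. by apply: eq_vecmx => x; rewrite mulmxA -!rhoE scalerA. Qed.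

Lemma rhoL M c a b : rho M (c *: a + b) = c *: rho M a + rho M b.
Proof.
apply: eq_vecmx => x; rewrite mulmxDr -scalemxAr -!rhoE -vecZ -vecD; congr vec.
rewrite scalerDl /kscale scalerA; congr (_ *: _ + _).
by rewrite -[RHS]/(a * c%:A : A) mulr_algr.
Qed.

Definition hm M N (F : 'M[k]_(dm M, dm N)) := forall a, rho M a *m F = F *m rho N a.
Definition mat M N (f : mhom M N) : 'M[k]_(dm M, dm N) := fmat f.

Lemma matE M N (f : mhom M N) x : vec (f x) = vec x *m mat f.
Proof. by apply: fmatE => [y z|c y]; [rewrite linearD|rewrite /kscale linearZ]. Qed.

Lemma mat_hm M N (f : mhom M N) : hm (mat f).
Proof.
by move=> a; apply: eq_vecmx => x; rewrite !mulmxA -rhoE -!matE -rhoE linearZ.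
Qed.

Lemma mat_inj M N (f g : mhom M N) : mat f = mat g <-> f =1 g.
Proof.
split=> [E1 x|E1]; first by apply: vec_inj; rewrite !matE E1.
by apply: eq_vecmx => x; rewrite -!matE E1.
Qed.

Lemma hom_of_mat M N (F : 'M[k]_(dm M, dm N)) : hm F -> exists f : mhom M N, mat f = F.
Proof.
move=> hF; pose g (x : M) : N := elt (vec x *m F).
have lin : linear g.
  move=> a x y; apply: vec_inj; rewrite /g eltK !vecD !rhoE !eltK mulmxDl.
  by rewrite -!mulmxA hF.
pose f : mhom M N := HB.pack g (GRing.isLinear.Build A^c M N *:%R g lin).
by exists f; apply: eq_vecmx => x; rewrite -matE eltK.
Qed.

Lemma mat_comp M N P (f : mhom M N) (g : mhom N P) : mat (mcomp f g) = mat f *m mat g.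
Proof. by apply: eq_vecmx => x; rewrite mulmxA -!matE. Qed.

Lemma mat_add M N (f g : mhom M N) : mat (madd f g) = mat f + mat g.
Proof. by apply: eq_vecmx => x; rewrite mulmxDr -!matE -vecD. Qed.

Lemma mat_zero M N : mat (mzero M N) = 0.
Proof. by apply: eq_vecmx => x; rewrite mulmx0 -matE vec0. Qed.

Lemma mat_id M (f : mhom M M) : mat f = 1%:M <-> f =1 id.
Proof.
split=> [E1 x|E1]; first by apply: vec_inj; rewrite matE E1 mulmx1.
by apply: eq_vecmx => x; rewrite -matE E1 mulmx1.
Qed.

End Coordinates.

(* A copy of ['rV_d] without its [k]-module structure, so that it can carry an
   [A^c]-module structure. *)
Definition row_carrier (k : fieldType) d := 'rV[k]_d.
HB.instance Definition _ (k : fieldType) d := GRing.Zmodule.copy (row_carrier k d) 'rV[k]_d.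

Section Representations.
Variables (k : fieldType) (A : falgType k).
Local Notation modA := (modA A).
Implicit Types M N P : modA.

(** The coordinates chosen for the new module need not be the standard ones of the row space; u and
    v are the change of basis and its inverse. *)
Lemma rep_mod d (r : A -> 'M[k]_d) :
  r 1 = 1%:M -> (forall a b, r (a * b) = r a *m r b) ->
  (forall c a b, r (c *: a + b) = c *: r a + r b) ->
  exists N : modA, exists (u : 'M[k]_(dm N, d)) (v : 'M[k]_(d, dm N)),
    [/\ u *m v = 1%:M, v *m u = 1%:M & forall a, rho N a *m u = u *m r a].
Proof.
move=> r1 rM rL.
pose sc (a : A^c) (x : 'rV[k]_d) : 'rV[k]_d := x *m r a.
have rD a b : r (a + b) = r a + r b by rewrite -{1}[a]scale1r rL scale1r.
have rZ c : r c%:A = c%:M.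
  rewrite -[c%:A]addr0 rL r1 -[r 0](addKr (r 0)) -{2}[r 0]scale1r.
  by rewrite -rL scale1r addr0 addNr addr0 scalemx1.
have scA (a b : A^c) x : sc a (sc b x) = sc (a * b) x by rewrite /sc -mulmxA -rM.
have sc1 : left_id 1 sc by move=> x; rewrite /sc r1 mulmx1.
have scDr : right_distributive sc +%R by move=> a x y; rewrite /sc mulmxDl.
have scDl x : {morph sc^~ x : a b / a + b} by move=> a b; rewrite /sc rD mulmxDr.
pose V : lmodType A^c := HB.pack (row_carrier k d)
  (GRing.Zmodule_isLmodule.Build A^c (row_carrier k d) scA sc1 scDr scDl).
have scE (a : A^c) (x : V) : a *: x = (x : 'rV_d) *m r a by [].
have fg : finitely_generated V.
  exists d, (fun i => delta_mx 0 i : 'rV[k]_d) => x.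
  exists (fun i => (x : 'rV_d) 0 i *: (1 : A)).
  rewrite {1}(row_sum_delta (x : 'rV_d)); apply: eq_bigr => i _.
  by rewrite scE rZ mul_mx_scalar.
pose N := ModA fg; exists N.
pose inN : 'rV[k]_d -> N := id; pose outN : N -> 'rV[k]_d := id.
have inD x y : inN (x + y) = inN x + inN y by [].
have outD x y : outN (x + y) = outN x + outN y by [].
have outA (a : A) x : outN ((a : A^c) *: x) = outN x *m r a by [].
have outZ c x : outN (kscale c x) = c *: outN x.
  by rewrite /kscale outA rZ mul_mx_scalar.
have inZ c x : inN (c *: x) = kscale c (inN x) by rewrite -[LHS]/(c *: outN (inN x)) -outZ.
pose u : 'M[k]_(dm N, d) := \matrix_i outN (elt (delta_mx 0 i)).
pose v : 'M[k]_(d, dm N) := \matrix_i vec (inN (delta_mx 0 i)).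
have uE x : vec x *m u = outN x.
  rewrite -{2}(vecK x) {2}(row_sum_delta (vec x)) mulmx_sum_row.
  have gD a b : outN (elt (a + b)) = outN (elt a) + outN (elt b) by rewrite eltD.
  have g0 : outN (elt 0) = 0 by rewrite -(scale0r 0) eltZ outZ scale0r.
  rewrite -[RHS]/((outN \o @elt _ _ N) _) (big_morph (outN \o @elt _ _ N) gD g0).
  by apply: eq_bigr => i _; rewrite /= eltZ outZ rowK.
have vE x : x *m v = vec (inN x).
  rewrite {2}(row_sum_delta x) mulmx_sum_row.
  have gD a b : vec (inN (a + b)) = vec (inN a) + vec (inN b) by rewrite inD vecD.
  have g0 : vec (inN 0) = 0 by rewrite -(scale0r 0) inZ vecZ scale0r.
  rewrite -[RHS]/((@vec _ _ N \o inN) _) (big_morph (@vec _ _ N \o inN) gD g0).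
  by apply: eq_bigr => i _; rewrite /= inZ vecZ rowK.
exists u, v; split.
- by apply: eq_vecmx => x; rewrite mulmxA uE vE mulmx1.
- by apply: eq_rowmx => x; rewrite mulmxA vE uE mulmx1.
- by move=> a; apply: eq_vecmx => x; rewrite !mulmxA -rhoE !uE.
Qed.

End Representations.

(** * Submodules, quotients, kernels, images and direct sums in coordinates *)

Section Constructions.
Variables (k : fieldType) (A : falgType k).
Local Notation modA := (modA A).
Implicit Types M N P : modA.

Lemma hm_0 M N : hm (0 : 'M_(dm M, dm N)).
Proof. by move=> a; rewrite mulmx0 mul0mx. Qed.
Lemma hm_1 M : hm (1%:M : 'M_(dm M)).
Proof. by move=> a; rewrite mulmx1 mul1mx. Qed.
Lemma hm_D M N (F G : 'M_(dm M, dm N)) : hm F -> hm G -> hm (F + G).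
Proof. by move=> hF hG a; rewrite mulmxDr hF hG mulmxDl. Qed.
Lemma hm_Z M N c (F : 'M_(dm M, dm N)) : hm F -> hm (c *: F).
Proof. by move=> hF a; rewrite -scalemxAr hF scalemxAl. Qed.
Lemma hm_N M N (F : 'M_(dm M, dm N)) : hm F -> hm (- F).
Proof. by move=> hF a; rewrite mulmxN hF mulNmx. Qed.
Lemma hm_B M N (F G : 'M_(dm M, dm N)) : hm F -> hm G -> hm (F - G).
Proof. by move=> hF hG; apply: hm_D => //; apply: hm_N. Qed.
Lemma hm_M M N P (F : 'M_(dm M, dm N)) (G : 'M_(dm N, dm P)) : hm F -> hm G -> hm (F *m G).
Proof. by move=> hF hG a; rewrite mulmxA hF -mulmxA hG mulmxA. Qed.
Lemma hm_sum M N (T : finType) (F : T -> 'M_(dm M, dm N)) :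
  (forall i, hm (F i)) -> hm (\sum_i F i).
Proof. by move=> h; apply: big_ind => //; [exact: hm_0|exact: hm_D]. Qed.
Lemma hm_inv M (F : 'M_(dm M)) : hm F -> F \in unitmx -> hm (invmx F).
Proof.
move=> hF uF a.
by rewrite -[rho M a in LHS](mulKmx uF) -hF -!mulmxA mulmxV // mulmx1.
Qed.
Lemma hm_free M N P (c : 'M_(dm M, dm N)) (F : 'M_(dm N, dm P)) :
  row_free F -> hm F -> hm (c *m F) -> hm c.
Proof.
move=> fF hF hcF a; apply: (row_free_inj fF).
by rewrite -[LHS]mulmxA hcF -[RHS]mulmxA hF mulmxA.
Qed.

Lemma hm_full M N P (F : 'M_(dm M, dm N)) (c : 'M_(dm N, dm P)) :
  row_full F -> hm F -> hm (F *m c) -> hm c.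
Proof.
case/row_fullP => G GF hF hFc a.
rewrite -[LHS]mul1mx -[RHS]mul1mx -GF -!mulmxA; congr (_ *m _).
by rewrite mulmxA -hF -mulmxA hFc mulmxA.
Qed.

Lemma submodule M m (U : 'M_(m, dm M)) : (forall a, U *m rho M a <= U)%MS ->
  exists N (i : 'M_(dm N, dm M)), [/\ hm i, row_free i & (i :=: U)%MS].
Proof.
move=> st; set B := row_base U.
have fB : row_free B by apply: row_base_free.
have stB a : (B *m rho M a <= B)%MS.
  by rewrite (eqmxMr _ (eq_row_base U)) eq_row_base st.
pose r a := B *m rho M a *m pinvmx B.
have rB a : r a *m B = B *m rho M a by rewrite mulmxKpV.
have [|||N [u [v [uv vu h]]]] := @rep_mod k A _ r.
- by rewrite /r rho1 mulmx1 mulmxVp.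
- move=> a b; apply: (row_free_inj fB).
  by rewrite /= rB -(mulmxA (r a)) rB (mulmxA (r a)) rB -mulmxA -rhoM.
- move=> c a b; apply: (row_free_inj fB).
  by rewrite /= mulmxDl -scalemxAl !rB rhoL mulmxDr -scalemxAr.
have uu : row_free u by apply/row_freeP; exists v.
exists N, (u *m B); split.
- by move=> a; rewrite mulmxA h -mulmxA rB mulmxA.
- by rewrite -row_leq_rank mxrankMfree // row_leq_rank.
- apply: (eqmx_trans _ (eq_row_base U)); apply/eqmxP; rewrite submxMl /=.
  by rewrite -[X in (X <= _)%MS](mul1mx B) -vu -mulmxA submxMl.
Qed.

(** The projection is a column base of the cokernel matrix of U, followed by a change of basis; [q']
    is a k-linear section of it. *)
Lemma quotient_module M m (U : 'M_(m, dm M)) : (forall a, U *m rho M a <= U)%MS ->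
  exists N (q : 'M_(dm M, dm N)) (q' : 'M_(dm N, dm M)), [/\ hm q, q' *m q = 1%:M
    & forall n (v : 'M_(n, dm M)), (v *m q == 0) = (v <= U)%MS].
Proof.
move=> st.
have [n0 [c [c' [c'c kc]]]] : exists n0 (c : 'M_(dm M, n0)) (c' : 'M_(n0, dm M)),
    c' *m c = 1%:M /\ forall n (v : 'M_(n, dm M)), (v *m c == 0) = (v <= U)%MS.
  have [c' c'c] : exists c', c' *m col_base (cokermx U) = 1%:M.
    by apply/row_fullP; apply: col_base_full.
  exists (\rank (cokermx U)), (col_base (cokermx U)), c'; split=> // n v.
  rewrite submxE -[in RHS](mulmx_base (cokermx U)) mulmxA.
  apply/eqP/eqP => [->|]; first by rewrite mul0mx.
  by rewrite -(mul0mx _ (row_base (cokermx U))) => /(row_free_inj (row_base_free _)).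
have E1 a : c *m (c' *m rho M a *m c) = rho M a *m c.
  apply/eqP; rewrite -subr_eq0 -oppr_eq0 opprB !mulmxA -{1}[rho M a]mul1mx -!mulmxBl kc.
  apply: submx_trans (st a); apply: submxMr; rewrite -kc mulmxBl mul1mx -mulmxA c'c.
  by rewrite mulmx1 subrr.
pose r a := c' *m rho M a *m c.
have [|||N [u [v [uv vu h]]]] := @rep_mod k A _ r.
- by rewrite /r rho1 mulmx1.
- by move=> a b; rewrite /r -(mulmxA _ c) E1 rhoM !mulmxA.
- by move=> d a b; rewrite /r rhoL mulmxDr mulmxDl -scalemxAr -scalemxAl.
have hv a : r a *m v = v *m rho N a.
  by rewrite -[LHS]mul1mx -vu -mulmxA (mulmxA u) -h -mulmxA uv mulmx1.
exists N, (c *m v), (u *m c'); split.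
- by move=> a; rewrite mulmxA -E1 -mulmxA -/(r a) hv mulmxA.
- by rewrite mulmxA -(mulmxA u) c'c mulmx1.
- move=> n w; rewrite mulmxA -kc; apply/eqP/eqP => [E2|->]; last by rewrite mul0mx.
  by rewrite -[LHS]mulmx1 -vu mulmxA E2 mul0mx.
Qed.

Lemma kernel_module M N (F : 'M_(dm M, dm N)) : hm F ->
  exists P (i : 'M_(dm P, dm M)), [/\ hm i, row_free i, i *m F = 0
    & forall n (g : 'M_(n, dm M)), g *m F = 0 -> exists c, g = c *m i].
Proof.
move=> hF; have [|P [i [hi fi Ei]]] := @submodule M _ (kermx F).
  by move=> a; rewrite sub_kermx -mulmxA hF mulmxA mulmx_ker mul0mx.
exists P, i; split=> //; first by apply/eqP; rewrite -sub_kermx Ei.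
by move=> n g /eqP; rewrite -sub_kermx -Ei => /submxP.
Qed.

Lemma image_module M N (F : 'M_(dm M, dm N)) : hm F ->
  exists P (p : 'M_(dm M, dm P)) (i : 'M_(dm P, dm N)),
    [/\ hm p, hm i, row_free i, F = p *m i & row_full p].
Proof.
move=> hF; have [|P [i [hi fi Ei]]] := @submodule N _ F.
  by move=> a; rewrite -hF submxMl.
have /submxP [p E1] : (F <= i)%MS by rewrite Ei.
exists P, p, i; split=> //; first by apply: (hm_free fi hi); rewrite -E1.
rewrite -col_leq_rank -(mxrankMfree p fi) -E1 -Ei.
by move: fi; rewrite -row_leq_rank.
Qed.

Lemma sum_module M N : exists S (i1 : 'M_(dm M, dm S)) (i2 : 'M_(dm N, dm S))
    (p1 : 'M_(dm S, dm M)) (p2 : 'M_(dm S, dm N)),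
  [/\ [/\ hm i1, hm i2, hm p1 & hm p2], i1 *m p1 = 1%:M /\ i2 *m p2 = 1%:M,
      i1 *m p2 = 0 /\ i2 *m p1 = 0 & p1 *m i1 + p2 *m i2 = 1%:M].
Proof.
pose r a := block_mx (rho M a) 0 0 (rho N a).
have [|||S [u [v [uv vu h]]]] := @rep_mod k A _ r.
- by rewrite /r !rho1 -scalar_mx_block.
- by move=> a b; rewrite /r mulmx_block !mul0mx !mulmx0 !addr0 !add0r !rhoM.
- by move=> c a b; rewrite /r !rhoL scale_block_mx add_block_mx !scaler0 !addr0.
have hv a : r a *m v = v *m rho S a.
  by rewrite -[LHS]mul1mx -vu -mulmxA (mulmxA u) -h -mulmxA uv mulmx1.
exists S, (row_mx 1%:M 0 *m v), (row_mx 0 1%:M *m v), (u *m col_mx 1%:M 0), (u *m col_mx 0 1%:M).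
have vuK m n (x : 'M_(m, _)) (y : 'M_(_, n)) : x *m v *m (u *m y) = x *m y.
  by rewrite mulmxA -(mulmxA x) vu mulmx1.
rewrite !vuK !mul_row_col !mulmx0 !mul0mx !mulmx1 !addr0 !add0r.
split=> //; first split=> a.
- rewrite -[RHS]mulmxA -hv !mulmxA; congr (_ *m _).
  by rewrite mul_mx_row mul_row_block !mul0mx !mulmx0 mulmx1 mul1mx !addr0.
- rewrite -[RHS]mulmxA -hv !mulmxA; congr (_ *m _).
  by rewrite mul_mx_row mul_row_block !mul0mx !mulmx0 mulmx1 mul1mx !add0r.
- rewrite mulmxA h -!mulmxA; congr (_ *m _).
  by rewrite /r mul_block_col mul_col_mx !mul0mx !mulmx0 mulmx1 mul1mx !addr0.
- rewrite mulmxA h -!mulmxA; congr (_ *m _).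
  by rewrite /r mul_block_col mul_col_mx !mul0mx !mulmx0 mulmx1 mul1mx !add0r.
rewrite !mulmxA -mulmxDl -!(mulmxA u) -mulmxDr !mul_col_row add_block_mx.
by rewrite !mulmx0 !mul0mx !mulmx1 !addr0 !add0r -scalar_mx_block mulmx1.
Qed.

End Constructions.

(** * Indecomposable modules *)

Definition mxpow (k : fieldType) d (F : 'M[k]_d) n : 'M_d := iter n (mulmx F) 1%:M.

Lemma mxpowE (k : fieldType) d (F : 'M[k]_d.+1) n : mxpow F n = F ^+ n.
Proof. by elim: n => //= n IH; rewrite exprS -IH. Qed.

(** The Fitting decomposition: e projects onto the part where F is invertible, along the part where
    it is nilpotent. It is a polynomial in F, obtained from the factorisation of the characteristic
    polynomial as X^m q with q prime to X; so it commutes with the action of A whenever F does. *)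
Lemma fitting_idempotent (k : fieldType) d (F : 'M[k]_d) : exists e u n,
  [/\ e *m e = e, e = u *m F, mxpow F n *m (1%:M - e) = 0
    & forall B, B *m F = F *m B -> B *m e = e *m B].
Proof.
case: d F => [|d] F.
  by exists 1%:M, 1%:M, 0%N; split=> *; apply/matrixP => -[].
have cp0 : char_poly F != 0 by apply/monic_neq0/char_poly_monic.
have [m [q q0 Ep]] := multiplicity_XsubC (char_poly F) 0.
rewrite polyC0 subr0 in Ep.
have {q0} : ~~ root q 0 by move: q0; rewrite cp0.
rewrite -coprimep_XsubC => q0.
(* The exponent m+1 makes e a multiple of F even when m = 0. *)
have co : coprimep ('X ^+ m.+1) q by rewrite coprimep_expl // coprimep_sym -['X]subr0.
have /Bezout_eq1_coprimepP [[u v] /= uv] := co.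
pose h (p : {poly k}) : 'M[k]_d.+1 := horner_mx F p; have hX : h 'X = F by apply: horner_mx_X.
have hM p p' : h (p * p') = h p *m h p' by rewrite /h rmorphM.
have hpow n : mxpow F n = h ('X ^+ n) by rewrite mxpowE /h rmorphXn /= horner_mx_X.
have CH (p : {poly k}) : h (p * char_poly F) = 0 by rewrite hM /h Cayley_Hamilton mulmx0.
pose e := h (u * 'X ^+ m.+1).
have E1 : 1%:M - e = h (v * q) by rewrite /e /h -[1%:M](rmorph1 (horner_mx F)) -rmorphB /= -uv addrC addKr.
exists e, (h (u * 'X ^+ m)), m.+1; split.
- apply/eqP; rewrite eq_sym -subr_eq0 -{1}[e]mulmx1 -mulmxBr E1 -hM.
  have -> : u * 'X ^+ m.+1 * (v * q) = u * v * 'X * char_poly F.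
    by rewrite Ep exprS; ring.
  by rewrite CH.
- by rewrite -hX -hM -mulrA -exprSr.
- rewrite E1 hpow -hM (_ : _ * _ = v * 'X * char_poly F) ?CH //.
  by rewrite Ep exprS; ring.
- move=> B BF; apply: comm_mx_horner; exact: BF.
Qed.

Lemma nilpotent_unit (k : fieldType) d (F : 'M[k]_d) n :
  mxpow F n = 0 -> 1%:M - F \in unitmx.
Proof.
case: d F => [|d] F; first by move=> _; rewrite unitmxE [1%:M - F]flatmx0 det_mx00 unitr1.
rewrite mxpowE => F0; have := subrX1 F n; rewrite F0 sub0r => E1.
have /mulmx1_unit [] : (1%:M - F) *m (\sum_(i < n) F ^+ i) = 1%:M by
  rewrite -[LHS]opprK -mulNmx opprB -[_ *m _]E1 opprK.
by [].
Qed.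

Lemma leq_of_mulmx1 (k : fieldType) m n (X : 'M[k]_(m, n)) (Y : 'M_(n, m)) :
  X *m Y = 1%:M -> (m <= n)%N.
Proof.
move=> E1; rewrite -(mxrank1 k m) -E1.
exact: leq_trans (mxrankM_maxl _ _) (rank_leq_col _).
Qed.

Section Indecomposables.
Variables (k : fieldType) (A : falgType k).
Local Notation modA := (modA A).
Implicit Types M N P : modA.

Lemma zero_mod_dim M : is_zero_mod M <-> dm M = 0%N.
Proof.
split=> [M0|M0 x].
  apply/eqP; rewrite -leqn0 leqNgt; apply/negP => lt.
  have := eltK (delta_mx 0 (Ordinal lt) : 'rV[k]_(dm M)).
  rewrite (M0 (elt _)) vec0 => /rowP /(_ (Ordinal lt)) /eqP.
  by rewrite !mxE !eqxx eq_sym oner_eq0.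
apply: vec_inj; move: (vec x) (vec 0); rewrite M0 => u v.
by rewrite [u]thinmx0 [v]thinmx0.
Qed.

Lemma indec_dim M : indecomposable M -> (0 < dm M)%N.
Proof. by case=> nz _; rewrite lt0n; apply/eqP => /zero_mod_dim. Qed.

Lemma indec_neq0 M : indecomposable M -> (1%:M : 'M[k]_(dm M)) != 0.
Proof.
move=> /indec_dim lt; apply/eqP => /matrixP /(_ (Ordinal lt) (Ordinal lt)) /eqP.
by rewrite !mxE eqxx oner_eq0.
Qed.

(** The images of e and 1 - e give a direct decomposition of M, so one of them is zero. *)
Lemma indec_idempotent M (e : 'M_(dm M)) : indecomposable M -> hm e -> e *m e = e ->
  e = 0 \/ e = 1%:M.
Proof.
move=> [nz ind] he ee.
pose e' := 1%:M - e; have he' : hm e' by apply: hm_B => //; apply: hm_1.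
have ee'0 : e *m e' = 0 by rewrite mulmxBr mulmx1 ee subrr.
have e'e0 : e' *m e = 0 by rewrite mulmxBl mul1mx ee subrr.
have e'e' : e' *m e' = e' by rewrite mulmxBr mulmx1 e'e0 subr0.
have [Y [p [i [hp hi fi Ei fp]]]] := image_module he.
have [Z [q [j [hq hj fj Ej fq]]]] := image_module he'.
have cancel_full m1 m2 m3 (a : 'M[k]_(m1, m2)) (x y : 'M_(m2, m3)) :
    row_full a -> a *m x = a *m y -> x = y.
  by case/row_fullP => b ba E1; rewrite -[x]mul1mx -ba -mulmxA E1 mulmxA ba mul1mx.
have ip : i *m p = 1%:M.
  apply: (row_free_inj fi) => /=; apply: (cancel_full _ _ _ p _ _ fp).
  by rewrite mul1mx !mulmxA -Ei -mulmxA -Ei ee.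
have jq : j *m q = 1%:M.
  apply: (row_free_inj fj) => /=; apply: (cancel_full _ _ _ q _ _ fq).
  by rewrite mul1mx !mulmxA -Ej -mulmxA -Ej e'e'.
have iq : i *m q = 0.
  apply: (row_free_inj fj) => /=; apply: (cancel_full _ _ _ p _ _ fp).
  by rewrite mul0mx mulmx0 !mulmxA -Ei -mulmxA -Ej.
have jp : j *m p = 0.
  apply: (row_free_inj fi) => /=; apply: (cancel_full _ _ _ q _ _ fq).
  by rewrite mul0mx mulmx0 !mulmxA -Ej -mulmxA -Ei.
have [f Ef] := hom_of_mat hp; have [g Eg] := hom_of_mat hq.
have [f' Ef'] := hom_of_mat hi; have [g' Eg'] := hom_of_mat hj.
pose ph (x : M) : (Y * Z)%type := (f x, g x).
have lin : linear ph by move=> a x y; rewrite /ph !linearP.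
pose phi : {linear M -> (Y * Z)%type} :=
  HB.pack ph (GRing.isLinear.Build A^c M (Y * Z)%type *:%R ph lin).
have bij : bijective phi.
  exists (fun y => f' y.1 + g' y.2) => [x|[y z]] /=; first apply: vec_inj.
    rewrite vecD !matE Ef Eg Ef' Eg' -!mulmxA -Ei -Ej -mulmxDr.
    by rewrite /e' addrC subrK mulmx1.
  congr (_, _); apply: vec_inj; rewrite !matE vecD !matE Ef' Eg' ?Ef ?Eg mulmxDl.
    by rewrite -!mulmxA ip jp mulmx1 mulmx0 addr0.
  by rewrite -!mulmxA iq jq mulmx1 mulmx0 add0r.
have [/zero_mod_dim Y0|/zero_mod_dim Z0] := ind Y Z phi bij; [left|right].
  by rewrite Ei; move: (p) (i); rewrite Y0 => p0 i0; rewrite [p0]thinmx0 mul0mx.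
apply/esym/subr0_eq; rewrite -/e' Ej; move: (q) (j); rewrite Z0 => q0 j0.
by rewrite [q0]thinmx0 mul0mx.
Qed.

Lemma indec_fitting M (F : 'M_(dm M)) : indecomposable M -> hm F ->
  F \in unitmx \/ exists n, mxpow F n = 0.
Proof.
move=> ind hF; have [e [u [n [ee eu en com]]]] := fitting_idempotent F.
have he : hm e by move=> a; apply: com; apply: hF.
have [e0|e1] := indec_idempotent ind he ee.
  by right; exists n; move: en; rewrite e0 subr0 mulmx1.
by left; move: eu; rewrite e1 => /esym /mulmx1_unit [].
Qed.

(** Locality of the endomorphism ring: W = (F+G)^-1 F is invertible or nilpotent, and in the second
    case 1 - W = (F+G)^-1 G is invertible. *)
Lemma indec_add_unit M (F G : 'M_(dm M)) : indecomposable M -> hm F -> hm G ->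
  F + G \in unitmx -> F \in unitmx \/ G \in unitmx.
Proof.
move=> ind hF hG u; pose W := invmx (F + G) *m F.
have hW : hm W by apply: hm_M => //; apply: hm_inv => //; apply: hm_D.
have [|[n /nilpotent_unit]] := indec_fitting ind hW.
  by rewrite unitmx_mul => /andP [_ ->]; left.
rewrite -(mulVmx u) -mulmxBr (_ : F + G - F = G); last by rewrite addrAC subrr add0r.
by rewrite unitmx_mul => /andP [_ ->]; right.
Qed.

(** f has a right inverse h, and [h *m f] is a nonzero idempotent endomorphism of the indecomposable
    N. *)
Lemma indec_split M N (f : 'M_(dm M, dm N)) (g : 'M_(dm N, dm M)) :
  indecomposable M -> indecomposable N -> hm f -> hm g -> f *m g \in unitmx ->
  exists2 h, hm h & f *m h = 1%:M /\ h *m f = 1%:M.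
Proof.
move=> indM indN hf hg u; pose h := g *m invmx (f *m g).
have hh : hm h by apply: hm_M => //; apply: hm_inv => //; apply: hm_M.
have fh : f *m h = 1%:M by rewrite mulmxA mulmxV.
exists h => //; split=> //.
have [e0|//] := @indec_idempotent N (h *m f) indN (hm_M hh hf)
  ltac:(by rewrite -mulmxA (mulmxA f) fh mul1mx).
have : f *m (h *m f) *m h = 1%:M by rewrite mulmxA fh mul1mx fh.
by move/esym/eqP; rewrite e0 mulmx0 mul0mx (negPf (indec_neq0 indM)).
Qed.

Lemma iso_mat M N (f : mhom M N) :
  is_iso f <-> exists2 h, hm h & mat f *m h = 1%:M /\ h *m mat f = 1%:M.
Proof.
split=> [[g [fg gf]]|[h hh [fh hf]]].
  exists (mat g); first exact: mat_hm.
  by rewrite -!mat_comp; split; apply/mat_id.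
by have [g Eg] := hom_of_mat hh; exists g; split; apply/mat_id; rewrite mat_comp Eg.
Qed.

Lemma section_mat M N (f : mhom M N) :
  is_section f <-> exists2 h, hm h & mat f *m h = 1%:M.
Proof.
split=> [[g fg]|[h hh fh]].
  by exists (mat g); [exact: mat_hm|rewrite -mat_comp; apply/mat_id].
by have [g Eg] := hom_of_mat hh; exists g; apply/mat_id; rewrite mat_comp Eg.
Qed.

Lemma retraction_mat M N (f : mhom M N) :
  is_retraction f <-> exists2 h, hm h & h *m mat f = 1%:M.
Proof.
split=> [[g fg]|[h hh fh]].
  by exists (mat g); [exact: mat_hm|rewrite -mat_comp; apply/mat_id].
by have [g Eg] := hom_of_mat hh; exists g; apply/mat_id; rewrite mat_comp Eg.
Qed.

Definition decomposes M (T : finType) (P : T -> modA)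
    (p : forall i, 'M[k]_(dm M, dm (P i))) (q : forall i, 'M[k]_(dm (P i), dm M)) :=
  [/\ forall i, hm (p i), forall i, hm (q i), forall i, q i *m p i = 1%:M,
      forall i j, i != j -> q i *m p j = 0 & \sum_i p i *m q i = 1%:M].

Lemma decomposition_exists (I : modA -> Prop) : is_ind I -> forall M,
  exists (T : finType) (P : T -> modA) (p : forall i, 'M[k]_(dm M, dm (P i)))
    (q : forall i, 'M[k]_(dm (P i), dm M)), decomposes p q /\ forall i, I (P i).
Proof.
move=> [I_ind I_rep I_eq] M; move: {2}(dm M) (leqnn (dm M)) => n.
elim: n M => [|n IH] M le.
  have M0 : dm M = 0%N by apply/eqP; rewrite -leqn0.
  exists 'I_0, (fun=> M), (fun=> 0), (fun=> 0); split; last by case.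
  split; try by case.
  by rewrite big_ord0; apply/matrixP => i; have := ltn_ord i; rewrite {2}M0.
have [M0|nz] := classic (is_zero_mod M).
  by apply: IH; move/zero_mod_dim: M0 => ->.
have [ind|nind] := classic (indecomposable M).
  have [N IN [f /iso_mat [h hh [fh hf]]]] := I_rep M ind.
  exists unit, (fun=> N), (fun=> mat f), (fun=> h); split=> //.
  split=> //; first by move=> _; apply: mat_hm.
  by rewrite (eq_bigl (pred1 tt)) ?big_pred1_eq // => -[].
have [Y [Z [phi [[psi phiK psiK] [nY nZ]]]]] :
    exists (Y Z : modA) (phi : {linear M -> (Y * Z)%type}),
    bijective phi /\ ~ is_zero_mod Y /\ ~ is_zero_mod Z.
  apply: NNPP => no; apply: nind; split=> // Y Z phi bij; apply: NNPP => nYZ.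
  by apply: no; exists Y, Z, phi; split=> //; split=> h; apply: nYZ; [left|right].
have psi_lin : linear psi.
  by move=> a x y; apply: (can_inj phiK); rewrite linearP !psiK.
pose psi' : {linear (Y * Z)%type -> M} :=
  HB.pack psi (GRing.isLinear.Build A^c (Y * Z)%type M *:%R psi psi_lin).
pose p1 : mhom M Y := fst \o phi; pose p2 : mhom M Z := snd \o phi.
have l1 : linear (fun y : Y => psi' (y, 0)).
  by move=> a x y; rewrite -linearP; congr (psi' (_, _)); rewrite /= scaler0 addr0.
have l2 : linear (fun z : Z => psi' (0, z)).
  by move=> a x y; rewrite -linearP; congr (psi' (_, _)); rewrite /= scaler0 addr0.
pose q1 : mhom Y M := HB.pack (fun y : Y => psi' (y, 0))
  (GRing.isLinear.Build A^c Y M *:%R _ l1).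
pose q2 : mhom Z M := HB.pack (fun z : Z => psi' (0, z))
  (GRing.isLinear.Build A^c Z M *:%R _ l2).
have q1p1 : mat q1 *m mat p1 = 1%:M.
  by rewrite -mat_comp; apply/mat_id => y /=; rewrite psiK.
have q2p2 : mat q2 *m mat p2 = 1%:M.
  by rewrite -mat_comp; apply/mat_id => y /=; rewrite psiK.
have q1p2 : mat q1 *m mat p2 = 0.
  by rewrite -mat_comp -mat_zero; apply/mat_inj => y /=; rewrite psiK.
have q2p1 : mat q2 *m mat p1 = 0.
  by rewrite -mat_comp -mat_zero; apply/mat_inj => y /=; rewrite psiK.
have sum1 : mat p1 *m mat q1 + mat p2 *m mat q2 = 1%:M.
  rewrite -!mat_comp -mat_add; apply/mat_id => x /=.
  rewrite -[psi (_, 0)]/(psi' _) -[psi (0, _)]/(psi' _) -linearD /= -[RHS]phiK.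
  by congr psi; rewrite -[LHS]/((phi x).1 + 0, 0 + (phi x).2) addr0 add0r; case: (phi x).
(* Both summands being nonzero, each is of smaller dimension than M and the induction applies. *)
have dimM : (dm Y + dm Z = dm M)%N.
  have E1 : col_mx (mat q1) (mat q2) *m row_mx (mat p1) (mat p2) = 1%:M.
    by rewrite mul_col_row q1p1 q1p2 q2p1 q2p2 -scalar_mx_block.
  have E2 : row_mx (mat p1) (mat p2) *m col_mx (mat q1) (mat q2) = 1%:M.
    by rewrite mul_row_col.
  by apply/eqP; rewrite eqn_leq (leq_of_mulmx1 E1) (leq_of_mulmx1 E2).
have Y0 : (0 < dm Y)%N by rewrite lt0n; apply/eqP => /zero_mod_dim.
have Z0 : (0 < dm Z)%N by rewrite lt0n; apply/eqP => /zero_mod_dim.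
have [|T1 [P1 [p1' [q1' [[hp1 hq1 q1E q1N s1] I1]]]]] := IH Y; first by lia.
have [|T2 [P2 [p2' [q2' [[hp2 hq2 q2E q2N s2] I2]]]]] := IH Z; first by lia.
pose PP (s : T1 + T2) := match s with inl i => P1 i | inr j => P2 j end.
exists (T1 + T2)%type, PP,
  (fun s => match s return 'M[k]_(dm M, dm (PP s)) with
            | inl i => mat p1 *m p1' i | inr j => mat p2 *m p2' j end),
  (fun s => match s return 'M[k]_(dm (PP s), dm M) with
            | inl i => q1' i *m mat q1 | inr j => q2' j *m mat q2 end).
have mid m1 m2 m3 m4 (a : 'M[k]_(m1, m2)) (b : 'M_(m2, dm M)) (c : 'M_(dm M, m3)) (d : 'M_(m3, m4)) :
  a *m b *m (c *m d) = a *m (b *m c) *m d by rewrite !mulmxA.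
split; last by case.
split.
- by case=> i; [exact: (hm_M (mat_hm p1) (hp1 i))|exact: (hm_M (mat_hm p2) (hp2 i))].
- by case=> i; [exact: (hm_M (hq1 i) (mat_hm q1))|exact: (hm_M (hq2 i) (mat_hm q2))].
- by case=> i; rewrite mid ?q1p1 ?q2p2 mulmx1 ?q1E ?q2E.
- case=> i [] j ij; rewrite mid ?q1p1 ?q2p2 ?q1p2 ?q2p1 ?mulmx1 ?mulmx0 ?mul0mx //.
    by apply: q1N.
  by apply: q2N.
- rewrite big_sumType /= -sum1; congr (_ + _).
    under eq_bigr => i _ do rewrite mulmxA -(mulmxA _ (p1' i)).
    by rewrite -mulmx_suml -mulmx_sumr s1 mulmx1.
  under eq_bigr => i _ do rewrite mulmxA -(mulmxA _ (p2' i)).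
  by rewrite -mulmx_suml -mulmx_sumr s2 mulmx1.
Qed.

End Indecomposables.

(** * Powers of the radical *)

Lemma mulmx_mid (k : fieldType) m1 m2 m3 m4 m5 (a : 'M[k]_(m1, m2)) (b : 'M_(m2, m3))
    (c : 'M_(m3, m4)) (d : 'M_(m4, m5)) :
  a *m b *m (c *m d) = a *m (b *m c) *m d.
Proof. by rewrite !mulmxA. Qed.

Section Radical.
Variables (k : fieldType) (A : falgType k).
Local Notation modA := (modA A).
Implicit Types M N P U W : modA.

(** On matrices, pointwise equality of morphisms becomes equality; [rad_pow_mat] translates in both
    directions. *)
Definition Rad n M N (F : 'M[k]_(dm M, dm N)) :=
  exists2 f : mhom M N, mat f = F & rad_pow n f.

Lemma Rad_hm n M N (F : 'M_(dm M, dm N)) : Rad n F -> hm F.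
Proof. by case=> f <- _; apply: mat_hm. Qed.

Lemma Rad0P M N (F : 'M_(dm M, dm N)) : Rad 0 F <-> hm F.
Proof.
split=> [|hF]; first exact: Rad_hm.
by have [f Ef] := hom_of_mat hF; exists f.
Qed.

Lemma rad_pow_mat n M N (f : mhom M N) : Rad n (mat f) <-> rad_pow n f.
Proof.
split=> [[g /mat_inj Eg]|h]; last by exists f.
by case: n => // n h; apply: ideal_gen_eq h Eg.
Qed.

Lemma Rad_0 n M N : Rad n (0 : 'M_(dm M, dm N)).
Proof.
rewrite -mat_zero; apply/rad_pow_mat; case: n => // n; exact: ideal_gen_zero.
Qed.

Lemma Rad_D n M N (F G : 'M_(dm M, dm N)) : Rad n F -> Rad n G -> Rad n (F + G).
Proof.
move=> [f <- hf] [g <- hg]; rewrite -mat_add; apply/rad_pow_mat.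
by case: n hf hg => // n; apply: ideal_gen_add.
Qed.

Lemma Rad_hl n M N P (F : 'M_(dm M, dm N)) (G : 'M_(dm N, dm P)) :
  hm F -> Rad n G -> Rad n (F *m G).
Proof.
move=> /hom_of_mat [f <-] [g <- hg]; rewrite -mat_comp; apply/rad_pow_mat.
by case: n hg => // n; apply: ideal_gen_compl.
Qed.

Lemma Rad_hr n M N P (F : 'M_(dm M, dm N)) (G : 'M_(dm N, dm P)) :
  Rad n F -> hm G -> Rad n (F *m G).
Proof.
move=> [f <- hf] /hom_of_mat [g <-]; rewrite -mat_comp; apply/rad_pow_mat.
by case: n hf => // n; apply: ideal_gen_compr.
Qed.

Lemma Rad_Z n M N c (F : 'M_(dm M, dm N)) : Rad n F -> Rad n (c *: F).
Proof.
by move=> h; rewrite -mul_scalar_mx -scalemx1; apply: Rad_hl => //; apply/hm_Z/hm_1.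
Qed.

Lemma Rad_N n M N (F : 'M_(dm M, dm N)) : Rad n F -> Rad n (- F).
Proof. by move=> h; rewrite -scaleN1r; apply: Rad_Z. Qed.

Lemma Rad_sum n M N (T : finType) (F : T -> 'M_(dm M, dm N)) :
  (forall i, Rad n (F i)) -> Rad n (\sum_i F i).
Proof. by move=> h; apply: big_ind => //; [exact: Rad_0|move=> *; exact: Rad_D]. Qed.

Lemma rad_Rad1 M N (f : mhom M N) : Defs.rad f -> Rad 1 (mat f).
Proof.
move=> hf; apply/rad_pow_mat; apply: ideal_gen_in.
by exists N, f, idfun; split.
Qed.

Lemma Rad_S n M N (F : 'M_(dm M, dm N)) : Rad n.+1 F -> Rad n F.
Proof.
move=> [f <-]; elim=> {M N F f} [M N f [P [g [h [_ hh Ef]]]]|M N f g _ IH Eg|M N|M N f g _ IHf _ IHg|M N P u f _ IH|M N P f v _ IH].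
- have -> : mat f = mat g *m mat h by rewrite -mat_comp; apply/mat_inj.
  by apply: Rad_hl; [exact: mat_hm|apply/rad_pow_mat].
- by have <- : mat f = mat g by apply/mat_inj.
- by rewrite mat_zero; apply: Rad_0.
- by rewrite mat_add; apply: Rad_D.
- by rewrite mat_comp; apply: Rad_hl => //; apply: mat_hm.
- by rewrite mat_comp; apply: Rad_hr => //; apply: mat_hm.
Qed.

Lemma Rad_M a b M N P (F : 'M_(dm M, dm N)) (G : 'M_(dm N, dm P)) :
  Rad a F -> Rad b G -> Rad (a + b) (F *m G).
Proof.
elim: a => [|a IH] in M N P F G *; first by move=> /Rad0P hF; apply: Rad_hl.
move=> [f <- hf] hG; elim: hf P G hG => {M N F f} [M N f [Q [g [h [hg hh Ef]]]]|M N f g _ IH' Eg|M N|M N f g _ IHf _ IHg|M N Q u f _ IH'|M N Q f v _ IH'] P G hG.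
- have [h' Eh' radh'] : Rad (a + b) (mat h *m G).
    by apply: IH => //; apply/rad_pow_mat.
  have -> : mat f *m G = mat (mcomp g h').
    by rewrite mat_comp Eh' mulmxA -mat_comp; congr (_ *m _); apply/mat_inj.
  apply/rad_pow_mat; rewrite addSn; apply: ideal_gen_in.
  by exists Q, g, h'; split.
- have <- : mat f = mat g by apply/mat_inj.
  exact: IH'.
- by rewrite mat_zero mul0mx; apply: Rad_0.
- by rewrite mat_add mulmxDl; apply: Rad_D; [exact: IHf|exact: IHg].
- by rewrite mat_comp -mulmxA; apply: Rad_hl; [exact: mat_hm|exact: IH'].
- by rewrite mat_comp -mulmxA; apply: IH'; apply: Rad_hl => //; apply: mat_hm.
Qed.

(* [rad_pow] is defined by splitting off a radical factor on the left; this
   splits one off on the right. *)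
Lemma Rad_right_factor n M N (F : 'M_(dm M, dm N)) : Rad n.+1 F ->
  exists W (G : 'M_(dm M, dm W)) (H : 'M_(dm W, dm N)), [/\ Rad n G, Rad 1 H & F = G *m H].
Proof.
elim: n => [|n IH] in M N F *.
  move=> hF; exists M, 1%:M, F; split; rewrite ?mul1mx //.
  by apply/Rad0P/hm_1.
move=> [f <-].
elim=> {M N F f} [M N f [Q [g [h [hg hh Ef]]]]|M N f g _ IH' Eg|M N|M N f g _ IHf _ IHg|M N Q u f _ IH'|M N Q f v _ IH'].
- have [|W [G [H [hG hH E1]]]] := IH _ _ (mat h); first by apply/rad_pow_mat.
  exists W, (mat g *m G), H; split=> //; first by apply: (@Rad_M 1) => //; apply: rad_Rad1.
  by rewrite -mulmxA -E1 -mat_comp; apply/mat_inj.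
- by have <- : mat f = mat g by apply/mat_inj.
- exists M, 0, 0; split; [exact: Rad_0|exact: Rad_0|by rewrite mat_zero mul0mx].
- have [W1 [G1 [H1 [hG1 hH1 E1]]]] := IHf; have [W2 [G2 [H2 [hG2 hH2 E2]]]] := IHg.
  have [S [i1 [i2 [p1 [p2 [[hi1 hi2 hp1 hp2] [e11 e22] [e12 e21] _]]]]]] := sum_module W1 W2.
  exists S, (G1 *m i1 + G2 *m i2), (p1 *m H1 + p2 *m H2); split.
  + by apply: Rad_D; apply: Rad_hr.
  + by apply: Rad_D; apply: Rad_hl.
  + rewrite mat_add E1 E2 mulmxDl !mulmxDr !mulmx_mid e11 e12 e21 e22.
    by rewrite !mulmx1 !mulmx0 !mul0mx addr0 add0r.
- have [W [G [H [hG hH E1]]]] := IH'.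
  exists W, (mat u *m G), H; split=> //; first by apply: Rad_hl => //; apply: mat_hm.
  by rewrite -mulmxA -E1 mat_comp.
- have [W [G [H [hG hH E1]]]] := IH'.
  exists W, G, (H *m mat v); split=> //; first by apply: Rad_hr => //; apply: mat_hm.
  by rewrite mulmxA -E1 mat_comp.
Qed.

(** A sum of composites is a single composite through the direct sum of the middle modules. *)
Lemma Rad_left_factor n M N (F : 'M_(dm M, dm N)) : Rad n.+1 F ->
  exists W (G : 'M_(dm M, dm W)) (H : 'M_(dm W, dm N)), [/\ Rad 1 G, Rad n H & F = G *m H].
Proof.
move=> [f <-].
elim=> {M N F f} [M N f [Q [g [h [hg hh Ef]]]]|M N f g _ IH' Eg|M N|M N f g _ IHf _ IHg|M N Q u f _ IH'|M N Q f v _ IH'].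
- exists Q, (mat g), (mat h); split; [exact: rad_Rad1|exact/rad_pow_mat|].
  by rewrite -mat_comp; apply/mat_inj.
- by have <- : mat f = mat g by apply/mat_inj.
- exists M, 0, 0; split; [exact: Rad_0|exact: Rad_0|by rewrite mat_zero mul0mx].
- have [W1 [G1 [H1 [hG1 hH1 E1]]]] := IHf; have [W2 [G2 [H2 [hG2 hH2 E2]]]] := IHg.
  have [S [i1 [i2 [p1 [p2 [[hi1 hi2 hp1 hp2] [e11 e22] [e12 e21] _]]]]]] := sum_module W1 W2.
  exists S, (G1 *m i1 + G2 *m i2), (p1 *m H1 + p2 *m H2); split.
  + by apply: Rad_D; apply: Rad_hr.
  + by apply: Rad_D; apply: Rad_hl.
  + rewrite mat_add E1 E2 mulmxDl !mulmxDr !mulmx_mid e11 e12 e21 e22.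
    by rewrite !mulmx1 !mulmx0 !mul0mx addr0 add0r.
- have [W [G [H [hG hH E1]]]] := IH'.
  exists W, (mat u *m G), H; split=> //; first by apply: Rad_hl => //; apply: mat_hm.
  by rewrite -mulmxA -E1 mat_comp.
- have [W [G [H [hG hH E1]]]] := IH'.
  exists W, G, (H *m mat v); split=> //; first by apply: Rad_hr => //; apply: mat_hm.
  by rewrite mulmxA -E1 mat_comp.
Qed.

(** The radical described by test objects: no indecomposable splits off through F. Unlike membership
    in a generated ideal, this can be refuted by exhibiting u and v; [Rad1P] shows that the two
    agree. *)
Definition radical M N (F : 'M[k]_(dm M, dm N)) := hm F /\
  forall U (u : 'M_(dm U, dm M)) (v : 'M_(dm N, dm U)),
    indecomposable U -> hm u -> hm v -> u *m F *m v \notin unitmx.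

Lemma radical_closed M N (F G : 'M_(dm M, dm N)) :
  radical F -> radical G -> radical (F + G).
Proof.
move=> [hF rF] [hG rG]; split=> [|U u v indU hu hv]; first exact: hm_D.
apply/negP; rewrite mulmxDr mulmxDl => uFG.
have [||h|h] := indec_add_unit indU _ _ uFG.
- by apply: hm_M => //; apply: hm_M.
- by apply: hm_M => //; apply: hm_M.
- by have := rF U u v indU hu hv; rewrite h.
- by have := rG U u v indU hu hv; rewrite h.
Qed.

Lemma radical_hl M N P (F : 'M_(dm M, dm N)) (G : 'M_(dm N, dm P)) :
  hm F -> radical G -> radical (F *m G).
Proof.
move=> hF [hG rG]; split=> [|U u v indU hu hv]; first exact: hm_M.
by rewrite mulmxA; apply: rG => //; apply: hm_M.
Qed.

Lemma radical_hr M N P (F : 'M_(dm M, dm N)) (G : 'M_(dm N, dm P)) :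
  radical F -> hm G -> radical (F *m G).
Proof.
move=> [hF rF] hG; split=> [|U u v indU hu hv]; first exact: hm_M.
by rewrite -mulmxA -(mulmxA F) mulmxA; apply: rF => //; apply: hm_M.
Qed.

Lemma radical_0 M N : radical (0 : 'M_(dm M, dm N)).
Proof.
split=> [|U u v indU _ _]; first exact: hm_0.
rewrite mulmx0 mul0mx; apply/negP => /mulmxV; rewrite mul0mx => /esym/eqP.
by rewrite (negPf (indec_neq0 indU)).
Qed.

Lemma radical_non_iso M N (f : mhom M N) :
  indecomposable M -> indecomposable N -> ~ is_iso f -> radical (mat f).
Proof.
move=> indM indN niso; split=> [|U u v indU hu hv]; first exact: mat_hm.
apply/negP => unit_ufv; apply: niso.
have hf := mat_hm f.
have [h hh [uh hu1]] : exists2 h, hm h & u *m h = 1%:M /\ h *m u = 1%:M.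
  by apply: (@indec_split k A U M u (mat f *m v)) => //; [exact: hm_M|rewrite mulmxA].
have [h' hh' [ufh' h'uf]] : exists2 h', hm h' & u *m mat f *m h' = 1%:M /\ h' *m (u *m mat f) = 1%:M.
  by apply: (@indec_split k A U N _ v) => //; apply: hm_M.
apply/iso_mat; exists (h' *m u); first exact: hm_M.
split; last by rewrite -mulmxA.
have -> : mat f = h *m (u *m mat f) by rewrite mulmxA hu1 mul1mx.
by rewrite -mulmxA (mulmxA _ h') ufh' mul1mx.
Qed.

Lemma Rad1_radical M N (F : 'M_(dm M, dm N)) : Rad 1 F -> radical F.
Proof.
have gen P Q (f : mhom P Q) : Defs.rad f -> radical (mat f).
  elim=> {P Q f} [P Q f [indP indQ nf]|P Q f g _ IH Eg|P Q|P Q f g _ IHf _ IHg|P Q S u f _ IH|P Q S f v _ IH].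
  - exact: radical_non_iso.
  - by have <- : mat f = mat g by apply/mat_inj.
  - by rewrite mat_zero; apply: radical_0.
  - by rewrite mat_add; apply: radical_closed.
  - by rewrite mat_comp; apply: radical_hl => //; apply: mat_hm.
  - by rewrite mat_comp; apply: radical_hr => //; apply: mat_hm.
move=> [f <-].
elim=> {M N F f} [M N f [Q [g [h [hg hh Ef]]]]|M N f g _ IH Eg|M N|M N f g _ IHf _ IHg|M N Q u f _ IH|M N Q f v _ IH].
- have -> : mat f = mat g *m mat h by rewrite -mat_comp; apply/mat_inj.
  by apply: radical_hr; [apply: gen|apply: mat_hm].
- by have <- : mat f = mat g by apply/mat_inj.
- by rewrite mat_zero; apply: radical_0.
- by rewrite mat_add; apply: radical_closed.
- by rewrite mat_comp; apply: radical_hl => //; apply: mat_hm.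
- by rewrite mat_comp; apply: radical_hr => //; apply: mat_hm.
Qed.

Variables (I : modA -> Prop) (I_ind : is_ind I).

Lemma indec_of_I M : I M -> indecomposable M.
Proof. by case: I_ind => h _ _; apply: h. Qed.

(** For the converse, decompose both modules: an invertible component of F would violate the test,
    so all components are generators of the ideal. *)
Lemma Rad1P M N (F : 'M_(dm M, dm N)) : Rad 1 F <-> radical F.
Proof.
split; first exact: Rad1_radical.
move=> [hF rF].
have [T1 [P1 [p1 [q1 [[hp1 hq1 e1 n1 s1] I1]]]]] := decomposition_exists I_ind M.
have [T2 [P2 [p2 [q2 [[hp2 hq2 e2 n2 s2] I2]]]]] := decomposition_exists I_ind N.
rewrite -[F]mul1mx -s1 -[_ *m F]mulmx1 -s2 !mulmx_suml; apply: Rad_sum => i.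
rewrite mulmx_sumr; apply: Rad_sum => j.
have -> : p1 i *m q1 i *m F *m (p2 j *m q2 j) = p1 i *m (q1 i *m F *m p2 j) *m q2 j.
  by rewrite !mulmxA.
apply: Rad_hr => //; apply: Rad_hl => //.
have [f Ef] : exists f : mhom _ _, mat f = q1 i *m F *m p2 j.
  by apply: hom_of_mat; apply: hm_M => //; apply: hm_M.
rewrite -Ef; apply: rad_Rad1; apply: ideal_gen_in; split; try exact: indec_of_I.
move=> /iso_mat [h hh]; rewrite Ef => -[E1 _].
have := rF _ (q1 i) (p2 j *m h) (indec_of_I (I1 i)) (hq1 i) (hm_M (hp2 j) hh).
by rewrite mulmxA E1 unitmx1.
Qed.

Lemma indec_Rad1 M N (F : 'M_(dm M, dm N)) : indecomposable M -> indecomposable N -> hm F ->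
  Rad 1 F \/ exists2 G, hm G & F *m G = 1%:M /\ G *m F = 1%:M.
Proof.
move=> indM indN hF; have [f Ef] := hom_of_mat hF.
have [/iso_mat|nf] := classic (is_iso f); first by rewrite Ef; right.
by left; rewrite -Ef; apply: rad_Rad1; apply: ideal_gen_in.
Qed.

Lemma radical_not_split M N (F : 'M_(dm M, dm N)) (G : 'M_(dm N, dm M)) :
  indecomposable M -> Rad 1 F -> hm G -> F *m G <> 1%:M.
Proof.
move=> indM /Rad1_radical [hF rF] hG FG.
by have := rF M 1%:M G indM (@hm_1 _ _ M) hG; rewrite mul1mx FG unitmx1.
Qed.

Lemma radical_not_retract M N (F : 'M_(dm M, dm N)) (G : 'M_(dm N, dm M)) :
  indecomposable N -> Rad 1 F -> hm G -> G *m F <> 1%:M.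
Proof.
move=> indN /Rad1_radical [hF rF] hG GF.
by have := rF N G 1%:M indN hG (@hm_1 _ _ N); rewrite mulmx1 GF unitmx1.
Qed.

(** If u F v is invertible, then u is an isomorphism onto the indecomposable M, and F becomes a
    section. *)
Lemma Rad1_nonsection M N (F : 'M_(dm M, dm N)) : indecomposable M -> hm F ->
  (forall G, hm G -> F *m G <> 1%:M) -> Rad 1 F.
Proof.
move=> indM hF ns; apply/Rad1P; split=> // U u v indU hu hv.
apply/negP => unit_uFv.
have [|h hh [uh hu1]] := @indec_split k A U M u (F *m v) indU indM hu (hm_M hF hv).
  by rewrite mulmxA.
apply: (ns (v *m invmx (u *m F *m v) *m u)).
  by apply: hm_M => //; apply: hm_M => //; apply: hm_inv => //; apply: hm_M => //; apply: hm_M.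
transitivity (h *m (u *m F *m v *m invmx (u *m F *m v)) *m u).
  by move: (invmx _) => w; rewrite !mulmxA hu1 mul1mx.
by rewrite mulmxV // mulmx1 hu1.
Qed.

Lemma Rad1_nonretraction M N (F : 'M_(dm M, dm N)) : indecomposable N -> hm F ->
  (forall G, hm G -> G *m F <> 1%:M) -> Rad 1 F.
Proof.
move=> indN hF ns; apply/Rad1P; split=> // U u v indU hu hv.
apply/negP => unit_uFv.
have [h hh [uh hu1]] := @indec_split k A U N (u *m F) v indU indN (hm_M hu hF) hv unit_uFv.
apply: (ns (h *m u)); first exact: hm_M.
by rewrite -mulmxA.
Qed.

Lemma Rad1_one_zero M : Rad 1 (1%:M : 'M_(dm M)) -> (1%:M : 'M[k]_(dm M)) = 0.
Proof.
move=> h; have [T [P [p [q [[hp hq e n s] IP]]]]] := decomposition_exists I_ind M.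
rewrite -s big1 // => i _; exfalso.
have := radical_not_split (indec_of_I (IP i)) (Rad_hl (hq i) h) (hp i).
by rewrite mulmx1 e.
Qed.

(** The identity of the image of E factors through E, so it is radical, which happens for the zero
    module only. *)
Lemma Rad1_idempotent M (E : 'M_(dm M)) : Rad 1 E -> E *m E = E -> E = 0.
Proof.
move=> rE EE; have [N [p [i [hp hi fi Ei fp]]]] := image_module (Rad_hm rE).
have ip : i *m p = 1%:M.
  apply: (row_free_inj fi) => /=; case/row_fullP: fp => b bp.
  rewrite mul1mx -mulmxA -Ei -[X in X *m E](mul1mx i) -bp -!mulmxA.
  by rewrite (mulmxA p) -Ei EE Ei mulmxA bp mul1mx.
suff N0 : (1%:M : 'M[k]_(dm N)) = 0 by rewrite Ei -[p]mulmx1 N0 mulmx0 mul0mx.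
apply: (@Rad1_one_zero N); rewrite (_ : 1%:M = i *m E *m p).
  by apply: Rad_hr => //; apply: Rad_hl.
by rewrite Ei mulmxA ip mul1mx.
Qed.

Lemma mxpow_Rad1 M (F : 'M_(dm M)) n : Rad 1 F -> Rad 1 (mxpow (1%:M + F) n - 1%:M).
Proof.
move=> rF; elim: n => [|n IH] /=; first by rewrite subrr; apply: Rad_0.
rewrite -/(mxpow _ n) mulmxDl mul1mx addrAC; apply: Rad_D => //.
rewrite -[mxpow _ n](subrK 1%:M) mulmxDr mulmx1; apply: Rad_D => //.
by apply: Rad_hr => //; apply: Rad_hm IH.
Qed.

(** Let e be the Fitting idempotent of 1 + F. A power of 1 + F kills 1 - e and is congruent to 1
    modulo the radical; so 1 - e is a radical idempotent, hence zero. *)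
Lemma Rad1_unit M (F : 'M_(dm M)) : Rad 1 F -> 1%:M + F \in unitmx.
Proof.
move=> rF; have [e [u [n [ee eu en com]]]] := fitting_idempotent (1%:M + F).
have h1F : hm (1%:M + F) by apply: hm_D; [exact: hm_1|exact: Rad_hm rF].
have he : hm e by move=> a; apply: com; apply: h1F.
have h1e : hm (1%:M - e) by apply: hm_B => //; apply: hm_1.
suff e1 : 1%:M - e = 0.
  by move: eu; rewrite -(subr0_eq e1) => /esym /mulmx1_unit [].
apply: Rad1_idempotent; last by rewrite mulmxBr mulmx1 mulmxBl mul1mx ee subrr subr0.
rewrite -[X in Rad _ X]opprK; apply: Rad_N.
rewrite -[X in Rad _ X]add0r -en -{2}[1%:M - e]mul1mx -mulmxBl.
by apply: Rad_hr => //; apply: mxpow_Rad1.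
Qed.

(** Since M and N are indecomposable, maps out of M that are not sections and maps into N that are
    not retractions are radical; a forbidden factorisation is thus a product of two radical maps. *)
Lemma irreducible_Rad M N (f : mhom M N) : indecomposable M -> indecomposable N ->
  irreducible_hom f <-> Rad 1 (mat f) /\ ~ Rad 2 (mat f).
Proof.
move=> indM indN; split=> [[nsec nret irr]|[r1 nr2]].
  split.
    have [//|[G hG [FG GF]]] := indec_Rad1 indM indN (mat_hm f).
    by exfalso; apply: nsec; apply/section_mat; exists G.
  case/Rad_right_factor => W [G [H [rG rH E1]]].
  have [g Eg] := hom_of_mat (Rad_hm rG); have [h Eh] := hom_of_mat (Rad_hm rH).
  have [/section_mat [x hx]|/retraction_mat [x hx]] : is_section g \/ is_retraction h.
  - by apply: irr; apply/mat_inj; rewrite mat_comp Eg Eh.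
  - by rewrite Eg; apply: radical_not_split.
  - by rewrite Eh; apply: radical_not_retract.
split.
- by move=> /section_mat [x hx]; apply: radical_not_split.
- by move=> /retraction_mat [x hx]; apply: radical_not_retract.
- move=> W g h /mat_inj; rewrite mat_comp => E1.
  apply: NNPP => no; apply: nr2; rewrite E1; apply: (@Rad_M 1 1).
    by apply: Rad1_nonsection; [|exact: mat_hm|move=> G hG E2; apply: no; left; apply/section_mat; exists G].
  by apply: Rad1_nonretraction; [|exact: mat_hm|move=> G hG E2; apply: no; right; apply/retraction_mat; exists G].
Qed.

End Radical.

(** * Almost split maps *)

Section LinearAlgebra.
Variable k : fieldType.

(** Enlarge a subspace contained in P until it exhausts P; the dimension bounds the number of
    steps. *)
Lemma vspace_of_pred (vT : vectType k) (P : vT -> Prop) :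
  P 0 -> (forall a x y, P x -> P y -> P (a *: x + y)) ->
  exists U : {vspace vT}, forall x, x \in U <-> P x.
Proof.
move=> P0 Plin.
suff : forall m (U : {vspace vT}), (forall x, x \in U -> P x) ->
    (\dim {:vT} - \dim U <= m)%N -> exists U : {vspace vT}, forall x, x \in U <-> P x.
  by move=> /(_ _ 0%VS); apply=> // x; rewrite memv0 => /eqP ->.
elim=> [|m IH] U UP le.
  exists U => x; split=> [/UP //|_].
  have /eqP -> : U == fullv by rewrite eqEdim subvf -subn_eq0 -leqn0.
  exact: memvf.
have [all|] := classic (forall x, P x -> x \in U).
  by exists U => x; split=> [/UP|/all].
move=> /not_all_ex_not [x nx]; have [Px /negP xU] := imply_to_and _ _ nx.
apply: (IH (U + <[x]>)%VS).
  move=> _ /memv_addP [u uU [_ /vlineP [c ->] ->]].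
  by rewrite addrC; apply: Plin => //; apply: UP.
rewrite -ltnS; apply: leq_trans le; apply: ltn_sub2l.
  rewrite ltn_neqAle dimvS ?subvf // andbT; apply: contraNneq xU => E1.
  suff /eqP -> : U == fullv by apply: memvf.
  by rewrite eqEdim subvf E1 leqnn.
rewrite ltn_neqAle dimvS ?addvSl // andbT; apply: contraNneq xU => E1.
suff /eqP -> : U == (U + <[x]>)%VS by rewrite memvE addvSr.
by rewrite eqEdim addvSl E1 leqnn.
Qed.

(** C represents, in the trace pairing, an entry of the projection along U that is nonzero at X. *)
Lemma trace_functional m n (U : {vspace 'M[k]_(m, n)}) X : X \notin U ->
  exists C : 'M_(n, m), (forall Y, Y \in U -> \tr (Y *m C) = 0) /\ \tr (X *m C) != 0.
Proof.
move=> XU; pose p (Y : 'M[k]_(m, n)) := Y - projv U Y.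
have [i [j pX]] : exists i j, p X i j != 0.
  apply: NNPP => no; move/negP: XU; apply.
  suff p0 : p X = 0 by rewrite -[X](subrK (projv U X)) -/(p X) p0 add0r memv_proj.
  apply/matrixP => i j; rewrite [RHS]mxE; apply/eqP; apply: contraT => ne.
  by exfalso; apply: no; exists i, j.
pose C := \matrix_(b, a) p (delta_mx a b) i j.
have p_lin : linear p by move=> a Y Z; rewrite /p linearP scalerBr opprD addrACA.
pose q : {linear 'M[k]_(m, n) -> 'M[k]_(m, n)} :=
  HB.pack p (GRing.isLinear.Build k _ _ *:%R p p_lin).
have CE Y : \tr (Y *m C) = p Y i j.
  rewrite -[p Y]/(q Y) [in RHS](matrix_sum_delta Y) linear_sum summxE /mxtrace.
  apply: eq_bigr => a _; rewrite mxE linear_sum summxE; apply: eq_bigr => b _.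
  by rewrite linearZ !mxE.
exists C; split=> [Y YU|]; rewrite CE //.
by rewrite /p projv_id // subrr mxE.
Qed.

(** Stores an n-tuple of matrices side by side in a single W, so that one coinduced module can
    represent families of linear maps. *)
Lemma pack_family d n : exists m (P : 'I_n -> 'M[k]_(m, d)),
  forall l (w : 'I_n -> 'M[k]_(l, d)), exists W, forall i, W *m P i = w i.
Proof.
elim: n => [|n [m [P hP]]].
  by exists 0%N, (fun=> 0) => l w; exists 0 => -[].
exists (d + m)%N, (fun i => oapp (fun j => col_mx 0 (P j)) (col_mx 1%:M 0) (unlift ord0 i)).
move=> l w; have [W hW] := hP l (w \o lift ord0).
exists (row_mx (w ord0) W) => i; case: unliftP => [j ->|->] /=.
  by rewrite mul_row_col mulmx0 add0r hW.
by rewrite mul_row_col mulmx1 mulmx0 addr0.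
Qed.

End LinearAlgebra.

Section AlmostSplit.
Variables (k : fieldType) (A : falgType k).
Local Notation modA := (modA A).
Implicit Types M N P U W Y : modA.

(* [Q] is the coinduced module Hom_k(A, k^m), and [ev] is evaluation at 1. *)
Lemma coinduced_module m : exists Q (ev : 'M[k]_(dm Q, m)),
  (forall M (W : 'M_(dm M, m)), exists2 f, hm f & f *m ev = W) /\
  (forall M (f g : 'M_(dm M, dm Q)), hm f -> hm g -> f *m ev = g *m ev -> f = g).
Proof.
pose n := \dim {:A}; pose b := vbasis {:A}.
pose al (a : A) : 'rV[k]_n := \row_i coord b i a.
pose be (v : 'rV[k]_n) : A := \sum_i v 0 i *: b`_i.
have alK a : be (al a) = a.
  rewrite [RHS](coord_vbasis (memvf a)); apply: eq_bigr => i _; by rewrite mxE.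
have beK v : al (be v) = v.
  by apply/rowP => i; rewrite mxE coord_sum_free // (basis_free (vbasisP _)).
have alL c x y : al (c *: x + y) = c *: al x + al y.
  by apply/rowP => i; rewrite !mxE linearP.
have al_sum l (F : 'I_l -> A) : al (\sum_i F i) = \sum_i al (F i).
  apply: (big_morph al) => [x y|]; first by rewrite -[x]scale1r alL !scale1r.
  by apply/rowP => i; rewrite !mxE linear0.
have alZ c x : al (c *: x) = c *: al x by apply/rowP => i; rewrite !mxE linearZ.
pose La (c : A) : 'M[k]_n := \matrix_i al (c * b`_i).
have LaE c a : al a *m La c = al (c * a).
  rewrite mulmx_sum_row -{2}(alK a) /be mulr_sumr al_sum; apply: eq_bigr => i _.
  by rewrite rowK -scalerAr alZ.
have eq_al l (F G : 'M[k]_(n, l)) : (forall a, al a *m F = al a *m G) -> F = G.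
  by move=> h; apply: eq_rowmx => v; rewrite -(beK v).
pose r c : 'M[k]_(n * m) := lin_mulmx (La c).
have rE c F : mxvec F *m r c = mxvec (La c *m F) by rewrite mul_vec_lin.
have eq_vec l (F G : 'M[k]_(n * m, l)) : (forall v, mxvec v *m F = mxvec v *m G) -> F = G.
  by move=> h; apply: eq_rowmx => v; rewrite -(vec_mxK v).
have [|||Q [u [v [uv vu h]]]] := @rep_mod k A _ r.
- apply: eq_vec => F; rewrite rE mulmx1; congr mxvec; apply: eq_al => a.
  by rewrite mulmxA LaE mul1r.
- move=> c d; apply: eq_vec => F; rewrite mulmxA !rE; congr mxvec; apply: eq_al => a.
  by rewrite !mulmxA !LaE mulrA.
- move=> c x y; apply: eq_vec => F; rewrite mulmxDr -scalemxAr !rE -linearP; congr mxvec.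
  rewrite scalemxAl -mulmxDl; congr (_ *m _); apply: eq_al => a.
  by rewrite mulmxDr -scalemxAr !LaE mulrDl -scalerAl alL.
have hv a : r a *m v = v *m rho Q a.
  by rewrite -[LHS]mul1mx -vu -mulmxA (mulmxA u) -h -mulmxA uv mulmx1.
pose ev0 : 'M[k]_(n * m, m) := lin1_mx (mulmx (al 1) \o vec_mx).
have ev0E F : mxvec F *m ev0 = al 1 *m F by rewrite mul_rV_lin1 /= mxvecK.
exists Q, (u *m ev0); split.
  move=> M W.
  pose f0 : 'M[k]_(dm M, n * m) := \matrix_i mxvec (\matrix_j row i (rho M b`_j *m W)).
  have f0E (x : 'rV_(dm M)) a : al a *m vec_mx (x *m f0) = x *m rho M a *m W.
    have rho_sum l (F : 'I_l -> A) : rho M (\sum_i F i) = \sum_i rho M (F i).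
      apply: (big_morph (rho M)) => [y z|]; first by rewrite -[y]scale1r rhoL !scale1r.
      by rewrite -(subrr 1) addrC -scaleN1r rhoL scaleN1r addNr.
    have rhoZ c y : rho M (c *: y) = c *: rho M y.
      have := rho_sum 0%N (fun=> 0); rewrite !big_ord0 => rho0.
      by rewrite -[c *: y]addr0 rhoL rho0 addr0.
    rewrite mulmx_sum_row -{2}(alK a) /be rho_sum mulmx_sumr mulmx_suml.
    apply: eq_bigr => j _; rewrite rhoZ -scalemxAr -scalemxAl; congr (_ *: _).
    rewrite mulmx_sum_row linear_sum -mulmxA mulmx_sum_row; apply/rowP => l.
    rewrite mxE !summxE; apply: eq_bigr => i _.
    by rewrite linearZ /= rowK mxvecK !mxE.
  exists (f0 *m v); last first.
    apply: eq_rowmx => x; rewrite mulmx_mid vu mulmx1 mulmxA.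
    by rewrite -[x *m f0]vec_mxK ev0E f0E rho1 mulmx1.
  move=> c; rewrite -mulmxA -hv !mulmxA; congr (_ *m _).
  apply: eq_rowmx => x; apply: (can_inj vec_mxK); apply: eq_al => a.
  rewrite mulmxA f0E mulmxA -(vec_mxK (x *m f0)) rE mxvecK mulmxA LaE f0E.
  by rewrite rhoM !mulmxA.
move=> M f g hf hg E1.
have key (f1 : 'M_(dm M, dm Q)) x a : hm f1 ->
    al a *m vec_mx (x *m f1 *m u) = x *m rho M a *m (f1 *m (u *m ev0)).
  move=> hf1; have -> : x *m rho M a *m (f1 *m (u *m ev0)) = x *m f1 *m u *m r a *m ev0.
    by rewrite -(mulmxA _ u) -h !mulmxA -(mulmxA x) hf1 !mulmxA.
  by rewrite -[in RHS](vec_mxK (x *m f1 *m u)) rE ev0E mulmxA LaE mulr1.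
have fu : f *m u = g *m u.
  apply: eq_rowmx => x; apply: (can_inj vec_mxK); apply: eq_al => a.
  by rewrite !mulmxA !key // E1.
by rewrite -[f]mulmx1 -uv mulmxA fu -mulmxA uv mulmx1.
Qed.

Variables (I : modA -> Prop) (I_ind : is_ind I).

(* A functional on End(Y), written as a trace, that vanishes exactly on
   one-sided ideals of non-units. *)
Lemma radical_functional Y : indecomposable Y -> exists C : 'M[k]_(dm Y),
  \tr C != 0 /\ forall F, hm F -> F \notin unitmx -> \tr (F *m C) = 0.
Proof.
move=> indY.
have [||U UP] := @vspace_of_pred k 'M[k]_(dm Y) (fun F => hm F /\ F \notin unitmx).
- split; first exact: hm_0.
  apply/negP => /mulmxV; rewrite mul0mx => /esym/eqP.
  by rewrite (negPf (indec_neq0 indY)).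
- move=> a F G [hF nF] [hG nG]; split; first by apply: hm_D => //; apply: hm_Z.
  apply/negP => uFG; have [|//|h|h] := indec_add_unit indY _ _ uFG; first exact: hm_Z.
    by move: h nF; rewrite -mul_scalar_mx unitmx_mul => /andP [_ ->].
  by rewrite h in nG.
have [|C [CU C1]] := @trace_functional k _ _ U 1%:M.
  by apply/negP => /UP []; rewrite unitmx1.
exists C; split; first by rewrite mul1mx in C1.
by move=> F hF nF; apply: CU; apply/UP.
Qed.

Section RightAlmostSplit.
Variables (Y : modA) (indY : indecomposable Y) (C : 'M[k]_(dm Y)).
Hypotheses (C_1 : \tr C != 0)
  (C_rad : forall F, hm F -> F \notin unitmx -> \tr (F *m C) = 0).

Let n := \dim {:A}.
Let b (i : 'I_n) : A := (vbasis {:A})`_i.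

Lemma commutes_with_basis M N (F : 'M[k]_(dm M, dm N)) :
  (forall i, rho M (b i) *m F = F *m rho N (b i)) -> hm F.
Proof.
move=> hb a.
have rho0 P : rho P 0 = 0.
  by have := rhoL P (-1) 0 0; rewrite scaler0 addr0 scaleN1r addNr.
have rho_sum P l (c : 'I_l -> k) (x : 'I_l -> A) :
    rho P (\sum_i c i *: x i) = \sum_i c i *: rho P (x i).
  apply: (big_ind2 (fun x y => rho P x = y)) => // [x1 x2 y1 y2 <- <-|i _].
    by rewrite -[x1]scale1r rhoL !scale1r.
  by rewrite -[_ *: x i]addr0 rhoL rho0 addr0.
rewrite (coord_vbasis (memvf a)) !rho_sum mulmx_suml mulmx_sumr.
by apply: eq_bigr => i _; rewrite -scalemxAl hb scalemxAr.
Qed.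

Lemma Rad1_trace M (g : 'M[k]_(dm M, dm Y)) : hm g ->
  Rad 1 g <-> forall u : 'M_(dm Y, dm M), hm u -> \tr (u *m g *m C) = 0.
Proof.
move=> hg; split=> [rg u hu|tr0].
  apply: C_rad; first exact: hm_M.
  apply/negP => ug; apply: (radical_not_retract indY rg (hm_M (hm_inv (hm_M hu hg) ug) hu)).
  by rewrite -mulmxA mulVmx.
apply: (Rad1_nonretraction I_ind indY hg) => G hG E1.
by have := tr0 G hG; rewrite E1 mul1mx => /eqP; rewrite (negPf C_1).
Qed.

(* The annihilator of Hom_A(Y, M) inside the dual of Hom_k(Y, M). *)
Lemma Rad1_coboundary M (g : 'M[k]_(dm M, dm Y)) : hm g ->
  Rad 1 g <-> exists w : 'I_n -> 'M_(dm M, dm Y),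
    g *m C = \sum_i (w i *m rho Y (b i) - rho M (b i) *m w i).
Proof.
move=> hg; rewrite Rad1_trace //; split=> [tr0|[w E1] u hu]; last first.
  rewrite -mulmxA E1 mulmx_sumr linear_sum big1 //= => i _.
  rewrite mulmxBr raddfB /= !mulmxA -hu -mulmxA.
  by rewrite mxtrace_mulC -mulmxA mxtrace_mulC subrr.
have [||U UP] := @vspace_of_pred k 'M[k]_(dm M, dm Y)
  (fun X => exists w : 'I_n -> 'M_(dm M, dm Y),
    X = \sum_i (w i *m rho Y (b i) - rho M (b i) *m w i)).
- by exists (fun=> 0); rewrite big1 // => i _; rewrite mul0mx mulmx0 subrr.
- move=> a _ _ [w1 ->] [w2 ->]; exists (fun i => a *: w1 i + w2 i).
  rewrite scaler_sumr -big_split; apply: eq_bigr => i _ /=.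
  rewrite mulmxDl mulmxDr scalerBr -scalemxAl -scalemxAr opprD !addrA; congr (_ - _).
  by rewrite addrAC.
apply/UP; apply: contraT => /trace_functional [u [uU ug]]; exfalso.
(* u annihilates all coboundaries. By cyclicity of the trace, its defect of A-linearity is
   orthogonal to every w, hence zero; then the trace of u g C vanishes by [tr0]. *)
have hu : hm u.
  apply: commutes_with_basis => i; apply/eqP; rewrite -subr_eq0; apply/eqP.
  have tr_w (w : 'M_(dm M, dm Y)) : \tr (w *m (rho Y (b i) *m u - u *m rho M (b i))) = 0.
    have -> : \tr (w *m (rho Y (b i) *m u - u *m rho M (b i))) =
        \tr ((w *m rho Y (b i) - rho M (b i) *m w) *m u).
      rewrite mulmxBr mulmxBl !raddfB /= !mulmxA; congr (_ - _).
      by rewrite mxtrace_mulC mulmxA.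
    apply: uU; apply/UP; exists (fun j => if j == i then w else 0).
    rewrite (bigD1 i) //= eqxx big1 ?addr0 // => j /negPf ->.
    by rewrite mul0mx mulmx0 subrr.
  apply/matrixP => a c; have := tr_w (delta_mx c a).
  rewrite /mxtrace (bigD1 c) //= big1 => [|x xc]; last first.
    by rewrite mxE big1 // => y _; rewrite mxE (negPf xc) mul0r.
  rewrite addr0 mxE (bigD1 a) //= big1 => [|y ya]; last first.
    by rewrite mxE (negPf ya) andbF mul0r.
  by rewrite addr0 mxE !eqxx mul1r => ->; rewrite mxE.
move/eqP: ug; apply; rewrite mxtrace_mulC mulmxA; exact: tr0.
Qed.

(** By [Rad1_coboundary], radical maps g into Y are those for which some family w solves g C =
    coboundary of w. Pairs (g, w) without the equation are the maps into Y plus [Q1]; the equation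
    takes place in [Q2], where k-linear maps to the space of Y become A-linear. So E, the kernel of
    the difference [p1 *m th - p2 *m de], represents the solutions, and its projection to Y is right
    almost split. *)
Lemma right_almost_split_exists : exists E (e : 'M[k]_(dm E, dm Y)), Rad 1 e /\
  forall M (g : 'M_(dm M, dm Y)), Rad 1 g -> exists2 x, hm x & g = x *m e.
Proof.
have [m [P hP]] := pack_family k (dm Y) n.
have [Q1 [ev1 [ex1 _]]] := coinduced_module m.
have [Q2 [ev2 [ex2 uniq2]]] := coinduced_module (dm Y).
pose D := \sum_i (ev1 *m P i *m rho Y (b i) - rho Q1 (b i) *m (ev1 *m P i)).
have [th hth Eth] := ex2 Y C; have [de hde Ede] := ex2 Q1 D.
have [S [i1 [i2 [p1 [p2 [[hi1 hi2 hp1 hp2] [e11 e22] [e12 e21] e_sum]]]]]] := sum_module Y Q1.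
have [|E [i [hi fi i0 ker]]] := @kernel_module k A S Q2 (p1 *m th - p2 *m de).
  by apply: hm_B; apply: hm_M.
have fD M (f : 'M_(dm M, dm Q1)) : hm f -> f *m D =
    \sum_j (f *m ev1 *m P j *m rho Y (b j) - rho M (b j) *m (f *m ev1 *m P j)).
  move=> hf; rewrite mulmx_sumr; apply: eq_bigr => j _.
  by rewrite mulmxBr !mulmxA hf.
exists E, (i *m p1); split.
  apply/Rad1_coboundary; first exact: hm_M.
  exists (fun j => i *m p2 *m ev1 *m P j); rewrite -fD; last exact: hm_M.
  rewrite -Eth -Ede !mulmxA; congr (_ *m _).
  by apply/subr0_eq; rewrite -!mulmxA -mulmxBr.
move=> M g rg; have hg := Rad_hm rg.
have [w Ew] := (Rad1_coboundary hg).1 rg.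
have [W hW] := hP _ w; have [f hf Ef] := ex1 M W.
have E1 : g *m th = f *m de.
  apply: uniq2; [exact: hm_M|exact: hm_M|].
  rewrite -!mulmxA Eth Ede Ew fD //; apply: eq_bigr => j _.
  by rewrite Ef hW.
have [|x Ex] := ker _ (g *m i1 + f *m i2).
  rewrite mulmxBr !mulmxDl !mulmx_mid e11 e12 e21 e22 !mulmx1 !mulmx0 !mul0mx.
  by rewrite addr0 add0r E1 subrr.
have hx : hm x.
  by apply: (hm_free fi hi); rewrite -Ex; apply: hm_D; apply: hm_M.
exists x => //; rewrite mulmxA -Ex mulmxDl -!mulmxA e11 e21.
by rewrite mulmx1 mulmx0 addr0.
Qed.

End RightAlmostSplit.

Definition min_right_almost_split Y E (e : 'M[k]_(dm E, dm Y)) :=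
  [/\ Rad 1 e, forall M (g : 'M_(dm M, dm Y)), Rad 1 g -> exists2 x, hm x & g = x *m e
    & forall x, hm x -> x *m e = e -> x \in unitmx].

(** If x e = e with x not invertible, the restriction of e to the image of x is still right almost
    split, in smaller dimension. *)
Lemma min_right_almost_split_exists Y : indecomposable Y ->
  exists E (e : 'M[k]_(dm E, dm Y)), min_right_almost_split e.
Proof.
move=> indY; have [C [C1 Crad]] := radical_functional indY.
have [E [e [re ce]]] := right_almost_split_exists indY C1 Crad.
move: {2}(dm E) (leqnn (dm E)) => m; elim: m => [|m IH] in E e re ce *.
  move=> le; exists E, e; split=> // x _ _.
  have E0 : dm E = 0%N by apply/eqP; rewrite -leqn0.
  by rewrite -row_free_unit -row_leq_rank {1}E0.
move=> le; have [min|] := classic (forall x, hm x -> x *m e = e -> x \in unitmx).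
  by exists E, e.
move=> /not_all_ex_not [x nx].
have [hx nx'] := imply_to_and _ _ nx; have [xe /negP ux] := imply_to_and _ _ nx'.
have [P [p [i [hp hi fi Ex fp]]]] := image_module hx.
apply: (IH P (i *m e)).
- exact: Rad_hl.
- move=> M g /ce [y hy ->]; exists (y *m p); first exact: hm_M.
  by rewrite -mulmxA (mulmxA p) -Ex xe.
- rewrite -ltnS; apply: leq_trans le; rewrite ltnNge; apply: contra ux => le.
  rewrite -row_free_unit -row_leq_rank Ex mxrankMfree //.
  by move: fp; rewrite -col_leq_rank; apply: leq_trans.
Qed.

(** * Factorisation through a minimal right almost split map and through its kernel *)

Section Mesh.
Variables (Y E Z : modA) (e : 'M[k]_(dm E, dm Y)) (s : 'M[k]_(dm Z, dm E)).
Hypotheses (indY : indecomposable Y) (e_mras : min_right_almost_split e).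
Hypotheses (hs : hm s) (fs : row_free s) (se : s *m e = 0).
Hypothesis s_ker : forall n (g : 'M_(n, dm E)), g *m e = 0 -> exists c, g = c *m s.

Let e_R : Rad 1 e. Proof. by case: e_mras. Qed.
Let e_cover M (g : 'M_(dm M, dm Y)) : Rad 1 g -> exists2 x, hm x & g = x *m e.
Proof. by case: e_mras => _ h _; apply: h. Qed.
Let e_min x : hm x -> x *m e = e -> x \in unitmx. Proof. by case: e_mras => _ _; apply. Qed.

(** If h were not radical, some u h would have a right inverse w. Then x = 1 - w u h satisfies x e =
    e, so it is invertible by minimality, although u h x = 0. *)
Lemma ras_kernel_radical M (h : 'M[k]_(dm M, dm E)) : hm h -> h *m e = 0 -> Rad 1 h.
Proof.
move=> hh he; apply/(Rad1P I_ind); split=> // U u v indU hu hv; apply/negP => uhv.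
have huhv : hm (u *m h *m v) by apply: hm_M => //; apply: hm_M.
pose w := v *m invmx (u *m h *m v).
have hw : hm w by apply: hm_M => //; apply: hm_inv.
have uhw : u *m h *m w = 1%:M by rewrite mulmxA mulmxV.
pose x := 1%:M - w *m (u *m h).
have ux : x \in unitmx.
  apply: e_min; first by apply: hm_B; [exact: hm_1|apply: hm_M => //; apply: hm_M].
  by rewrite mulmxBl mul1mx -!mulmxA he !mulmx0 subr0.
have : u *m h *m x = 0 by rewrite mulmxBr mulmx1 (mulmxA (u *m h)) uhw mul1mx subrr.
move=> uhx; have uh0 : u *m h = 0 by rewrite -[u *m h](mulmxK ux) uhx mul0mx.
by have := indec_neq0 indU; rewrite -uhw uh0 mul0mx eqxx.
Qed.

(** Writing g e = a c with a and c radical and c = x e, the difference g - a x is killed by e, hence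
    radical. *)
Lemma ras_minimal M (g : 'M[k]_(dm M, dm E)) : hm g -> Rad 2 (g *m e) -> Rad 1 g.
Proof.
move=> hg /Rad_right_factor [W [a [c [ra rc E1]]]].
have [x hx Ex] := e_cover rc.
have hax : Rad 1 (a *m x) by apply: Rad_hr.
rewrite -[g](subrK (a *m x)); apply: Rad_D => //; apply: ras_kernel_radical.
  by apply: hm_B => //; apply: Rad_hm hax.
by rewrite mulmxBl E1 Ex mulmxA subrr.
Qed.

Lemma ras_cover n M (g : 'M[k]_(dm M, dm Y)) : Rad n.+1 g ->
  exists2 x, Rad n x & g = x *m e.
Proof.
case/Rad_right_factor => W [a [c [ra /e_cover [x hx ->] ->]]].
by exists (a *m x); [exact: Rad_hr|rewrite mulmxA].
Qed.

(* The pushout F of s along a maps onto Y with kernel W; this map is either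
   radical, hence factors through e, or a split epimorphism. *)
Lemma kernel_cover1 W (a : 'M[k]_(dm Z, dm W)) : Rad 1 a ->
  exists2 x, hm x & a = s *m x.
Proof.
move=> ra; have ha := Rad_hm ra.
have [S [i1 [i2 [p1 [p2 [[hi1 hi2 hp1 hp2] [e11 e22] [e12 e21] e_sum]]]]]] := sum_module E W.
pose j := s *m i1 - a *m i2.
have hj : hm j by apply: hm_B; apply: hm_M.
have [|F [q [q' [hq q'q kq]]]] := @quotient_module k A S _ j.
  by move=> x; rewrite -hj submxMl.
pose iE := i1 *m q; pose iW := i2 *m q.
have hiE : hm iE by apply: hm_M. have hiW : hm iW by apply: hm_M.
have jq : j *m q = 0 by apply/eqP; rewrite kq.
have siE : s *m iE = a *m iW.
  by apply/subr0_eq; rewrite !mulmxA -mulmxBl -/j jq.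
have jp1 : j *m p1 = s by rewrite mulmxBl -!mulmxA e11 e21 mulmx1 mulmx0 subr0.
pose qY := q' *m (p1 *m e).
have qqY : q *m qY = p1 *m e.
  have /submxP [c Ec] : (1%:M - q *m q' <= j)%MS.
    by rewrite -kq mulmxBl mul1mx -mulmxA q'q mulmx1 subrr.
  have : (1%:M - q *m q') *m (p1 *m e) = 0.
    by rewrite Ec -mulmxA (mulmxA j) jp1 se mulmx0.
  by rewrite mulmxBl mul1mx -mulmxA => /subr0_eq.
have fq : row_full q by apply/row_fullP; exists q'.
have hqY : hm qY.
  by apply: (hm_full fq hq); rewrite qqY; apply: hm_M => //; apply: Rad_hm e_R.
have iEqY : iE *m qY = e by rewrite -mulmxA qqY mulmxA e11 mul1mx.
have iWqY : iW *m qY = 0 by rewrite -mulmxA qqY mulmxA e21 mul0mx.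
have fiW : row_free iW.
  rewrite -kermx_eq0; apply/eqP.
  have : kermx iW *m i2 *m q == 0 by rewrite -mulmxA mulmx_ker.
  rewrite kq => /submxP [c Ec].
  have c0 : c = 0.
    by apply: (row_free_inj fs); rewrite /= mul0mx -jp1 mulmxA -Ec -mulmxA e21 mulmx0.
  by rewrite -[LHS]mulmx1 -e22 mulmxA Ec c0 !mul0mx.
have kqY m (h : 'M_(m, dm F)) : h *m qY = 0 -> exists x, h = x *m iW.
  move=> hqY0; pose v := h *m q'.
  have [|c Ec] := s_ker (g := v *m p1); first by rewrite -!mulmxA.
  exists (c *m a + v *m p2).
  have -> : h = v *m q by rewrite -mulmxA q'q mulmx1.
  have Ev : v = c *m s *m i1 + v *m p2 *m i2.
    by rewrite -[LHS]mulmx1 -e_sum mulmxDr !mulmxA Ec.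
  rewrite {1}Ev !mulmxDl; congr (_ + _); last by rewrite -mulmxA.
  by rewrite -(mulmxA (c *m s)) -/iE -mulmxA siE mulmxA.
(* If [qY] factors through e, minimality makes [iE *m x] invertible, and so is the map U' that it
   induces on Z. But U' also factors through the radical map a; hence Z = 0. *)
have [rqY|nrqY] := classic (Rad 1 qY).
  have [x hx Ex] := e_cover rqY.
  have uU : iE *m x \in unitmx.
    by apply: e_min; [exact: hm_M|rewrite -mulmxA -Ex].
  have [|y Ey] := s_ker (g := iW *m x); first by rewrite -mulmxA -Ex.
  have [|U' EU'] := s_ker (g := s *m (iE *m x)); first by rewrite -(mulmxA s) -(mulmxA iE) -Ex iEqY.
  have U'E : U' = a *m y.
    apply: (row_free_inj fs) => /=.
    by rewrite -EU' mulmxA siE -mulmxA Ey mulmxA.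
  have uU' : U' \in unitmx.
    rewrite -row_free_unit -row_leq_rank -(mxrankMfree _ fs) -EU'.
    by rewrite mxrankMfree ?row_free_unit // row_leq_rank.
  have hy : hm y by apply: (hm_free fs hs); rewrite -Ey; apply: hm_M.
  have rU' : Rad 1 U' by rewrite U'E; apply: Rad_hr.
  have Z0 : (1%:M : 'M[k]_(dm Z)) = 0.
    apply: (Rad1_one_zero I_ind); rewrite -(mulmxV uU').
    by apply: Rad_hr => //; apply: hm_inv => //; apply: Rad_hm rU'.
  by exists 0; [exact: hm_0|rewrite mulmx0 -[a]mul1mx Z0 mul0mx].
(* Otherwise [qY] splits, so its kernel [iW] has a retraction t, and [iE *m t] extends a along s. *)
have [G hG GqY] : exists2 G, hm G & G *m qY = 1%:M.
  apply: NNPP => no; apply: nrqY; apply: (Rad1_nonretraction I_ind indY hqY) => G hG E1.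
  by apply: no; exists G.
have [|t Et] := kqY _ (1%:M - qY *m G).
  by rewrite mulmxBl mul1mx -mulmxA GqY mulmx1 subrr.
have ht : hm t.
  apply: (hm_free fiW hiW); rewrite -Et; apply: hm_B; [exact: hm_1|exact: hm_M].
exists (iE *m t); first exact: hm_M.
rewrite mulmxA siE -mulmxA; suff -> : iW *m t = 1%:M by rewrite mulmx1.
apply: (row_free_inj fiW) => /=.
by rewrite -mulmxA -Et mulmxBr mulmx1 mulmxA iWqY mul0mx subr0 mul1mx.
Qed.

Lemma kernel_cover n W (a : 'M[k]_(dm Z, dm W)) : Rad n.+1 a ->
  exists2 x, Rad n x & a = s *m x.
Proof.
case/Rad_left_factor => V [c [d [/kernel_cover1 [x hx ->] rd ->]]].
by exists (x *m d); [exact: Rad_hl|rewrite mulmxA].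
Qed.

End Mesh.

End AlmostSplit.

(** Turns the matrices satisfying H into an algebra, a subspace of matrices closed under products,
    so that [wedderburn] applies with the non-units as ideal. *)
Lemma wedderburn_mx (k : fieldType) d (H : 'M[k]_d -> Prop) :
  perfect_field k -> (0 < d)%N -> H 1%:M ->
  (forall a F G, H F -> H G -> H (a *: F + G)) ->
  (forall F G, H F -> H G -> H (F *m G)) ->
  (forall F, H F -> F \in unitmx -> H (invmx F)) ->
  (forall F, H F -> F \in unitmx \/ exists n, mxpow F n = 0) ->
  (forall F G, H F -> H G -> F + G \in unitmx -> F \in unitmx \/ G \in unitmx) ->
  exists K : 'M[k]_d -> Prop, [/\ forall F, K F -> H F, K 1%:M,
    forall a F G, K F -> K G -> K (a *: F + G),
    forall F G, K F -> K G -> K (F *m G) &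
    [/\ forall F, H F -> exists2 G, K G & F - G \notin unitmx,
    forall F, K F -> F \notin unitmx -> F = 0 &
    exists n (x y : 'I_n -> 'M[k]_d), [/\ forall j, K (x j), forall j, K (y j),
      \sum_j x j *m y j = 1%:M & forall a, K a -> exists al : 'I_n -> 'I_n -> k,
        (forall j, a *m x j = \sum_l al j l *: x l) /\
        (forall l, y l *m a = \sum_j al j l *: y j)]]].
Proof.
case: d H => [|d] H // perf _ H1 Hlin HM Hinv Hfit Hadd.
have H0 : H 0 by have := Hlin (-1) 1%:M 1%:M H1 H1; rewrite scaleN1r addNr.
have unit0 : (0 : 'M[k]_d.+1) \notin unitmx.
  by apply/negP => /mulmxV /eqP; rewrite mul0mx eq_sym oner_eq0.
have [E EP] := @vspace_of_pred k 'M[k]_d.+1 H H0 Hlin.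
have E1 : 1 \in E by apply/EP.
have EA : is_aspace E.
  rewrite /is_aspace has_algid1 //=; apply/prodvP => F G /EP hF /EP hG.
  by apply/EP; apply: HM.
pose B : {aspace 'M[k]_d.+1} := ASpace EA.
pose R : falgType k := subvs_of B.
pose v (x : R) : 'M[k]_d.+1 := vsval x.
have vM x y : v (x * y) = v x *m v y by [].
have v1 : v 1 = 1%:M by apply/eqP; rewrite -[v 1]/(algid B) algid_eq1.
have vH x : H (v x) by apply/EP; exact: subvsP.
have v_inj x y : v x = v y -> x = y by move/val_inj.
have vL a x y : v (a *: x + y) = a *: v x + v y by rewrite /v linearP.
have lift F : H F -> {x : R | v x = F}.
  by move=> hF; exists (vsproj B F); rewrite /v vsprojK //; apply/EP.
have nonunit_mul F G : F \notin unitmx \/ G \notin unitmx -> F *m G \notin unitmx.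
  by rewrite unitmx_mul => -[/negPf ->|/negPf ->]; rewrite ?andbF.
have [||J JP] := @vspace_of_pred k R (fun x => v x \notin unitmx).
- by rewrite /v linear0.
- move=> a x y nx ny; apply/negP; rewrite vL => /Hadd [] //.
  + by rewrite -[_ *: _]addr0; apply: Hlin.
  + by apply/negP; rewrite -mul_scalar_mx; apply: nonunit_mul; right.
  + by apply/negP.
have [|||||K [K1 KM Ksplit KJ [n [x [y [Kx Ky [xy cas]]]]]]] := @wedderburn k R J perf.
- by move=> r z /JP nz; apply/JP; rewrite vM; apply: nonunit_mul; right.
- by move=> r z /JP nz; apply/JP; rewrite vM; apply: nonunit_mul; left.
- by apply/negP => /JP; rewrite v1 unitmx1.
- move=> z /JP nz; have [|[m zm]] := Hfit _ (vH z); first by rewrite (negPf nz).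
  exists m; apply: v_inj; rewrite [RHS]linear0 -zm.
  by elim: m {zm} => [|m IH]; rewrite ?expr0 // exprS vM IH.
- move=> z nz; have uz : v z \in unitmx by apply: contraNT nz => h; apply/JP.
  have [w vw] := lift _ (Hinv _ (vH z) uz).
  apply/unitrP; exists w; split; apply: v_inj; rewrite vM vw v1.
    exact: mulVmx.
  exact: mulmxV.
exists (fun F => exists2 z, z \in K & v z = F); split.
- by move=> _ [z _ <-].
- by exists 1.
- by move=> a _ _ [z zK <-] [w wK <-]; exists (a *: z + w); rewrite ?vL // rpredD ?rpredZ.
- by move=> _ _ [z zK <-] [w wK <-]; exists (z * w); rewrite ?vM // KM.
split.
- move=> F /lift [r <-]; have [z zK /JP rz] := Ksplit r; exists (v z); first by exists z.
  by move: rz; rewrite /v linearB.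
- move=> _ [z zK <-] nz; rewrite (KJ z zK) ?[LHS]linear0 //; exact/JP.
exists n, (fun j => v (x j)), (fun j => v (y j)); split.
- by move=> j; exists (x j).
- by move=> j; exists (y j).
- by rewrite -v1 -xy /v linear_sum; apply: eq_bigr.
have v_sum m (c : 'I_m -> k) (F : 'I_m -> R) : v (\sum_l c l *: F l) = \sum_l c l *: v (F l).
  by rewrite /v linear_sum; apply: eq_bigr => l _; rewrite linearZ.
move=> _ [a aK <-]; have [al [ax ya]] := cas a aK; exists al.
by split=> j; rewrite -vM ?ax ?ya v_sum.
Qed.

(** * A complement of the radical *)

Section Complement.
Variables (k : fieldType) (perf : perfect_field k) (A : falgType k).
Local Notation modA := (modA A).
Implicit Types M N P Y : modA.
Variables (I : modA -> Prop) (I_ind : is_ind I).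

Definition wedderburn_complement Y (K : 'M[k]_(dm Y) -> Prop) :=
  [/\ forall F, K F -> hm F, K 1%:M,
    forall a F G, K F -> K G -> K (a *: F + G),
    forall F G, K F -> K G -> K (F *m G) &
    [/\ forall F, hm F -> exists2 G, K G & Rad 1 (F - G),
    forall F, K F -> Rad 1 F -> F = 0 &
    exists n (x y : 'I_n -> 'M[k]_(dm Y)), [/\ forall j, K (x j), forall j, K (y j),
      \sum_j x j *m y j = 1%:M & forall a, K a -> exists al : 'I_n -> 'I_n -> k,
        (forall j, a *m x j = \sum_l al j l *: x l) /\
        (forall l, y l *m a = \sum_j al j l *: y j)]]].

Lemma wedderburn_complement_exists Y : indecomposable Y ->
  exists K : 'M[k]_(dm Y) -> Prop, wedderburn_complement K.
Proof.
move=> indY.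
have R1P (F : 'M_(dm Y)) : hm F -> Rad 1 F <-> F \notin unitmx.
  move=> hF; split=> [rF|nF].
    apply/negP => uF; apply: (radical_not_split indY rF (hm_inv hF uF)).
    exact: mulmxV.
  have [//|[G _ [FG _]]] := indec_Rad1 indY indY hF.
  by have [uF _] := mulmx1_unit FG; rewrite uF in nF.
have [||||||K [KH K1 Klin KM [Ksplit Kunit cas]]] :=
    @wedderburn_mx k (dm Y) (@hm k A Y Y) perf (indec_dim indY).
- exact: hm_1.
- by move=> a F G hF hG; apply: hm_D => //; apply: hm_Z.
- exact: hm_M.
- exact: hm_inv.
- by move=> F; apply: indec_fitting.
- by move=> F G; apply: indec_add_unit.
exists K; split=> //; split=> // [F hF|F KF].
  have [G KG nFG] := Ksplit F hF; exists G => //.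
  by apply/R1P => //; apply: hm_B => //; apply: KH.
by move/(R1P _ (KH _ KF)); apply: Kunit.
Qed.

Definition KI Y : 'M[k]_(dm Y) -> Prop :=
  epsilon (inhabits (fun=> True)) (@wedderburn_complement Y).

Lemma KI_spec Y : I Y -> wedderburn_complement (@KI Y).
Proof.
move=> IY; apply: epsilon_spec; apply: wedderburn_complement_exists.
exact: indec_of_I IY.
Qed.

(* The restriction of the complement to [I], zero off the diagonal. *)
Definition KII Y Y' (F : 'M[k]_(dm Y, dm Y')) : Prop :=
  (Y <> Y' -> F = 0) /\
  forall E : Y' = Y, KI (eq_rect Y' (fun Z => 'M[k]_(dm Y, dm Z)) F Y E).

Lemma KII_diag Y (F : 'M_(dm Y)) : KII F <-> KI F.
Proof.
split=> [[_ /(_ erefl)]|KF]; first by [].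
by split=> // E; rewrite (Classical_Prop.proof_irrelevance _ E erefl).
Qed.

Lemma KII_0 Y Y' : I Y -> KII (0 : 'M_(dm Y, dm Y')).
Proof.
move=> IY; split=> // E; subst Y'; have [_ K1 Klin _ _] := KI_spec IY.
by have := Klin (-1) _ _ K1 K1; rewrite scaleN1r addNr.
Qed.

Lemma KII_off Y Y' (F : 'M_(dm Y, dm Y')) : Y <> Y' -> KII F -> F = 0.
Proof. by move=> ne [h _]; apply: h. Qed.

Lemma KII_lin Y Y' a (F G : 'M_(dm Y, dm Y')) : I Y -> KII F -> KII G -> KII (a *: F + G).
Proof.
move=> IY KF KG; have [E|ne] := classic (Y = Y'); last first.
  by rewrite (KII_off ne KF) (KII_off ne KG) scaler0 addr0; apply: KII_0.
subst Y'; apply/KII_diag; have [_ _ Klin _ _] := KI_spec IY.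
by apply: Klin; apply/KII_diag.
Qed.

Lemma KII_M Y Y' Y'' (F : 'M_(dm Y, dm Y')) (G : 'M_(dm Y', dm Y'')) :
  I Y -> KII F -> KII G -> KII (F *m G).
Proof.
move=> IY KF KG; have [E|ne] := classic (Y = Y'); last first.
  by rewrite (KII_off ne KF) mul0mx; apply: KII_0.
subst Y'; have [E|ne] := classic (Y = Y''); last first.
  by rewrite (KII_off ne KG) mulmx0; apply: KII_0.
subst Y''; apply/KII_diag; have [_ _ _ KM _] := KI_spec IY.
by apply: KM; apply/KII_diag.
Qed.

Lemma KII_hm Y Y' (F : 'M_(dm Y, dm Y')) : I Y -> KII F -> hm F.
Proof.
move=> IY KF; have [E|ne] := classic (Y = Y'); last first.
  by rewrite (KII_off ne KF); apply: hm_0.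
by subst Y'; have [h _ _ _ _] := KI_spec IY; apply: h; apply/KII_diag.
Qed.

Lemma KII_Rad1 Y Y' (F : 'M_(dm Y, dm Y')) : I Y -> KII F -> Rad 1 F -> F = 0.
Proof.
move=> IY KF; have [E|ne] := classic (Y = Y'); last by rewrite (KII_off ne KF).
by subst Y'; have [_ _ _ _ [_ h _]] := KI_spec IY; apply: h; apply/KII_diag.
Qed.

Lemma KII_split Y Y' (F : 'M_(dm Y, dm Y')) : I Y -> I Y' -> hm F ->
  exists2 G, KII G & Rad 1 (F - G).
Proof.
move=> IY IY' hF; have [E|ne] := classic (Y = Y').
  subst Y'; have [_ _ _ _ [h _ _]] := KI_spec IY.
  by have [G KG RG] := h F hF; exists G => //; apply/KII_diag.
exists 0; rewrite ?subr0; first exact: KII_0.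
have [//|iso] := indec_Rad1 (indec_of_I I_ind IY) (indec_of_I I_ind IY') hF.
have [f Ef] := hom_of_mat hF.
case: I_ind => _ _ uniq; exfalso; apply: ne; apply: uniq => //.
by exists f; apply/iso_mat; rewrite Ef.
Qed.

Record decomposition M := Decomposition {
  dT : finType;
  dP : dT -> modA;
  dp : forall i, 'M[k]_(dm M, dm (dP i));
  dq : forall i, 'M[k]_(dm (dP i), dm M);
  d_dec : decomposes dp dq;
  d_I : forall i, I (dP i)
}.
Arguments dP {M} d i.
Arguments dp {M} d i.
Arguments dq {M} d i.
Arguments d_dec {M} d.
Arguments d_I {M} d i.

Lemma decompose M : inhabited (decomposition M).
Proof.
have [T [P [p [q [h hI]]]]] := decomposition_exists I_ind M.
by constructor; apply: Decomposition h hI.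
Qed.

Lemma trivial_decomposes M :
  @decomposes k A M unit (fun=> M) (fun=> 1%:M) (fun=> 1%:M).
Proof.
split=> [i|i|i|[] []|] //; try exact: hm_1; first exact: mulmx1.
by rewrite (eq_bigl (pred1 tt)) ?big_pred1_eq ?mulmx1 // => -[].
Qed.

Definition dtriv M (IM : I M) : decomposition M :=
  Decomposition (trivial_decomposes M) (fun=> IM).

(** Members of [I] get the trivial decomposition, so that between them [Kmod] is [KII] itself and
    the structure maps of any decomposition lie in [Kmod]. *)
Definition decM M : decomposition M :=
  match excluded_middle_informative (I M) with
  | left IM => dtriv IM
  | right _ => epsilon (decompose M) (fun=> True)
  end.

Lemma decM_I M : I M -> exists IM : I M, decM M = dtriv IM.
Proof. by move=> IM; rewrite /decM; case: excluded_middle_informative => // h; exists h. Qed.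

Definition Kdec M N (DM : decomposition M) (DN : decomposition N) (F : 'M[k]_(dm M, dm N)) :=
  forall i j, KII (dq DM i *m F *m dp DN j).

Definition Kmod M N (F : 'M[k]_(dm M, dm N)) := Kdec (decM M) (decM N) F.

Lemma Kmod_I M N (F : 'M_(dm M, dm N)) : I M -> I N -> Kmod F <-> KII F.
Proof.
move=> /decM_I [IM EM] /decM_I [IN EN]; rewrite /Kmod EM EN.
split=> [/(_ tt tt)|h [] []]; by rewrite /= mul1mx mulmx1.
Qed.

Lemma Kmod_expand M N (F : 'M_(dm M, dm N)) :
  F = \sum_i \sum_j dp (decM M) i *m (dq (decM M) i *m F *m dp (decM N) j) *m dq (decM N) j.
Proof.
have [_ _ _ _ sM] := d_dec (decM M); have [_ _ _ _ sN] := d_dec (decM N).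
rewrite -[LHS]mul1mx -sM -[LHS]mulmx1 -sN !mulmx_suml; apply: eq_bigr => i _.
by rewrite mulmx_sumr; apply: eq_bigr => j _; rewrite !mulmxA.
Qed.

Lemma Kmod_lin M N a (F G : 'M_(dm M, dm N)) : Kmod F -> Kmod G -> Kmod (a *: F + G).
Proof.
move=> KF KG i j; rewrite mulmxDr mulmxDl -scalemxAr -scalemxAl.
by apply: KII_lin => //; apply: d_I.
Qed.

Lemma Kmod_0 M N : Kmod (0 : 'M_(dm M, dm N)).
Proof. by move=> i j; rewrite mulmx0 mul0mx; apply: KII_0; apply: d_I. Qed.

Lemma KII_sum Y Y' (T : finType) (F : T -> 'M_(dm Y, dm Y')) : I Y ->
  (forall i, KII (F i)) -> KII (\sum_i F i).
Proof.
move=> IY h; apply: big_ind => //; first exact: KII_0.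
by move=> x y Kx Ky; rewrite -[x]scale1r; apply: KII_lin.
Qed.

Lemma Kmod_M M N P (F : 'M_(dm M, dm N)) (G : 'M_(dm N, dm P)) :
  Kmod F -> Kmod G -> Kmod (F *m G).
Proof.
move=> KF KG i j; have [_ _ _ _ sN] := d_dec (decM N).
rewrite -[F]mulmx1 -sN mulmx_sumr mulmx_suml mulmx_sumr mulmx_suml.
apply: KII_sum => [|l]; first exact: d_I.
have -> : dq (decM M) i *m (F *m (dp (decM N) l *m dq (decM N) l) *m G) *m dp (decM P) j =
  dq (decM M) i *m F *m dp (decM N) l *m (dq (decM N) l *m G *m dp (decM P) j).
  by rewrite !mulmxA.
by apply: KII_M => //; apply: d_I.
Qed.

Lemma KII_delta M (D : decomposition M) i j : KII (dq D i *m dp D j).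
Proof.
have [_ _ qp qpN _] := d_dec D; have [ij|ij] := eqVneq i j.
  subst j; rewrite qp; apply/KII_diag.
  by have [_ K1 _ _ _] := KI_spec (d_I D i).
by rewrite qpN //; apply: KII_0; apply: d_I.
Qed.

Lemma Kmod_1 M : Kmod (1%:M : 'M_(dm M)).
Proof. by move=> i j; rewrite mulmx1; apply: KII_delta. Qed.

Lemma Kmod_hm M N (F : 'M_(dm M, dm N)) : Kmod F -> hm F.
Proof.
move=> KF; rewrite (Kmod_expand F); apply: hm_sum => i; apply: hm_sum => j.
have [hp _ _ _ _] := d_dec (decM M); have [_ hq _ _ _] := d_dec (decM N).
apply: hm_M => //; apply: hm_M => //; apply: KII_hm => //; exact: d_I.
Qed.

Lemma Kmod_Rad1 M N (F : 'M_(dm M, dm N)) : Kmod F -> Rad 1 F -> F = 0.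
Proof.
move=> KF RF; rewrite (Kmod_expand F) big1 // => i _; rewrite big1 // => j _.
have [_ hq _ _ _] := d_dec (decM M); have [hp _ _ _ _] := d_dec (decM N).
rewrite (KII_Rad1 (d_I _ _) (KF i j)) ?mulmx0 ?mul0mx //.
by apply: Rad_hr => //; apply: Rad_hl.
Qed.


Lemma Kmod_split M N (F : 'M_(dm M, dm N)) : hm F -> exists2 G, Kmod G & Rad 1 (F - G).
Proof.
move=> hF.
have [hpM hqM qpM qpNM _] := d_dec (decM M); have [hpN hqN qpN qpNN _] := d_dec (decM N).
have split_ij i j : exists G, KII G /\ Rad 1 (dq (decM M) i *m F *m dp (decM N) j - G).
  have [|G] := @KII_split _ _ (dq (decM M) i *m F *m dp (decM N) j) (d_I _ _) (d_I _ _).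
  - by apply: hm_M => //; apply: hm_M.
  - by move=> KG RG; exists G.
pose G i j := sval (constructive_indefinite_description _ (split_ij i j)).
have KG i j : KII (G i j) by case: (svalP (constructive_indefinite_description _ (split_ij i j))).
have RG i j : Rad 1 (dq (decM M) i *m F *m dp (decM N) j - G i j).
  by case: (svalP (constructive_indefinite_description _ (split_ij i j))).
exists (\sum_i \sum_j dp (decM M) i *m G i j *m dq (decM N) j).
  move=> i j; suff -> : dq (decM M) i *m
    (\sum_i0 \sum_j0 dp (decM M) i0 *m G i0 j0 *m dq (decM N) j0) *m dp (decM N) j = G i j by [].
  rewrite (bigD1 i) //= (bigD1 j) //= !mulmxDr !mulmxDl.
  rewrite !mulmxA qpM mul1mx -[_ *m _ *m dp _ _]mulmxA qpN mulmx1.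
  rewrite mulmx_sumr mulmx_suml big1 => [|j' jj'].
    rewrite addr0 mulmx_sumr mulmx_suml big1 ?addr0 // => i' ii'.
    rewrite mulmx_sumr mulmx_suml big1 // => j' _.
    by rewrite !mulmxA qpNM 1?eq_sym // !mul0mx.
  by rewrite -!mulmxA qpNN // !mulmx0.
rewrite [X in X - _](Kmod_expand F) -sumrB; apply: Rad_sum => i.
rewrite -sumrB; apply: Rad_sum => j.
by rewrite -mulmxBl -mulmxBr; apply: Rad_hr => //; apply: Rad_hl.
Qed.

Lemma Kmod_dec N : exists (T : finType) (P : T -> modA)
  (p : forall i, 'M_(dm N, dm (P i))) (q : forall i, 'M_(dm (P i), dm N)),
  [/\ forall i, I (P i), forall i, Kmod (p i), forall i, Kmod (q i)
    & \sum_i p i *m q i = 1%:M].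
Proof.
exists (dT (decM N)), (dP (decM N)), (dp (decM N)), (dq (decM N)).
have [_ _ _ _ dec1] := d_dec (decM N).
split=> // i; first exact: d_I.
  have [IP EP] := decM_I (d_I (decM N) i); rewrite /Kmod EP => j [] /=.
  by rewrite mulmx1; apply: KII_delta.
have [IP EP] := decM_I (d_I (decM N) i); rewrite /Kmod EP => -[] j /=.
by rewrite mul1mx; apply: KII_delta.
Qed.


Record mesh Y := Mesh {
  mE : modA;
  mZ : modA;
  me : 'M[k]_(dm mE, dm Y);
  ms : 'M[k]_(dm mZ, dm mE);
  me_mras : min_right_almost_split me;
  ms_hm : hm ms;
  ms_free : row_free ms;
  ms_me : ms *m me = 0;
  ms_ker : forall n (g : 'M_(n, dm mE)), g *m me = 0 -> exists c, g = c *m ms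
}.
Arguments me {Y} _.
Arguments ms {Y} _.

Lemma mesh_exists Y : I Y -> inhabited (mesh Y).
Proof.
move=> IY; have [E [e he]] := min_right_almost_split_exists I_ind (indec_of_I I_ind IY).
have [e_R _ _] := he; have [Z [s [hs fs se ker]]] := kernel_module (Rad_hm e_R).
by constructor; apply: Mesh he hs fs se ker.
Qed.

(** Options make the choice total: outside [I], when no mesh is chosen, the objects default to Y and
    the maps to 0. *)
Lemma mesh_family : exists (E Z : modA -> modA) (e : forall Y, 'M[k]_(dm (E Y), dm Y))
    (s : forall Y, 'M[k]_(dm (Z Y), dm (E Y))), forall Y, I Y ->
  [/\ min_right_almost_split (e Y), hm (s Y), row_free (s Y), s Y *m e Y = 0
    & forall n (g : 'M_(n, dm (E Y))), g *m e Y = 0 -> exists c, g = c *m s Y].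
Proof.
have meshY Y : exists m : option (mesh Y), I Y -> m.
  have [/mesh_exists [m]|nI] := classic (I Y); last by exists None.
  by exists (Some m).
pose m Y := epsilon (inhabits None) (fun m : option (mesh Y) => I Y -> m).
have mI Y : I Y -> m Y by apply: (epsilon_spec (inhabits None) _ (meshY Y)).
exists (fun Y => oapp (@mE Y) Y (m Y)), (fun Y => oapp (@mZ Y) Y (m Y)).
exists (fun Y => if m Y is Some x as o return 'M_(dm (oapp (@mE Y) Y o), dm Y) then me x else 0).
exists (fun Y => if m Y is Some x as o return 'M_(dm (oapp (@mZ Y) Y o), dm (oapp (@mE Y) Y o))
  then ms x else 0).
by move=> Y /mI; case: (m Y) => // -[].
Qed.

Lemma strict_representatives (P : nat -> modA) (h : forall i, 'M[k]_(dm (P i), dm (P i.+1))) n :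
  (forall i, (i < n)%N -> Rad 1 (h i)) -> Rad n.+1 (path_mx h n) ->
  exists f : forall i, 'M[k]_(dm (P i), dm (P i.+1)),
    [/\ forall i, hm (f i), forall i, (i < n)%N -> Rad 2 (h i - f i) & path_mx f n = 0].
Proof.
move=> Rh Rp; have [E [Z [e [s meshY]]]] := mesh_family.
have indI Y := @indec_of_I _ _ I I_ind Y.
have [] := @strictify k modA (@dm k A) I (@Rad k A) Kmod _ _ _ _ _ _ _ _ _ _ _ _ _ _ _ _ _ _ _ E Z e s
   _ _ _ _ _ _ _ _ P h n Rh Rp.
- exact: Rad_0.
- exact: Rad_D.
- by move=> m M N a f; apply: Rad_Z.
- exact: Rad_S.
- exact: Rad_M.
- by move=> M; apply/Rad0P; apply: hm_1.
- by move=> M f /Rad0P hf uf; apply/Rad0P; apply: hm_inv.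
- by move=> M f; apply: (Rad1_unit I_ind).
- exact: Kmod_0.
- by move=> M N f g Kf Kg; rewrite -[f]scale1r; apply: Kmod_lin.
- by move=> M N a f Kf; rewrite -[a *: f]addr0; apply: Kmod_lin => //; apply: Kmod_0.
- exact: Kmod_M.
- exact: Kmod_1.
- by move=> M N f Kf; apply/Rad0P; apply: Kmod_hm.
- exact: Kmod_Rad1.
- by move=> M N f /Rad0P; apply: Kmod_split.
- move=> M N f IM IN /(Kmod_I _ IM IN) Kf.
  by have [eqMN|ne] := classic (M = N); [right|left; apply: KII_off Kf].
- exact: Kmod_dec.
- move=> M IM; have [_ _ _ _ [_ _ [m [x [y [Kx Ky xy cas]]]]]] := KI_spec IM.
  have KE (F : 'M_(dm M)) : Kmod F <-> KI F.
    by split=> [/(Kmod_I _ IM IM)/KII_diag|/KII_diag/(Kmod_I _ IM IM)].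
  exists m, x, y; split=> // [j|j|a /KE]; [exact/KE|exact/KE|exact: cas].
- by move=> Y /meshY [[]].
- by move=> Y /meshY [he _ _ _ _] m M g; apply: ras_cover.
- move=> Y IY M g /Rad0P hg; have [he _ _ _ _] := meshY Y IY.
  exact: (ras_minimal I_ind he hg).
- move=> Y IY; have [he hs fs se ker] := meshY Y IY.
  exact: (ras_kernel_radical I_ind he hs se).
- by move=> Y /meshY [].
- move=> Y IY M g /Rad0P hg ge; have [he hs fs se ker] := meshY Y IY.
  have [c Ec] := ker _ g ge; exists c => //; apply/Rad0P.
  by apply: (hm_free fs hs); rewrite -Ec.
- by move=> Y /meshY [].
- move=> Y IY m M f; have [he hs fs se ker] := meshY Y IY.
  exact: (kernel_cover I_ind (indI Y IY) he hs fs se ker).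
by move=> f [hf Rf f0]; exists f; split=> // i; apply/Rad0P.
Qed.

End Complement.

(** * Composites of irreducible morphisms *)

Section Paths.
Variables (k : fieldType) (A : falgType k) (X : nat -> modA A).
Local Notation arrows := (forall i, 'M[k]_(dm (X i), dm (X i.+1))).
Local Notation path := (path_mx (d := @dm k A) (P := X)).
Implicit Types f g a b : arrows.

Lemma mat_comp_seq (f : forall i, mhom (X i) (X i.+1)) n :
  mat (comp_seq f n) = path (fun i => mat (f i)) n.
Proof.
elim: n => [|n IH] /=; first by apply/mat_id.
by rewrite mat_comp IH.
Qed.

Lemma comp_seq_zero (f : forall i, mhom (X i) (X i.+1)) n :
  comp_seq f n =1 mzero (X 0%N) (X n) <-> path (fun i => mat (f i)) n = 0.
Proof. by rewrite -mat_comp_seq -mat_inj mat_zero. Qed.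

Lemma path_mx_ext f g n : (forall i, (i < n)%N -> f i = g i) -> path f n = path g n.
Proof.
elim: n => [|n IH] h //=; rewrite IH => [|i lt]; last by apply/h/ltnW.
by rewrite h.
Qed.

(** Q collects the factors already chosen, since the induction removes them from the right end. *)
Lemma path_mx_expand a b n m (Q : 'M[k]_(dm (X n), m)) :
  path (fun i => a i + b i) n *m Q != 0 ->
  exists sg : nat -> bool, path (fun i => if sg i then a i else b i) n *m Q != 0.
Proof.
elim: n m Q => [|n IH] m Q /=; first by exists xpredT.
rewrite mulmxDr mulmxDl => nz.
have [c nzc] : exists c : bool,
    path (fun i => a i + b i) n *m ((if c then a n else b n) *m Q) != 0.
  have [za|] := eqVneq (path (fun i => a i + b i) n *m a n *m Q) 0; last first.
    by exists true; rewrite mulmxA.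
  by exists false; rewrite mulmxA; rewrite za add0r in nz.
have [sg nzs] := IH _ _ nzc.
exists (fun i => if (i < n)%N then sg i else c).
rewrite /= ltnn -mulmxA (@path_mx_ext _ (fun i => if sg i then a i else b i)) //.
by move=> i ->.
Qed.

Lemma path_mx_neq0 f n i : (i < n)%N -> path f n != 0 -> f i != 0.
Proof.
elim: n => [|n IH] //=; rewrite ltnS leq_eqVlt => /predU1P [->|lt] nz.
  by apply: contraNneq nz => ->; rewrite mulmx0.
by apply: IH => //; apply: contraNneq nz => ->; rewrite mul0mx.
Qed.

Lemma path_Rad f n : (forall i, (i < n)%N -> Rad 1 (f i)) -> Rad n (path f n).
Proof.
elim: n => [|n IH] h /=; first by apply/Rad0P/hm_1.
have := Rad_M (IH (fun i lt => h i (ltnW lt))) (h n (ltnSn n)); by rewrite addn1.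
Qed.

(** Modulo the next power, the composite of the g i is the product of the scalars t i times the
    composite of the f i, which is zero. *)
Lemma path_Rad_S f g (t : nat -> k) n : (forall i, (i < n)%N -> Rad 1 (f i)) ->
  (forall i, (i < n)%N -> Rad 1 (g i)) ->
  (forall i, (i < n)%N -> Rad 2 (g i - t i *: f i)) -> path f n = 0 -> Rad n.+1 (path g n).
Proof.
move=> Rf Rg Rgf f0.
suff : Rad n.+1 (path g n - (\prod_(i < n) t i) *: path f n).
  by rewrite f0 scaler0 subr0.
elim: n Rf Rg Rgf {f0} => [|n IH] Rf Rg Rgf /=.
  by rewrite big_ord0 scale1r subrr; apply: Rad_0.
have {}IH : Rad n.+1 (path g n - (\prod_(i < n) t i) *: path f n).
  by apply: IH => i lt; [apply: Rf|apply: Rg|apply: Rgf]; apply: ltnW.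
rewrite big_ord_recr /=; set u := \prod_(i < n) t i.
have -> : path g n *m g n - (u * t n) *: (path f n *m f n) =
    (path g n - u *: path f n) *m g n + u *: (path f n *m (g n - t n *: f n)).
  by rewrite mulmxBl mulmxBr scalerBr -scalemxAl -scalemxAr scalerA addrA subrK.
apply: Rad_D; first by have := Rad_M IH (Rg n (ltnSn n)); rewrite addn1.
apply: Rad_Z; have Rp : Rad n (path f n) by apply: path_Rad => i lt; apply/Rf/ltnW.
by have := Rad_M Rp (Rgf n (ltnSn n)); rewrite addn2.
Qed.

Lemma mhoms_of_mat f : (forall i, hm (f i)) ->
  exists g : forall i, mhom (X i) (X i.+1), forall i, mat (g i) = f i.
Proof.
move=> hf; pose g i := constructive_indefinite_description _ (hom_of_mat (hf i)).
by exists (fun i => sval (g i)) => i; apply: (svalP (g i)).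
Qed.

End Paths.

Lemma Rad2_congr (k : fieldType) (A : falgType k) (M N : modA A)
    (F G : 'M[k]_(dm M, dm N)) (c : k) : c != 0 -> Rad 2 (G - c *: F) ->
  Rad 1 F /\ ~ Rad 2 F -> Rad 1 G /\ ~ Rad 2 G.
Proof.
move=> c0 RGF [RF nRF]; split.
  by rewrite -(subrK (c *: F) G); apply: Rad_D; [apply: Rad_S|apply: Rad_Z].
move=> RG; apply: nRF; rewrite -[F](scalerK c0); apply: Rad_Z.
by rewrite -[c *: F](subKr G); apply: Rad_D => //; apply: Rad_N.
Qed.

(* Indices start at 0: X i stands for X_{i+1}; only X 0, ..., X n and the
   morphisms with index i < n matter. *)
Theorem mainTheorem3 (k : fieldType) (k_perfect : perfect_field k)
    (A : falgType k) (indA : modA A -> Prop) (indA_ind : is_ind indA)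
    (n : nat) (n_ge1 : (1 <= n)%N)
    (X : nat -> modA A) (X_ind : forall i, (i <= n)%N -> indA (X i)) :
  (exists h : forall i, mhom (X i) (X i.+1),
     [/\ forall i, (i < n)%N -> irreducible_hom (h i),
         rad_pow n.+1 (comp_seq h n)
       & ~ (comp_seq h n =1 mzero (X 0%N) (X n))])
  <->
  (exists (f : forall i, mhom (X i) (X i.+1))
          (eps : forall i, mhom (X i) (X i.+1)),
     [/\ forall i, (i < n)%N -> irreducible_hom (f i),
         comp_seq f n =1 mzero (X 0%N) (X n),
         ~ (comp_seq eps n =1 mzero (X 0%N) (X n))
       & forall i, (i < n)%N -> rad_pow 2 (eps i) \/ eps i =1 f i]).
Proof.
have indX i : (i <= n)%N -> indecomposable (X i).
  by move=> le; apply: (indec_of_I indA_ind); apply: X_ind.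
have irrP i (f : mhom (X i) (X i.+1)) : (i < n)%N ->
    irreducible_hom f <-> Rad 1 (mat f) /\ ~ Rad 2 (mat f).
  by move=> lt; apply: (irreducible_Rad indA_ind); apply: indX => //; apply: ltnW.
split=> [[h [irr Rh nz]]|[f [eps [irr f0 eps0 epsP]]]].
  pose H i := mat (h i).
  have HP i : (i < n)%N -> Rad 1 (H i) /\ ~ Rad 2 (H i) by move=> lt; apply/irrP/irr.
  have [|F [hF RF F0]] := strict_representatives k_perfect indA_ind (n := n) (h := H)
    (fun i lt => (HP i lt).1).
    by rewrite -mat_comp_seq; apply/rad_pow_mat.
  have : path_mx (fun i => F i + (H i - F i)) n *m 1%:M != 0.
    rewrite mulmx1; apply/eqP => H0; apply/nz/comp_seq_zero; rewrite -H0.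
    by apply: path_mx_ext => i _; rewrite addrC subrK.
  case/path_mx_expand => sg; rewrite mulmx1 => nzs.
  have [f Ef] := mhoms_of_mat hF.
  have [|eps Eeps] := @mhoms_of_mat _ _ _ (fun i => if sg i then F i else H i - F i).
    by move=> i; case: ifP => // _; apply: hm_B => //; apply: mat_hm.
  exists f, eps; split.
  - move=> i lt; apply/irrP => //; rewrite Ef; apply: (@Rad2_congr _ _ _ _ (H i) _ 1).
    + exact: oner_neq0.
    + by rewrite scale1r -opprB; apply: Rad_N; apply: RF.
    + exact: HP.
  - by apply/comp_seq_zero; rewrite -F0; apply: path_mx_ext => i _; apply: Ef.
  - move/comp_seq_zero => e0; case/eqP: nzs; rewrite -e0.
    by apply: path_mx_ext => i _; rewrite Eeps.
  - move=> i lt; case E: (sg i).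
      by right; apply/mat_inj; rewrite Ef Eeps E.
    by left; apply/rad_pow_mat; rewrite Eeps E; apply: RF.
pose F i := mat (f i); pose G i := mat (eps i).
have FP i : (i < n)%N -> Rad 1 (F i) /\ ~ Rad 2 (F i) by move=> lt; apply/irrP/irr.
have {}epsP i : (i < n)%N -> Rad 2 (G i) \/ G i = F i.
  by move=> /epsP [/rad_pow_mat|/mat_inj]; [left|right].
(* In both cases a i + b i is G i: either (F i + G i) + (- F i), or F i + 0 at the places where the
   two morphisms coincide. *)
pose a i := if excluded_middle_informative (Rad 2 (G i)) then F i + G i else F i.
pose b i := if excluded_middle_informative (Rad 2 (G i)) then - F i else 0.
have : path_mx (fun i => a i + b i) n *m 1%:M != 0.
  rewrite mulmx1; apply/eqP => ab0; apply/eps0/comp_seq_zero; rewrite -ab0.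
  apply: path_mx_ext => i lt; rewrite /a /b.
  case: excluded_middle_informative => [?|nR] /=; first by rewrite addrC addKr.
  by rewrite addr0; case: (epsP i lt).
case/path_mx_expand => sg; rewrite mulmx1; set c := (fun i => _) => nzc.
pose t i : k := if sg i then 1 else -1.
have cF i : (i < n)%N -> Rad 2 (c i - t i *: F i).
  (* A nonzero product cannot contain the summand 0, so c i is F i + G i, F i or - F i, each
     congruent to [t i *: F i]. *)
  move=> lt; have := path_mx_neq0 lt nzc; rewrite /c /t /a /b.
  case: (sg i); case: excluded_middle_informative => [RG|nRG]; rewrite ?eqxx // => _.
  - by rewrite scale1r addrC addKr.
  - by rewrite scale1r subrr; apply: Rad_0.
  - by rewrite scaleN1r subrr; apply: Rad_0.
have cP i : (i < n)%N -> Rad 1 (c i) /\ ~ Rad 2 (c i).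
  move=> lt; apply: Rad2_congr (cF i lt) (FP i lt).
  by rewrite /t; case: ifP => _; rewrite ?oppr_eq0 oner_eq0.
have [|h Eh] := @mhoms_of_mat _ _ _ c.
  move=> i; rewrite /c /a /b; case: ifP => _; case: excluded_middle_informative => ? /=.
  - by apply: hm_D; apply: mat_hm.
  - exact: mat_hm.
  - by rewrite -scaleN1r; apply/hm_Z/mat_hm.
  - exact: hm_0.
have Ehc : path_mx (fun i => mat (h i)) n = path_mx c n.
  by apply: path_mx_ext => i _; apply: Eh.
exists h; split.
- by move=> i lt; apply/irrP => //; rewrite Eh; apply: cP.
- apply/rad_pow_mat; rewrite mat_comp_seq Ehc; apply: (@path_Rad_S _ _ _ F _ t) => //.
  + by move=> i lt; case: (FP i lt).
  + by move=> i lt; case: (cP i lt).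
  + exact/comp_seq_zero.
- by move/comp_seq_zero; rewrite Ehc => c0; rewrite c0 eqxx in nzc.
Qed.
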